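(* Let $\mathfrak{g}$ be a vector space over $\mathbf{k}$, and let $\mathfrak{m}:=\mathrm{Hom}(\bigwedge\mathfrak{g},\mathfrak{g})$ and $\mathfrak{a}:=\mathrm{Hom}(\bigwedge\mathfrak{g},\mathfrak{g})$. There exists an $L_\infty[1]$-algebra structure $\{l_i\}_{i\ge 1}$ on $s\mathfrak{m}\oplus\mathfrak{a}$ given as follows. For homogeneous $f\in\mathrm{Hom}(\wedge^{n+1}\mathfrak{g},\mathfrak{g})\subseteq\mathfrak{m}$, $g\in\mathrm{Hom}(\wedge^{m+1}\mathfrak{g},\mathfrak{g})\subseteq\mathfrak{m}$ and $\xi_j\in\mathrm{Hom}(\wedge^{m_j+1}\mathfrak{g},\mathfrak{g})\subseteq\mathfrak{a}$, $1\le j\le i-1$, $$l_1(sf)=-A_n f\in\mathfrak{a},\qquad l_2(sf,sg)=(-1)^{|f|}s[f,g]_{\mathrm{NR}}\in s\mathfrak{m},$$ and for $i\ge 2$, $l_i(sf,\xi_1,\dots,\xi_{i-1})\in\mathfrak{a}$ is $$-\sum_{\tau\in\mathrm{Sh}(m_1+1,\dots,m_{i-1}+1,\,n+2-i)}\mathrm{sgn}(\tau)\,A_{n-i+1}\big(f(\xi_1\otimes\cdots\otimes\xi_{i-1}\otimes\mathrm{Id}^{\otimes n+2-i})\big)\tau^{-1}$$ $$-\sum_{k=1}^{i-1}\ \sum_{\tau\in\mathrm{Sh}(m_1+1,\dots,\widehat{m_k+1},\dots,m_{i-1}+1,\,n+3-i,\,m_k)}\mathrm{sgn}(\tau)(-1)^{(n+\sum_{j=1}^{k-1}m_j)m_k}\,B_{n-i+3}\;\xi_k\big(f(\xi_1\otimes\cdots\otimes\widehat{\xi_k}\otimes\cdots\otimes\xi_{i-1}\otimes\mathrm{Id}^{\otimes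 n+3-i})\otimes\mathrm{Id}^{\otimes m_k}\big)\tau^{-1},$$ where a hat means omission; all components of $\{l_i\}_{i\ge1}$ other than $l_1(sf)$, $l_2(sf,sg)$, $l_i(sf,\xi_1,\dots,\xi_{i-1})$ for $i\ge2$, and those obtained from these components by graded symmetry, vanish.
   Context: $\mathbf{k}$ is a field of characteristic $0$, $\mu,\lambda\in\mathbf{k}$, and $\mathbf{k}$ contains a square root $t=\sqrt{\mu^2-4\lambda}$. Constants: $B_n:=\frac1t\big((\frac{\mu+t}{2})^n-(\frac{\mu-t}{2})^n\big)$ for $n\ge 0$ and $A_n:=\frac{\lambda}{t}\big((\frac{\mu+t}{2})^n-(\frac{\mu-t}{2})^n\big)$ for $n\ge 0$, read formally as the resulting polynomials in $\mu,\lambda$ (so also when $t=0$): $B_0=0$, $B_1=1$, $B_{n+1}=\mu B_n-\lambda B_{n-1}$, and $A_n=\lambda B_n$ for $n\ge0$. By convention $A_{-1}=-1$ (even if $\lambda=0$). Grading: $\mathrm{Hom}(\bigwedge\mathfrak{g},\mathfrak{g})=\bigoplus_{n\ge -1}\mathrm{Hom}(\wedge^{n+1}\mathfrak{g},\mathfrak{g})$, with $|f|=n$ if $f\in\mathrm{Hom}(\wedge^{n+1}\mathfrak{g},\mathfrak{g})$. The shift is $(sV)^n=V^{n+1}$, so $sf$ has degree $|f|-1$. $\mathrm{Sh}(i_1,\dots,i_r)$ is the set of permutations of $\{1,\dots,i_1+\cdots+i_r\}$ increasing on each of the consecutive blocks of sizes $i_1,\dots,i_r$. For $\sigma\in S_N$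 and an $N$-ary map $F$, $(F\sigma^{-1})(x_1,\dots,x_N):=F(x_{\sigma(1)},\dots,x_{\sigma(N)})$. Sums over shuffles in which some block size is negative are zero. Nijenhuis-Richardson bracket: for $P\in\mathrm{Hom}(\wedge^{p+1}\mathfrak{g},\mathfrak{g})$, $Q\in\mathrm{Hom}(\wedge^{q+1}\mathfrak{g},\mathfrak{g})$, $[P,Q]_{\mathrm{NR}}=P\bar\circ Q-(-1)^{pq}Q\bar\circ P$, where $(P\bar\circ Q)(x_1,\dots,x_{p+q+1})=\sum_{\sigma\in\mathrm{Sh}(q+1,p)}\mathrm{sgn}(\sigma)P(Q(x_{\sigma(1)},\dots,x_{\sigma(q+1)}),x_{\sigma(q+2)},\dots,x_{\sigma(p+q+1)})$. Composition with tensor products follows the Koszul rule in which elements of $\mathfrak{g}$ count as odd and $\xi_j$ has degree $m_j$: $f(\eta_1\otimes\cdots\otimes\eta_p\otimes\mathrm{Id}^{\otimes q})$, with $\eta_a$ of degree $r_a$ and arity $r_a+1$, is the map sending $(x_1,x_2,\dots)$ to $(-1)^{\sum_{1\le a<b\le p}r_b(r_a+1)}f(\eta_1(x_1,\dots,x_{r_1+1}),\eta_2(x_{r_1+2},\dots),\dots,\eta_p(\dots),\text{remaining }q\text{ elements})$; and $\xi(F\otimes\mathrm{Id}^{\otimes r})$ inserts $F$ (on the first inputs) in the first slot of $\xi$ with no extra sign. An $L_\infty[1]$-algebra is a graded vector space $L$ with maps $l_n:L^{\otimes n}\to L$, $n\ge1$, of degree $1$ such that $l_n(x_{\sigma(1)},\dots,x_{\sigma(n)})=\varepsilon(\sigma)l_n(x_1,\dots,x_n)$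 and $\sum_{i=1}^n\sum_{\sigma\in\mathrm{Sh}(i,n-i)}\varepsilon(\sigma)l_{n-i+1}(l_i(x_{\sigma(1)},\dots,x_{\sigma(i)}),x_{\sigma(i+1)},\dots,x_{\sigma(n)})=0$ for all homogeneous $x_j$, where $\varepsilon(\sigma)$ is the Koszul sign: $x_1\odot\cdots\odot x_n=\varepsilon(\sigma)x_{\sigma(1)}\odot\cdots\odot x_{\sigma(n)}$ in the graded symmetric algebra. *)

(* Defs.v *)
From HB Require Import structures.
From mathcomp Require Import all_boot all_order all_algebra all_fingroup.
From mathcomp Require Import boolp classical_sets functions.
From mathcomp Require Import ring.

Set Implicit Arguments.
Unset Strict Implicit.
Unset Printing Implicit Defensive.

Import GRing.Theory.
Local Open Scope ring_scope.

(** An N-ary map on [V] is encoded as (the restriction to sequences of size N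
    of) a function on [seq V]; a function on [seq V] is thus a family of N-ary
    maps, one for each N, and [multilinear] says that all of them are
    multilinear (nothing is required on the empty sequence). *)
Definition multilinear (k : fieldType) (V W : lmodType k) (F : seq V -> W) :
    Prop :=
  forall (s1 s2 : seq V) (a : k) (u v : V),
    F (s1 ++ (a *: u + v) :: s2) =
    a *: F (s1 ++ u :: s2) + F (s1 ++ v :: s2).

Definition alternating (V W : nmodType) (F : seq V -> W) : Prop :=
  forall (s1 s2 s3 : seq V) (u : V), F (s1 ++ u :: s2 ++ u :: s3) = 0.

(** [cochain g] is Hom(/\g, g), the direct sum over N of the spaces of
    alternating N-linear maps g^N -> g: an element has one component for each
    N, almost all of which vanish. *)
Section Cochain.
Variables (k : fieldType) (g : lmodType k).

Definition cochain_pred : {pred (seq g -> g)} :=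
  fun F => `[< [/\ multilinear F, alternating F
                 & exists N, forall x, (N <= size x)%N -> F x = 0] >].

Lemma cochain_submod_closed : submod_closed cochain_pred.
Proof.
split=> [|a F G /asboolP[mF aF [N hF]] /asboolP[mG aG [M hG]]].
- apply/asboolP; split=> [s1 s2 a u v|s1 s2 s3 u|] //.
    by rewrite /GRing.zero /= scaler0 addr0.
  by exists 0%N.
- apply/asboolP; split=> [s1 s2 b u v|s1 s2 s3 u|].
  + change (a *: F (s1 ++ (b *: u + v) :: s2) + G (s1 ++ (b *: u + v) :: s2) =
      b *: (a *: F (s1 ++ u :: s2) + G (s1 ++ u :: s2))
      + (a *: F (s1 ++ v :: s2) + G (s1 ++ v :: s2))).
    by rewrite mF mG !scalerDr !scalerA (mulrC a b) addrACA.
  + change (a *: F (s1 ++ u :: s2 ++ u :: s3)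
      + G (s1 ++ u :: s2 ++ u :: s3) = 0).
    by rewrite aF aG scaler0 addr0.
  + exists (maxn N M) => x; rewrite geq_max => /andP[hN hM].
    change (a *: F x + G x = 0).
    by rewrite hF // hG // scaler0 addr0.
Qed.

HB.instance Definition _ :=
  GRing.isSubmodClosed.Build k (seq g -> g) cochain_pred cochain_submod_closed.

Record cochain := Cochain { cochain_fun :> seq g -> g;
                            _ : cochain_fun \in cochain_pred }.

HB.instance Definition _ := [isSub for cochain_fun].
HB.instance Definition _ := [Choice of cochain by <:].
HB.instance Definition _ :=
  [SubChoice_isSubLmodule of cochain by <:].

(** Hom(/\^(n+1) g, g), the piece of degree n; it is 0 for n < -1. *)
Definition cochain_deg (n : int) (F : cochain) : Prop :=
  forall x : seq g, (size x)%:Z <> n + 1 -> F x = 0.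

End Cochain.

(** The graded space sm (+) a, where (sm)^d = m^(d+1). *)
Section TotalSpace.
Variables (k : fieldType) (g : lmodType k).

Definition sm_a : lmodType k := (cochain g * cochain g)%type.

Definition in_sm (f : cochain g) : sm_a := (f, 0).
Definition in_a (xi : cochain g) : sm_a := (0, xi).

(** Elements of the disjoint union of sm and a: [inl] is sm, [inr] is a. *)
Definition is_sm (z : cochain g + cochain g) : bool :=
  if z is inl _ then true else false.
Definition of_summand (z : cochain g + cochain g) : sm_a :=
  match z with inl f => in_sm f | inr xi => in_a xi end.

Definition sm_a_deg (d : int) (u : sm_a) : Prop :=
  cochain_deg (d + 1) u.1 /\ cochain_deg d u.2.

End TotalSpace.

(** x_sigma(1), ..., x_sigma(N); [x0] is a default value, which is irrelevant
    when [size x = N]. *)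
Definition permuted (T : Type) (x0 : T) (N : nat) (sigma : 'S_N) (x : seq T) :
    seq T :=
  [seq nth x0 x (sigma i) | i <- enum 'I_N].

(** Block sizes are integers, so that there is no shuffle when one of them is
    negative. *)
Definition shuffle (b : seq int) (N : nat) (sigma : 'S_N) : bool :=
  [&& all (fun z => 0 <= z) b, \sum_(z <- b) z == N%:Z
    & all (sorted ltn) (reshape [seq absz z | z <- b]
                                [seq val (sigma i) | i <- enum 'I_N])].

(** Sum over tau in Sh(b) of sgn(tau) F tau^-1, which vanishes on sequences
    whose size is not the sum of the blocks. *)
Definition shuffle_sum (k : fieldType) (g : lmodType k) (b : seq int)
    (F : seq g -> g) (x : seq g) : g :=
  \sum_(tau : 'S_(size x) | shuffle b tau)
    ((-1) ^+ (odd_perm tau) : k) *: F (permuted 0 tau x).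

(** Graded vector spaces are given by an internal direct sum decomposition:
    [G d] is the subspace of homogeneous elements of degree [d]. *)
Record is_grading (k : fieldType) (L : lmodType k) (G : int -> L -> Prop) :
    Prop := IsGrading {
  grading0 : forall d, G d 0;
  gradingD : forall d a u v, G d u -> G d v -> G d (a *: u + v);
  grading_span : forall u, exists (ds : seq int) (c : int -> L),
    (forall d, G d (c d)) /\ u = \sum_(d <- ds) c d;
  grading_free : forall (ds : seq int) (c : int -> L),
    uniq ds -> (forall d, G d (c d)) -> \sum_(d <- ds) c d = 0 ->
    forall d, d \in ds -> c d = 0
}.

(** The exponents of signs are integers, possibly negative. *)
Definition koszul_sign (k : fieldType) (N : nat) (sigma : 'S_N)
    (d : seq int) : k :=
  \prod_(i < N) \prod_(j < N | (i < j)%N && (sigma j < sigma i)%N)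
    (-1) ^ (d`_(sigma i) * d`_(sigma j)).

(** The operation l_n is the restriction of [l] to sequences of size n >= 1;
    [l [::]] is irrelevant. *)
Record is_Linfty1 (k : fieldType) (L : lmodType k) (G : int -> L -> Prop)
    (l : seq L -> L) : Prop := IsLinfty1 {
  Linfty1_grading : is_grading G;
  Linfty1_multilinear : multilinear l;
  Linfty1_degree : forall (x : seq L) (d : seq int),
    (0 < size x)%N -> size d = size x ->
    (forall j, (j < size x)%N -> G d`_j x`_j) ->
    G (\sum_(e <- d) e + 1) (l x);
  Linfty1_symmetric : forall (n : nat) (x : seq L) (d : seq int)
      (sigma : 'S_n),
    (0 < n)%N -> size x = n -> size d = n ->
    (forall j, (j < n)%N -> G d`_j x`_j) ->
    l (permuted 0 sigma x) = koszul_sign k sigma d *: l x;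
  Linfty1_jacobi : forall (n : nat) (x : seq L) (d : seq int),
    (0 < n)%N -> size x = n -> size d = n ->
    (forall j, (j < n)%N -> G d`_j x`_j) ->
    \sum_(1 <= i < n.+1)
      \sum_(sigma : 'S_n | shuffle [:: i%:Z; (n - i)%N%:Z] sigma)
        koszul_sign k sigma d *:
          l (l (take i (permuted 0 sigma x)) :: drop i (permuted 0 sigma x))
    = 0
}.

Section Constants.
Variables (k : fieldType) (mu lam : k).

Fixpoint coefB_pair (n : nat) : k * k :=
  if n is m.+1 then
    let: (b, b') := coefB_pair m in (b', mu * b' - lam * b)
  else (0, 1).

(** B_0 = 0, B_1 = 1, B_(n+2) = mu B_(n+1) - lam B_n; only indices n >= 0 are
    meaningful. *)
Definition coefB (n : int) : k :=
  if n is Posz m then (coefB_pair m).1 else 0.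

(** Only indices n >= -1 are meaningful. *)
Definition coefA (n : int) : k :=
  if n is Posz m then lam * coefB m else -1.

Lemma coefB_rec (n : nat) :
  coefB n.+2 = mu * coefB n.+1 - lam * coefB n.
Proof. by rewrite /coefB /=; case: (coefB_pair n). Qed.

Lemma coefB_closed_form (t : k) (n : nat) :
    (2 : k) != 0 -> t != 0 -> t ^+ 2 = mu ^+ 2 - 4 * lam ->
  coefB n = t^-1 * (((mu + t) / 2) ^+ n - ((mu - t) / 2) ^+ n).
Proof.
move=> two0 t0 tE.
pose p := (mu + t) / 2; pose q := (mu - t) / 2.
have pDq : p + q = mu by rewrite /p /q; field.
have pBq : p - q = t by rewrite /p /q; field.
have pq : p * q = lam.
  have -> : p * q = (mu ^+ 2 - t ^+ 2) / 4.
    by rewrite /p /q; field; rewrite (natrM k 2 2) mulf_neq0.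
  by rewrite tE; field; rewrite (natrM k 2 2) mulf_neq0.
rewrite -/p -/q.
suff: coefB n = t^-1 * (p ^+ n - q ^+ n) /\
      coefB n.+1 = t^-1 * (p ^+ n.+1 - q ^+ n.+1) by case.
elim: n => [|n [IH0 IH1]].
  by rewrite !expr0 subrr mulr0 !expr1 pBq mulVf.
split=> //.
by rewrite coefB_rec IH0 IH1 -pDq -pq !exprS; ring.
Qed.

End Constants.

Section Brackets.
Variables (k : fieldType) (g : lmodType k).
Implicit Types (P Q f F : seq g -> g) (x : seq g).

Definition arity (n : int) : nat := absz (n + 1).

(** F (x) Id^(x)r inserted in [xi], where F has arity N. *)
Definition insert_first (xi F : seq g -> g) (N : nat) (x : seq g) : g :=
  xi (F (take N x) :: drop N x).

Definition NR_circ (p q : int) P Q : seq g -> g :=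
  shuffle_sum [:: q + 1; p] (insert_first P Q (arity q)).

Definition NR_bracket (p q : int) P Q (x : seq g) : g :=
  NR_circ p q P Q x - ((-1) ^ (p * q) : k) *: NR_circ q p Q P x.

(** f (eta_1 (x) ... (x) eta_p (x) Id (x) ... (x) Id), where the eta_a have
    degrees [r]. *)
Definition comp_tensor f (r : seq int) (eta : seq (seq g -> g)) (x : seq g) :
    g :=
  ((-1) ^ (\sum_(b < size r) \sum_(a < b) r`_b * (r`_a + 1)) : k) *:
  f ([seq e.1 e.2 | e <- zip eta (reshape (map arity r) x)]
     ++ drop (sumn (map arity r)) x).

End Brackets.

(** Removes the entry of index [j] (counted from 0). *)
Definition omit (T : Type) (j : nat) (s : seq T) : seq T :=
  take j s ++ drop j.+1 s.

(** The a-component of l_i(s f, xi_1, ..., xi_(i-1)) for f of degree [n] and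
    xi_j of degree m_j. The index [j] below is k - 1, so that xi_k and m_k
    are the entries of index [j] of [xi] and [m]. *)
Section HigherBracket.
Variables (k : fieldType) (g : lmodType k) (mu lam : k).
Variables (i : nat) (n : int) (f : seq g -> g).
Variables (m : seq int) (xi : seq (seq g -> g)).

Definition higher_term1 (x : seq g) : g :=
  coefA mu lam (n - i%:Z + 1) *:
  shuffle_sum (rcons [seq e + 1 | e <- m] (n + 2 - i%:Z))
    (comp_tensor f m xi) x.

Definition higher_term2 (j : nat) (x : seq g) : g :=
  let b := rcons [seq e + 1 | e <- omit j m] (n + 3 - i%:Z) in
  (((-1) ^ ((n + \sum_(h < j) m`_h) * m`_j) : k)
     * coefB mu lam (n - i%:Z + 3)) *:
  shuffle_sum (rcons b m`_j)
    (insert_first (nth (fun=> 0) xi j) (comp_tensor f (omit j m) (omit j xi))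
       (absz (\sum_(z <- b) z))) x.

Definition higher_bracket (x : seq g) : g :=
  - higher_term1 x - \sum_(j < i.-1) higher_term2 j x.

End HigherBracket.

(* Main.v *)
Require Import Defs.
From HB Require Import structures.
From mathcomp Require Import all_boot all_order all_algebra all_fingroup.
From mathcomp Require Import boolp ring zify.

(** Let R = k[T]/(T^2 - mu T + lam). In R one has T^n = B_n T - A_(n-1), which
    is where the constants come from. Extending f in m to an R-multilinear map
    on g (x) R = g + gT embeds m, as a graded Lie algebra, in the
    Nijenhuis-Richardson algebra of g + gT, in which a = Hom(/\ gT, g) is an
    abelian subalgebra. Let P restrict a map to gT and keep the coefficient of 1
    of its values; then P[u, v] = P[Pu, v] + P[u, Pv], and Voronov's derived
    brackets P[...[f, xi_1], ..., xi_p] form an L_oo[1]-structure on sm + a. The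
    quadratic identity between them follows from the displayed property of P,
    applied to the Leibniz expansion of [...[[f, h], xi_1], ..., xi_p].

    Alternating maps are handled through the contractions F(y, -): all the
    shuffle sums satisfy recursions in the first argument, so that each identity
    is proved by induction on the list of arguments. *)

(** The indices of the constants count free arguments. Evaluate P[...[f, xi_1], ..., xi_p] on
    arguments from gT: a slot of f filled by some xi receives a value in g and contributes no T,
    while every other slot contributes one. With all p maps inserted, n + 1 - p slots are free and P
    reads the coefficient of 1 in T^(n+1-p), which is -A_(n-p); the convention A_(-1) = -1 is T^0 =
    1. A xi may also be outermost. It then reads the coefficient of T of what is inserted in it, and
    n + 2 - p slots of f are free, whence B_(n+2-p). At most one xi is outermost, since its values
    lie in g, which the other elements of a do not see. The theorem has i = p + 1.

    The quadratic identity has to be proved for arbitrary homogeneous maps on g + gT, because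
    bracketing with some xi leaves the image of m.

    Signs depend on degrees only through parities, so that sign checks become finite case
    distinctions. [twist] carries the sign (-1)^degree on maps that need not be homogeneous, which
    keeps the recursions free of degrees. *)

Set Implicit Arguments.
Unset Strict Implicit.
Unset Printing Implicit Defensive.

Import GRing.Theory.
Local Open Scope ring_scope.

(** * Linear combinations *)

Section LinearExpressions.
Variables (k : comPzRingType) (V : lmodType k).

Inductive lexp :=
  LVar of nat | LZero | LAdd of lexp & lexp | LOpp of lexp | LScale of k & lexp.

Fixpoint leval (env : seq V) (e : lexp) : V :=
  match e with
  | LVar n => env`_n
  | LZero => 0
  | LAdd e1 e2 => leval env e1 + leval env e2
  | LOpp e1 => - leval env e1
  | LScale a e1 => a *: leval env e1
  end.

(** The test is [eqn] so that [cbn] decides it on the indices produced by reification. *)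
Fixpoint lcoef (i : nat) (e : lexp) : k :=
  match e with
  | LVar n => if eqn n i then 1 else 0
  | LZero => 0
  | LAdd e1 e2 => lcoef i e1 + lcoef i e2
  | LOpp e1 => - lcoef i e1
  | LScale a e1 => a * lcoef i e1
  end.

Lemma leval_lcoef (env : seq V) (e : lexp) :
  leval env e = \sum_(i < size env) lcoef i e *: env`_i.
Proof.
elim: e => [n||e1 IH1 e2 IH2|e IH|a e IH] /=.
- case: (ltnP n (size env)) => hn.
    rewrite (bigD1 (Ordinal hn)) //= eqnE eqxx scale1r big1 ?addr0 // => i ni.
    by rewrite ifN ?scale0r // eq_sym.
  rewrite nth_default // big1 // => i _.
  by rewrite eqnE gtn_eqF ?scale0r // (leq_trans (ltn_ord i)).
- by rewrite big1 // => i _; rewrite scale0r.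
- by rewrite IH1 IH2 -big_split; apply: eq_bigr => i _; rewrite scalerDl.
- by rewrite IH -sumrN; apply: eq_bigr => i _; rewrite scaleNr.
- by rewrite IH scaler_sumr; apply: eq_bigr => i _; rewrite scalerA.
Qed.

(** Recursive rather than a quantification over indices: it unfolds to a finite conjunction with one
    goal for [ring] per atom. *)
Fixpoint lcoef_eq (n : nat) (e1 e2 : lexp) : Prop :=
  if n is n'.+1 then lcoef n' e1 = lcoef n' e2 /\ lcoef_eq n' e1 e2 else True.

Lemma leval_eq (env : seq V) (e1 e2 : lexp) :
  lcoef_eq (size env) e1 e2 -> leval env e1 = leval env e2.
Proof.
move=> h; rewrite !leval_lcoef; apply: eq_bigr => i _; congr (_ *: _).
elim: (size env) h i => [|n IH] /= h; first by case.
by case=> m /=; rewrite ltnS leq_eqVlt => /predU1P[->|hm]; [case: h|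
  apply: (IH h.2 (Ordinal hm))].
Qed.

End LinearExpressions.

Ltac lin_mem x env :=
  lazymatch env with
  | nil => constr:(false)
  | cons x _ => constr:(true)
  | cons _ ?env' => lin_mem x env'
  end.
Ltac lin_index x env :=
  lazymatch env with
  | cons x _ => constr:(O)
  | cons _ ?env' => let n := lin_index x env' in constr:(S n)
  end.
Ltac lin_atoms env t :=
  lazymatch t with
  | @GRing.add _ ?a ?b => let env1 := lin_atoms env a in lin_atoms env1 b
  | @GRing.opp _ ?a => lin_atoms env a
  | @GRing.scale _ _ ?c ?a => lin_atoms env a
  | @GRing.zero _ => env
  | _ => lazymatch lin_mem t env with
         | true => env
         | false => constr:(cons t env)
         end
  end.
Ltac lin_reify k env t :=
  lazymatch t with
  | @GRing.add _ ?a ?b =>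
      let a' := lin_reify k env a in let b' := lin_reify k env b in
      constr:(@LAdd k a' b')
  | @GRing.opp _ ?a => let a' := lin_reify k env a in constr:(@LOpp k a')
  | @GRing.scale _ _ ?c ?a =>
      let a' := lin_reify k env a in constr:(@LScale k c a')
  | @GRing.zero _ => constr:(@LZero k)
  | _ => let n := lin_index t env in constr:(@LVar k n)
  end.
(** Proves an equation between two linear combinations over [k]: the
    coefficients of each atom are compared by [ring]. *)
Ltac linear_over k :=
  lazymatch goal with
  | |- @eq ?T ?a ?b =>
      let env1 := lin_atoms (@nil T) a in
      let env := lin_atoms env1 b in
      let a' := lin_reify k env a in
      let b' := lin_reify k env b in
      refine (@leval_eq _ _ env a' b' _);
      cbn [lcoef_eq lcoef size eqn]; repeat split; rewrite ?expr0 ?expr1; ring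
  end.

(** * Alternating maps *)

Section AlternatingMaps.
Variables (k : fieldType) (V W : lmodType k).
Implicit Types (F : seq V -> W) (s : seq V) (u v : V).

Lemma multilinearD F : multilinear F -> forall s1 s2 u v,
  F (s1 ++ (u + v) :: s2) = F (s1 ++ u :: s2) + F (s1 ++ v :: s2).
Proof. by move=> mF s1 s2 u v; rewrite -[u in u + v]scale1r mF scale1r. Qed.

Lemma multilinear0 F : multilinear F -> forall s1 s2, F (s1 ++ 0 :: s2) = 0.
Proof.
by move=> mF s1 s2; rewrite -[X in X :: s2](addNr 0) -scaleN1r mF scaleN1r
  addNr.
Qed.

Lemma multilinearZ F : multilinear F -> forall s1 s2 a u,
  F (s1 ++ (a *: u) :: s2) = a *: F (s1 ++ u :: s2).
Proof.
by move=> mF s1 s2 a u; rewrite -[a *: u]addr0 mF (multilinear0 mF) addr0.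
Qed.

Lemma alternating_swap F : multilinear F -> alternating F ->
  forall s1 s2 u v, F (s1 ++ u :: v :: s2) = - F (s1 ++ v :: u :: s2).
Proof.
move=> mF aF s1 s2 u v; apply/eqP; rewrite -addr_eq0; apply/eqP.
have := aF s1 [::] s2 (u + v).
rewrite /= (multilinearD mF) -!(cat_rcons _ _ (u + v :: s2)) !(multilinearD mF)
  !cat_rcons.
by rewrite (aF s1 [::] s2 u) (aF s1 [::] s2 v) add0r addr0.
Qed.

(** Transpositions of neighbours bring equal arguments together. The recursions below can only treat
    equal arguments that are adjacent. *)
Lemma adjacent_alternating F : multilinear F ->
  (forall s1 s2 u, F (s1 ++ u :: u :: s2) = 0) -> alternating F.
Proof.
move=> mF aF.
have swapF s1 s2 u v : F (s1 ++ u :: v :: s2) = - F (s1 ++ v :: u :: s2).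
  apply/eqP; rewrite -addr_eq0; apply/eqP.
  have := aF s1 s2 (u + v).
  rewrite /= (multilinearD mF) -!(cat_rcons _ _ (u + v :: s2)) !(multilinearD
    mF) !cat_rcons.
  by rewrite !aF add0r addr0.
move=> s1 s2 s3 u; elim: s2 s1 => [|v s2 IH] s1 /=; first exact: aF.
by rewrite swapF -cat_rcons IH oppr0.
Qed.

Lemma multilinear_cons F y : multilinear F -> multilinear (fun s => F (y :: s)).
Proof. by move=> mF s1 s2 a u v; rewrite -!cat_cons mF. Qed.

Lemma alternating_cons F y : alternating F -> alternating (fun s => F (y :: s)).
Proof. by move=> aF s1 s2 s3 u; rewrite -!cat_cons aF. Qed.

End AlternatingMaps.

Section CochainBasics.
Variables (k : fieldType) (V : lmodType k).
Implicit Types (F G P : cochain V).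

Lemma cochain_multilinear F : multilinear F.
Proof. by case: F => F /= /asboolP[]. Qed.

Lemma cochain_alternating F : alternating F.
Proof. by case: F => F /= /asboolP[]. Qed.

Lemma cochain_bounded F : exists N, forall x, (N <= size x)%N -> F x = 0.
Proof. by case: F => F /= /asboolP[]. Qed.

Lemma cochain_eq F G : (forall s, F s = G s) -> F = G.
Proof. by move=> FG; apply: val_inj; apply: funext. Qed.

Lemma cochainD F G s : (F + G) s = F s + G s. Proof. by []. Qed.
Lemma cochainN F s : (- F) s = - F s. Proof. by []. Qed.
Lemma cochainZ a F s : (a *: F) s = a *: F s. Proof. by []. Qed.
Lemma cochain0 s : (0 : cochain V) s = 0. Proof. by []. Qed.

Definition cochainE := (cochainD, cochainN, cochainZ, cochain0).

Lemma cochain_cons_subproof y F : (fun s => F (y :: s)) \in @cochain_pred k V.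
Proof.
apply/asboolP; split.
- exact/multilinear_cons/cochain_multilinear.
- exact/alternating_cons/cochain_alternating.
- by have [N hN] := cochain_bounded F; exists N => x hx; apply: hN; rewrite
  ltnW.
Qed.

Definition contract y F : cochain V := Cochain (cochain_cons_subproof y F).

Lemma contractE y F s : contract y F s = F (y :: s). Proof. by []. Qed.

Lemma contractD y z F : contract (y + z) F = contract y F + contract z F.
Proof.
by apply: cochain_eq => s; apply: (multilinearD (@cochain_multilinear F) [::]).
Qed.

Lemma contractZ a y F : contract (a *: y) F = a *: contract y F.
Proof.
by apply: cochain_eq => s; apply: (multilinearZ (@cochain_multilinear F) [::]).
Qed.

Lemma contract0 F : contract 0 F = 0.
Proof.
by apply: cochain_eq => s; apply: (multilinear0 (@cochain_multilinear F) [::]).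
Qed.

Lemma contract_swap u v F : contract u (contract v F) = - contract v (contract u
  F).
Proof.
apply: cochain_eq => s; rewrite cochainN !contractE.
exact: (alternating_swap (@cochain_multilinear F) (@cochain_alternating F)
  [::]).
Qed.

(** The degree of an N-ary map is N - 1, whence the successor. *)
Definition twistf (F : seq V -> V) s : V := (-1) ^+ (size s).+1 *: F s.

(** The component of degree [b] mod 2; its arity has the opposite parity. *)
Definition partf (b : bool) (F : seq V -> V) s : V :=
  if odd (size s) == b then 0 else F s.

(** Serves [twist], [part] and the homogeneous components, each of which rescales every arity by its
    own scalar. *)
Lemma cochain_scale_subproof (c : nat -> k) F :
  (fun s => c (size s) *: F s) \in @cochain_pred k V.
Proof.
apply/asboolP; split=> [s1 s2 a u v|s1 s2 s3 u|].
- rewrite (cochain_multilinear F) scalerDr !scalerA (mulrC _ a) !size_cat /=.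
  by [].
- by rewrite cochain_alternating scaler0.
- by have [N hN] := cochain_bounded F; exists N => x hx; rewrite hN ?scaler0.
Qed.

Lemma twist_subproof F : twistf F \in @cochain_pred k V.
Proof. exact: (cochain_scale_subproof (fun n => (-1) ^+ n.+1)). Qed.

Lemma part_subproof b F : partf b F \in @cochain_pred k V.
Proof.
rewrite (_ : partf b F =
  fun s => (if odd (size s) == b then 0 else 1) *: F s).
  exact: (cochain_scale_subproof (fun n => if odd n == b then 0 else 1)).
by apply: funext => s; rewrite /partf; case: ifP; rewrite ?scale0r ?scale1r.
Qed.

Definition twist F : cochain V := Cochain (twist_subproof F).
Definition part b F : cochain V := Cochain (part_subproof b F).

Lemma twistE F s : twist F s = (-1) ^+ (size s).+1 *: F s. Proof. by []. Qed.
Lemma partE b F s : part b F s = if odd (size s) == b then 0 else F s.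
Proof. by []. Qed.

Lemma twist_is_linear : linear twist.
Proof.
move=> a F G; apply: cochain_eq => s; rewrite !(cochainE, twistE).
by rewrite scalerDr !scalerA mulrC.
Qed.
HB.instance Definition _ :=
  GRing.isLinear.Build k (cochain V) (cochain V) _ twist twist_is_linear.

Lemma part_is_linear b : linear (part b).
Proof.
move=> a F G; apply: cochain_eq => s; rewrite !(cochainE, partE).
by case: ifP; rewrite ?scaler0 ?addr0.
Qed.
HB.instance Definition _ b :=
  GRing.isLinear.Build k (cochain V) (cochain V) _ (part b) (part_is_linear b).

Lemma contract_is_linear y : linear (contract y).
Proof. by move=> a F G; apply: cochain_eq. Qed.
HB.instance Definition _ y :=
  GRing.isLinear.Build k (cochain V) (cochain V) _ (contract y)
    (contract_is_linear y).

Lemma contract_twist y F : contract y (twist F) = - twist (contract y F).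
Proof.
apply: cochain_eq => s; rewrite cochainN contractE !twistE /=.
by rewrite exprS mulN1r scaleNr.
Qed.

(** A map of degree d has arity d + 1, so degree parity [b] means vanishing on lists whose size has
    parity [b]. *)
Definition parity (b : bool) F := forall s, odd (size s) = b -> F s = 0.

Lemma parity_contract b y F : parity b F -> parity (~~ b) (contract y F).
Proof. by move=> hF s hs; rewrite contractE hF //= hs negbK. Qed.

Lemma twist_parity b F : parity b F -> twist F = (-1) ^+ b *: F.
Proof.
move=> hF; apply: cochain_eq => s; rewrite twistE cochainE.
case: (eqVneq (odd (size s)) b) => [/hF->|nb]; first by rewrite !scaler0.
rewrite -signr_odd /=; congr ((-1) ^+ nat_of_bool _ *: _).
by move: nb; case: (odd _); case: (b).
Qed.

Lemma part_parity b c F : parity b F -> part c F = if b == c then F else 0.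
Proof.
move=> hF; apply: cochain_eq => s; rewrite partE.
case: (eqVneq (odd (size s)) b) => [hs|nb].
  by rewrite (hF _ hs); case: (b == c) => //=; rewrite ?cochain0 ?(hF _ hs)
    if_same.
by move: nb {hF}; case: (odd _); case: b; case: c.
Qed.

Lemma parityD b a F G : parity b F -> parity b G -> parity b (a *: F + G).
Proof. by move=> hF hG s hs; rewrite !cochainE hF // hG // scaler0 addr0. Qed.

End CochainBasics.

(** * The Nijenhuis-Richardson bracket *)

Section Composition.
Variables (k : fieldType) (V : lmodType k).

(** The sum over (q+1, p)-shuffles of P(Q(...), ...), for Q of degree q, split
    according to whether the first argument is an argument of [Q] or of [P]. *)
Fixpoint circf (P Q : seq V -> V) (s : seq V) : V :=
  if s is y :: s' then
    circf P (fun t => Q (y :: t)) s' + circf (fun t => P (y :: t)) (twistf Q) s'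
  else P [:: Q [::]].

Lemma circf_ext (P P' Q Q' : seq V -> V) s :
  (forall t, P t = P' t) -> (forall t, Q t = Q' t) -> circf P Q s = circf P' Q'
    s.
Proof. by move=> /funext-> /funext->. Qed.

(** The combination [H] is given by its values, so that in the induction it can be replaced by its
    contraction. *)
Lemma circf_linearl a (P P' H Q : seq V -> V) s :
  (forall t, H t = a *: P t + P' t) ->
  circf H Q s = a *: circf P Q s + circf P' Q s.
Proof.
elim: s H P P' Q => [|y s IH] H P P' Q h /=; first exact: h.
rewrite (IH H P P') // (IH (fun t => H (y :: t)) (fun t => P (y :: t)) (fun t =>
  P' (y :: t))) //.
by rewrite scalerDr addrACA.
Qed.

Lemma circf_linearr a (P Q Q' H : seq V -> V) s : multilinear P ->
  (forall t, H t = a *: Q t + Q' t) ->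
  circf P H s = a *: circf P Q s + circf P Q' s.
Proof.
elim: s H P Q Q' => [|y s IH] H P Q Q' mP h /=.
  by rewrite h (mP [::] [::]).
rewrite (IH (fun t => H (y :: t)) P (fun t => Q (y :: t)) (fun t => Q' (y ::
  t))) //.
rewrite (IH (twistf H) _ (twistf Q) (twistf Q')).
- by rewrite scalerDr addrACA.
- exact: multilinear_cons.
- by move=> t; rewrite /twistf h scalerDr !scalerA mulrC.
Qed.

Lemma circf0l (P Q : seq V -> V) s : (forall t, P t = 0) -> circf P Q s = 0.
Proof.
move=> h; rewrite (@circf_linearl (-1) P P P) ?scaleN1r ?addNr //.
by move=> t; rewrite scaleN1r addNr.
Qed.

Lemma circf0r (P Q : seq V -> V) s :
  multilinear P -> (forall t, Q t = 0) -> circf P Q s = 0.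
Proof.
move=> mP h; rewrite (@circf_linearr (-1) P Q Q Q) ?scaleN1r ?addNr //.
by move=> t; rewrite scaleN1r addNr.
Qed.

Lemma circf_multilinear P Q :
  multilinear P -> multilinear Q -> multilinear (circf P Q).
Proof.
move=> mP mQ s1; elim: s1 P Q mP mQ => [|y s1 IH] P Q mP mQ s2 a u v /=.
  rewrite (@circf_linearr a P (fun t => Q (u :: t)) (fun t => Q (v :: t))
    (fun t => Q (a *: u + v :: t))) //.
    rewrite (@circf_linearl a (fun t => P (u :: t)) (fun t => P (v :: t))
      (fun t => P (a *: u + v :: t))).
      by rewrite scalerDr addrACA.
    by move=> t; apply: (mP [::]).
  by move=> t; apply: (mQ [::]).
rewrite (IH P) //; last exact: multilinear_cons.
rewrite (IH _ (twistf Q)); first by rewrite scalerDr addrACA.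
  exact: multilinear_cons.
move=> t1 t2 b u' v'; rewrite /twistf mQ scalerDr !scalerA !size_cat /=.
by rewrite mulrC.
Qed.

Implicit Types (P Q : cochain V).

Lemma circf_alternating P Q : alternating (circf P Q).
Proof.
apply: adjacent_alternating.
  by apply: circf_multilinear; apply: cochain_multilinear.
move=> s1 s2 u; elim: s1 P Q => [|y s1 IH] P Q /=.
  (* The two terms in which [P] and [Q] take one copy of [u] each cancel, because contraction
     anticommutes with [twist]. *)
  rewrite (@circf_linearr (-1) _ (twistf (contract u Q)) (fun=> 0) (fun t =>
    twistf Q (u :: t))); last first.
  - by move=> t; rewrite /twistf /= exprS mulN1r scaleNr scaleN1r addr0.
  - exact: (@cochain_multilinear _ _ (contract u P)).
  rewrite (circf0r _ (Q := fun=> 0)) ?addr0 //; last first.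
    exact: (@cochain_multilinear _ _ (contract u P)).
  rewrite circf0r ?add0r; last 2 first.
  - exact: cochain_multilinear.
  - by move=> t; apply: (@cochain_alternating _ _ Q [::] [::]).
  rewrite [X in _ + (_ + X)]circf0l ?addr0; last first.
    by move=> t; apply: (@cochain_alternating _ _ P [::] [::]).
  by rewrite scaleN1r subrr.
by rewrite (IH P (contract y Q)) (IH (contract y P) (twist Q)) addr0.
Qed.

Lemma circf_bounded P Q :
  exists N, forall s, (N <= size s)%N -> circf P Q s = 0.
Proof.
have [N hN] := cochain_bounded P; have [M hM] := cochain_bounded Q.
exists (N + M)%N => s.
elim: s N M P Q hN hM => [|y s IH] N M P Q hN hM.
  by rewrite leqn0 addn_eq0 => /andP[/eqP N0 _] /=; apply: hN; rewrite N0.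
case: M hM => [|M] hM hs.
  by rewrite circf0r //; [exact: cochain_multilinear | move=> t; exact: hM].
rewrite /= (IH N M _ (contract y Q)) //; first 1 last.
- by move=> t ht; apply: hM.
- by move: hs; rewrite addnS.
rewrite add0r; case: N hN hs => [|N] hN hs.
  by rewrite circf0l // => t; apply: hN.
apply: (IH N M.+1 (contract y P) (twist Q)).
- by move=> t ht; apply: hN.
- by move=> t ht; rewrite /= /twistf hM ?scaler0.
- by [].
Qed.

Lemma circ_subproof P Q : circf P Q \in @cochain_pred k V.
Proof.
apply/asboolP; split; last exact: circf_bounded.
- by apply: circf_multilinear; apply: cochain_multilinear.
- exact: circf_alternating.
Qed.

Definition circ P Q : cochain V := Cochain (circ_subproof P Q).

Lemma circ_nil P Q : circ P Q [::] = P [:: Q [::]]. Proof. by []. Qed.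

(** To become the first argument of [P], [y] passes the q + 1 arguments of [Q] and then the value of
    [Q]; the resulting sign (-1)^q is [twist]. *)
Lemma contract_circ y P Q : contract y (circ P Q) =
  circ P (contract y Q) + circ (contract y P) (twist Q).
Proof. exact: cochain_eq. Qed.

Lemma circ_cons y s P Q : circ P Q (y :: s) =
  circ P (contract y Q) s + circ (contract y P) (twist Q) s.
Proof. by []. Qed.

Lemma circ_is_linearl Q : linear (circ^~ Q).
Proof. by move=> a P P'; apply: cochain_eq => s; apply: circf_linearl. Qed.

Lemma circ_is_linearr P : linear (circ P).
Proof.
move=> a Q Q'; apply: cochain_eq => s; apply: circf_linearr => //.
exact: cochain_multilinear.
Qed.
HB.instance Definition _ P :=
  GRing.isLinear.Build k (cochain V) (cochain V) _ (circ P) (circ_is_linearr P).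

Lemma circDl P P' Q : circ (P + P') Q = circ P Q + circ P' Q.
Proof. by have := circ_is_linearl Q 1 P P'; rewrite /= !scale1r. Qed.
Lemma circ0l Q : circ 0 Q = 0.
Proof. by apply: cochain_eq => s; apply: circf0l. Qed.
Lemma circZl a P Q : circ (a *: P) Q = a *: circ P Q.
Proof. by have := circ_is_linearl Q a P 0; rewrite /= circ0l !addr0. Qed.
Lemma circNl P Q : circ (- P) Q = - circ P Q.
Proof. by rewrite -scaleN1r circZl scaleN1r. Qed.
Lemma circDr P Q Q' : circ P (Q + Q') = circ P Q + circ P Q'.
Proof. exact: linearD. Qed.
Lemma circ0r P : circ P 0 = 0. Proof. exact: linear0. Qed.
Lemma circZr a P Q : circ P (a *: Q) = a *: circ P Q.
Proof. exact: linearZ. Qed.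
Lemma circNr P Q : circ P (- Q) = - circ P Q.
Proof. exact: linearN. Qed.

Definition circE := (circDl, circDr, circZl, circZr, circNl, circNr, circ0l,
  circ0r).

Lemma parity_circ p q P Q :
  parity p P -> parity q Q -> parity (p (+) q) (circ P Q).
Proof.
move=> hP hQ s; elim: s p q P Q hP hQ => [|y s IH] p q P Q hP hQ hs.
  rewrite circ_nil; case: q hQ hs => [hQ|/(_ [::] erefl) ->].
    by case: p hP => // hP _; rewrite hP.
  by move=> _; rewrite (multilinear0 (@cochain_multilinear _ _ P) [::]).
rewrite circ_cons (twist_parity hQ) circZr cochainZ.
have hs' : odd (size s) = ~~ (p (+) q) by rewrite -hs /= negbK.
rewrite (IH p (~~ q)) //; last 2 first.
- exact: parity_contract.
- by rewrite hs' addbN.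
rewrite (IH (~~ p) q) ?scaler0 ?addr0 //; first exact: parity_contract.
by rewrite hs' addNb.
Qed.

Definition assoc P Q S := circ (circ P Q) S - circ P (circ Q S).

(** [circ] is a right pre-Lie product in the super sense; the Jacobi identity
    of [brk] follows formally. *)
Lemma assoc_sym p q P Q S : parity p Q -> parity q S ->
  assoc P Q S = (-1) ^+ (p && q) *: assoc P S Q.
Proof.
move=> hQ hS; apply: cochain_eq => s; rewrite cochainZ.
elim: s p q P Q S hQ hS => [|y s IH] p q P Q S hQ hS; rewrite /assoc !cochainE.
  (* Without arguments the associator is, up to sign, [P] applied to the constants of [S] and [Q].
     Constants have degree -1, so only odd [Q] and [S] contribute. *)
  rewrite !circ_nil !circ_cons !circ_nil !contractE addrAC subrr add0r.
  rewrite addrAC subrr add0r (twist_parity hQ) (twist_parity hS) !cochainZ.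
  rewrite !(multilinearZ (@cochain_multilinear _ _ P) [:: _] [::]).
  rewrite (alternating_swap (@cochain_multilinear _ _ P)
    (@cochain_alternating _ _ P) [::] [::]).
  case: p hQ => [_|/(_ [::] erefl)->]; last first.
    rewrite ?(multilinear0 (@cochain_multilinear _ _ P) [::]).
    rewrite ?(multilinear0 (@cochain_multilinear _ _ P) [:: _]).
    by rewrite oppr0 !scaler0.
  case: q hS => [_|/(_ [::] erefl)->]; last first.
    rewrite ?(multilinear0 (@cochain_multilinear _ _ P) [::]).
    rewrite ?(multilinear0 (@cochain_multilinear _ _ P) [:: _]).
    by rewrite oppr0 !scaler0.
  by rewrite /= expr1; linear_over k.
(* Contraction is a derivation of the associator: [y] goes to one of the three maps, with the sign
   of those it passes. *)
have e P1 Q1 S1 q1 : parity q1 S1 -> forall p1, parity p1 Q1 -> assoc P1 Q1 S1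
  (y :: s) =
  assoc P1 Q1 (contract y S1) s + (-1) ^+ q1 *: assoc P1 (contract y Q1) S1 s
  + (-1) ^+ (p1 (+) q1) *: assoc (contract y P1) Q1 S1 s.
  move=> h1 p1 hp1; rewrite /assoc !cochainE !circ_cons !contract_circ !circE
    !cochainE.
  rewrite (twist_parity h1) (twist_parity hp1) (twist_parity (parity_circ hp1
    h1)).
  rewrite !circE !cochainE.
  by case: p1 q1 {h1 hp1} => [] [] /=; rewrite ?expr1 ?expr0; linear_over k.
have := e P Q S _ hS _ hQ; rewrite /assoc !cochainE => ->.
have := e P S Q _ hQ _ hS; rewrite /assoc !cochainE => ->.
rewrite -!/(assoc _ _ _).
have := IH _ _ P _ _ hQ (parity_contract y hS); rewrite /assoc !cochainE => ->.
have := IH _ _ P _ _ (parity_contract y hQ) hS; rewrite /assoc !cochainE => ->.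
have := IH _ _ (contract y P) _ _ hQ hS; rewrite /assoc !cochainE => ->.
by case: p q {hQ hS} => [] [] /=; rewrite ?expr1 ?expr0; linear_over k.
Qed.

(** The Nijenhuis-Richardson bracket. The splitting of [P] into its even and odd
    parts makes it bilinear, also on non-homogeneous maps. *)
Definition brk P Q : cochain V :=
  circ P Q - (circ Q (part false P) + circ (twist Q) (part true P)).

Lemma brk_parity p q P Q : parity p P -> parity q Q ->
  brk P Q = circ P Q - (-1) ^+ (p && q) *: circ Q P.
Proof.
move=> hP hQ; rewrite /brk (twist_parity hQ) !(part_parity _ hP).
by case: p hP => hP /=; rewrite !circE ?addr0 ?add0r ?scale1r.
Qed.

Lemma parity_brk p q P Q :
  parity p P -> parity q Q -> parity (p (+) q) (brk P Q).
Proof.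
move=> hP hQ; rewrite (brk_parity hP hQ) addrC -scaleNr; apply: parityD.
  by rewrite addbC; apply: parity_circ.
exact: parity_circ.
Qed.

Lemma brkDl P P' Q : brk (P + P') Q = brk P Q + brk P' Q.
Proof. by rewrite /brk !linearD /= !circE; linear_over k. Qed.
Lemma brkZl a P Q : brk (a *: P) Q = a *: brk P Q.
Proof. by rewrite /brk !linearZ /= !circE; linear_over k. Qed.
Lemma brkDr P Q Q' : brk P (Q + Q') = brk P Q + brk P Q'.
Proof. by rewrite /brk !linearD /= !circE; linear_over k. Qed.
Lemma brkZr a P Q : brk P (a *: Q) = a *: brk P Q.
Proof. by rewrite /brk !linearZ /= !circE; linear_over k. Qed.
Lemma brk0l Q : brk 0 Q = 0. Proof. by rewrite /brk !linear0 /= !circE;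
  linear_over k. Qed.
Lemma brk0r P : brk P 0 = 0. Proof. by rewrite /brk !linear0 /= !circE;
  linear_over k. Qed.
Lemma brkNr P Q : brk P (- Q) = - brk P Q.
Proof. by rewrite -scaleN1r brkZr scaleN1r. Qed.

Lemma brkC p q P Q : parity p P -> parity q Q ->
  brk P Q = - ((-1) ^+ (p && q) *: brk Q P).
Proof.
move=> hP hQ; rewrite (brk_parity hP hQ) (brk_parity hQ hP).
by case: p q {hP hQ} => [] [] /=; rewrite ?expr1 ?expr0; linear_over k.
Qed.

(** The form says that bracketing with [S] on the right is a derivation; elements of a are always
    inserted on that side. *)
Lemma brk_jacobi p q r P Q S : parity p P -> parity q Q -> parity r S ->
  brk (brk P Q) S = brk P (brk Q S) + (-1) ^+ (q && r) *: brk (brk P S) Q.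
Proof.
move=> hP hQ hS.
rewrite (brk_parity (parity_brk hP hQ) hS) (brk_parity hP (parity_brk hQ hS)).
rewrite (brk_parity (parity_brk hP hS) hQ).
rewrite (brk_parity hP hQ) (brk_parity hQ hS) (brk_parity hP hS) !circE.
have a1 := assoc_sym P hQ hS; have a2 := assoc_sym Q hP hS.
have a3 := assoc_sym S hP hQ.
move: a1 a2 a3; rewrite /assoc => /eqP; rewrite subr_eq => /eqP ->.
move=> /eqP; rewrite subr_eq => /eqP ->.
move=> /eqP; rewrite subr_eq => /eqP ->.
by case: p q r {hP hQ hS} => [] [] [] /=; rewrite ?expr1 ?expr0; linear_over k.
Qed.

End Composition.

(** * Degrees and their parities *)

Definition oddz (z : int) : bool := odd `|z|.

Lemma oddzD a b : oddz (a + b) = oddz a (+) oddz b.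
Proof. rewrite /oddz; lia. Qed.
Lemma oddzM a b : oddz (a * b) = oddz a && oddz b.
Proof. by rewrite /oddz abszM oddM. Qed.
Lemma oddzN a : oddz (- a) = oddz a.
Proof. by rewrite /oddz abszN. Qed.

Lemma oddz0 : oddz 0 = false. Proof. by []. Qed.
Lemma oddz1 : oddz 1 = true. Proof. by []. Qed.

(** As -1 is its own inverse, negative exponents do no harm and every sign reduces to a boolean. *)
Lemma signz (k : fieldType) (z : int) : (-1) ^ z = (-1) ^+ oddz z :> k.
Proof.
by case: z => n; rewrite /oddz signr_odd // -[RHS]invr_sign.
Qed.

Section Degree.
Variables (k : fieldType) (V : lmodType k).
Implicit Types (P Q F G : cochain V).

Lemma cochain_deg0 n : cochain_deg n (0 : cochain V). Proof. by []. Qed.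

Lemma cochain_degD n a F G :
  cochain_deg n F -> cochain_deg n G -> cochain_deg n (a *: F + G).
Proof. by move=> hF hG s hs; rewrite !cochainE hF // hG // scaler0 addr0. Qed.

Lemma cochain_degZ n a F : cochain_deg n F -> cochain_deg n (a *: F).
Proof. by move=> hF s hs; rewrite !cochainE hF // scaler0. Qed.

Lemma cochain_deg_contract n y F :
  cochain_deg n F -> cochain_deg (n - 1) (contract y F).
Proof. by move=> hF s hs; rewrite contractE hF //= => h; apply: hs; lia. Qed.

Lemma cochain_deg_twist n F : cochain_deg n F -> cochain_deg n (twist F).
Proof. by move=> hF s hs; rewrite twistE hF ?scaler0. Qed.

Lemma cochain_deg_part n b F : cochain_deg n F -> cochain_deg n (part b F).
Proof. by move=> hF s hs; rewrite partE hF ?if_same. Qed.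

Lemma cochain_deg_circ p q P Q :
  cochain_deg p P -> cochain_deg q Q -> cochain_deg (p + q) (circ P Q).
Proof.
move=> hP hQ s; elim: s p q P Q hP hQ => [|y s IH] p q P Q hP hQ hs.
  rewrite circ_nil; have [q0|q0] := eqVneq (q + 1) 0.
    by rewrite hP // => /= h; apply: hs => /=; lia.
  by rewrite (hQ [::]) ?(multilinear0 (@cochain_multilinear _ _ P) [::]) //= =>
    h;
     move/eqP: q0; apply; rewrite -h.
rewrite circ_cons.
rewrite (IH _ _ _ _ hP (cochain_deg_contract y hQ)); last by move=> h; apply: hs
  => /=; lia.
rewrite (IH _ _ _ _ (cochain_deg_contract y hP) (cochain_deg_twist hQ)) ?addr0
  //.
by move=> h; apply: hs => /=; lia.
Qed.

Lemma cochain_deg_brk p q P Q :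
  cochain_deg p P -> cochain_deg q Q -> cochain_deg (p + q) (brk P Q).
Proof.
move=> hP hQ s hs; rewrite /brk !cochainE (cochain_deg_circ hP hQ) //.
rewrite (addrC p) in hs; rewrite (cochain_deg_circ hQ (cochain_deg_part _ hP))
  //.
rewrite (cochain_deg_circ (cochain_deg_twist hQ) (cochain_deg_part _ hP)) //.
by rewrite !(addr0, oppr0).
Qed.

Lemma cochain_deg_parity n F : cochain_deg n F -> parity (oddz n) F.
Proof. by move=> hF s hs; apply: hF; rewrite /oddz in hs *; lia. Qed.

Lemma twist_deg n F : cochain_deg n F -> twist F = (-1) ^+ oddz n *: F.
Proof. by move=> h; apply/twist_parity/cochain_deg_parity. Qed.

End Degree.

(** * Extension of scalars to k[T]/(T^2 - mu T + lam) *)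

Section Double.
Variables (k : fieldType) (g : lmodType k) (mu lam : k).

Definition dbl : lmodType k := (g * g)%type.

Lemma fstD (u v : dbl) : (u + v).1 = u.1 + v.1. Proof. by []. Qed.
Lemma sndD (u v : dbl) : (u + v).2 = u.2 + v.2. Proof. by []. Qed.

(** [dbl] is g[T]/(T^2 - mu T + lam), the pair (a, b) standing for a + T b. *)
Definition mulT (v : dbl) : dbl := (- (lam *: v.2), v.1 + mu *: v.2).

Lemma mulT_is_linear : linear mulT.
Proof.
by move=> a [u1 u2] [v1 v2]; congr (_, _); rewrite /= ; linear_over k.
Qed.
HB.instance Definition _ :=
  GRing.isLinear.Build k dbl dbl _ mulT mulT_is_linear.

Lemma mulTD u v : mulT (u + v) = mulT u + mulT v. Proof. exact: linearD. Qed.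
Lemma mulTZ a v : mulT (a *: v) = a *: mulT v. Proof. exact: linearZ. Qed.

Lemma mulT_sqr v : mulT (mulT v) = mu *: mulT v - lam *: v.
Proof. by case: v => a b; congr (_, _); rewrite /=; linear_over k. Qed.

(** The k[T]-multilinear extension of a multilinear map. *)
Fixpoint extf (f : seq g -> g) (s : seq dbl) : dbl :=
  if s is x :: s' then
    extf (fun t => f (x.1 :: t)) s' + mulT (extf (fun t => f (x.2 :: t)) s')
  else (f [::], 0).

Lemma extf_linear a f f' h s : (forall t, h t = a *: f t + f' t) ->
  extf h s = a *: extf f s + extf f' s.
Proof.
elim: s f f' h => [|x s IH] f f' h e /=.
  by rewrite e; congr (_, _); rewrite /= scaler0 addr0.
rewrite (IH (fun t => f (x.1 :: t)) (fun t => f' (x.1 :: t)) (fun t => h (x.1 ::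
  t))) //.
rewrite (IH (fun t => f (x.2 :: t)) (fun t => f' (x.2 :: t)) (fun t => h (x.2 ::
  t))) //.
by rewrite linearP scalerDr addrACA.
Qed.

Lemma extf0 f s : (forall t, f t = 0) -> extf f s = 0.
Proof.
move=> h; rewrite (@extf_linear (-1) f f f) ?scaleN1r ?addNr //.
by move=> t; rewrite scaleN1r addNr.
Qed.

(** Extension preserves the number of arguments, and [twist] and [part] depend on nothing else. *)
Lemma extf_scale (c : nat -> k) f s :
  extf (fun t => c (size t) *: f t) s = c (size s) *: extf f s.
Proof.
elim: s c f => [|x s IH] c f /=; first by congr (_, _); rewrite /= scaler0.
by rewrite !(IH (fun n => c n.+1)) linearZ scalerDr.
Qed.

Lemma extf_multilinear f : multilinear f -> multilinear (extf f).
Proof.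
move=> mf s1; elim: s1 f mf => [|x s1 IH] f mf s2 a u v /=.
  rewrite (@extf_linear a (fun t => f (u.1 :: t)) (fun t => f (v.1 :: t))); last
    first.
    by move=> t; apply: (mf [::]).
  rewrite (@extf_linear a (fun t => f (u.2 :: t)) (fun t => f (v.2 :: t))
    (fun t => f ((a *: u + v).2 :: t))); last first.
    by move=> t; apply: (mf [::]).
  by rewrite linearP scalerDr addrACA.
rewrite !IH; try exact: multilinear_cons.
by rewrite linearP scalerDr addrACA.
Qed.

Lemma extf_alternating (f : cochain g) : alternating (extf f).
Proof.
apply: adjacent_alternating.
  by apply: extf_multilinear; apply: cochain_multilinear.
move=> s1 s2 [u v]; elim: s1 f => [|x s1 IH] f /=; last first.
  by rewrite (IH (contract _ f)) (IH (contract _ f)) linear0 addr0.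
(* For the argument u + T v taken twice, the terms are f(u, u), T f(u, v), T f(v, u) and T^2 f(v,
   v). *)
rewrite (extf0 (f := fun t => f (u :: u :: t))); last first.
  by move=> t; apply: (@cochain_alternating _ _ f [::] [::]).
rewrite (extf0 (f := fun t => f (v :: v :: t))); last first.
  by move=> t; apply: (@cochain_alternating _ _ f [::] [::]).
rewrite (@extf_linear (-1) (fun t => f (v :: u :: t)) (fun=> 0)); last first.
  move=> t; rewrite addr0 scaleN1r.
  exact: (alternating_swap (@cochain_multilinear _ _ f) (@cochain_alternating _
    _ f) [::]).
rewrite (extf0 (f := fun=> 0)) // add0r addr0 linear0 addr0.
by rewrite linearZ /= scaleN1r addNr.
Qed.

Lemma extf_bounded (f : seq g -> g) N :
  (forall x, (N <= size x)%N -> f x = 0) ->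
  forall x, (N <= size x)%N -> extf f x = 0.
Proof.
move=> hf x; elim: x f N hf => [|x s IH] f N hf /=; first by move=> hN; rewrite
  hf.
move=> hN; have hs : (N.-1 <= size s)%N by case: (N) hN.
have hb y t : (N.-1 <= size t)%N -> f (y :: t) = 0.
  by move=> ht; apply: hf; case: (N) ht.
by rewrite (IH _ _ (hb x.1) hs) (IH _ _ (hb x.2) hs) linear0 addr0.
Qed.

Lemma ext_subproof (f : cochain g) : extf f \in @cochain_pred k dbl.
Proof.
apply/asboolP; split.
- exact/extf_multilinear/cochain_multilinear.
- exact: extf_alternating.
- by have [N hN] := cochain_bounded f; exists N; apply: extf_bounded.
Qed.

Definition ext (f : cochain g) : cochain dbl := Cochain (ext_subproof f).

Lemma ext_is_linear : linear ext.
Proof. by move=> a f h; apply: cochain_eq => s; apply: extf_linear. Qed.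
HB.instance Definition _ :=
  GRing.isLinear.Build k (cochain g) (cochain dbl) _ ext ext_is_linear.

Lemma extD f h : ext (f + h) = ext f + ext h. Proof. exact: linearD. Qed.
Lemma extZ a f : ext (a *: f) = a *: ext f. Proof. exact: linearZ. Qed.

Lemma ext_nil f : ext f [::] = (f [::], 0). Proof. by []. Qed.

Lemma ext_cons f x s :
  ext f (x :: s) = ext (contract x.1 f) s + mulT (ext (contract x.2 f) s).
Proof. by []. Qed.

(** Rests on T^2 = mu T - lam. Being linear over k[T] in every slot, an extension lets T out of the
    slot in which another map is inserted. *)
Lemma ext_mulT f s1 u s2 : ext f (s1 ++ mulT u :: s2) = mulT (ext f (s1 ++ u ::
  s2)).
Proof.
elim: s1 f => [|x s1 IH] f.
  rewrite !cat0s !ext_cons; case: u => a b.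
  rewrite -[(mulT (a, b)).1]/(- (lam *: b)) -[(mulT (a, b)).2]/(a + mu *: b).
  rewrite -[(a, b).1]/a -[(a, b).2]/b -scaleNr contractD !contractZ extD !extZ.
  by rewrite !cochainE !linearD !linearZ /= mulT_sqr; linear_over k.
by rewrite !cat_cons !ext_cons !IH linearD.
Qed.

Lemma ext_twist f : ext (twist f) = twist (ext f).
Proof. by apply: cochain_eq => s; rewrite twistE; apply: (extf_scale (fun n =>
  (-1) ^+ n.+1)). Qed.

Lemma ext_part b f : ext (part b f) = part b (ext f).
Proof.
apply: cochain_eq => s; rewrite partE.
rewrite (_ : ext (part b f) s = (if odd (size s) == b then 0 else 1) *: ext f
  s).
  by case: ifP; rewrite ?scale0r ?scale1r.
rewrite -(extf_scale (fun n => if odd n == b then 0 else 1)) /=.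
congr (extf _ s); apply: funext => t; rewrite /partf.
by case: ifP; rewrite ?scale0r ?scale1r.
Qed.

Lemma cochain_deg_ext n f : cochain_deg n f -> cochain_deg n (ext f).
Proof.
move=> hf s; elim: s n f hf => [|x s IH] n f hf hs; first by rewrite ext_nil hf.
rewrite ext_cons !(IH (n - 1)) ?linear0 ?addr0 //; try exact:
  cochain_deg_contract.
all: move=> h; apply: hs; rewrite -[size _]/((size s).+1) -addn1 PoszD h; lia.
Qed.

Lemma postT_subproof (u : cochain dbl) : (mulT \o u) \in @cochain_pred k dbl.
Proof.
apply/asboolP; split=> [s1 s2 a v w|s1 s2 s3 v|] /=.
- by rewrite (cochain_multilinear u) linearP.
- by rewrite cochain_alternating linear0.
- by have [N hN] := cochain_bounded u; exists N => x /hN /= ->; rewrite linear0.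
Qed.

Definition postT (u : cochain dbl) : cochain dbl := Cochain (postT_subproof u).

Lemma postTE u s : postT u s = mulT (u s). Proof. by []. Qed.

Lemma contract_ext x f :
  contract x (ext f) = ext (contract x.1 f) + postT (ext (contract x.2 f)).
Proof. exact: cochain_eq. Qed.

Lemma circ_postT_l P Q : circ (postT P) Q = postT (circ P Q).
Proof.
apply: cochain_eq => s; rewrite postTE.
elim: s P Q => [//|y s IH] P Q; rewrite !circ_cons mulTD -!IH.
by congr (_ + circ _ _ s); exact: cochain_eq.
Qed.

Lemma circ_postT_r (P Q : cochain dbl) :
  (forall s1 u s2, P (s1 ++ mulT u :: s2) = mulT (P (s1 ++ u :: s2))) ->
  circ P (postT Q) = postT (circ P Q).
Proof.
move=> h; apply: cochain_eq => s; rewrite postTE.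
elim: s P Q h => [|y s IH] P Q h; first by rewrite circ_nil postTE (h [::] _
  [::]).
rewrite !circ_cons mulTD.
rewrite (_ : contract y (postT Q) = postT (contract y Q)); last exact:
  cochain_eq.
rewrite (_ : twist (postT Q) = postT (twist Q)); last first.
  by apply: cochain_eq => t; rewrite !(postTE, twistE) mulTZ.
by rewrite !IH // => s1 u s2; rewrite !contractE -!cat_cons h.
Qed.

(** Contraction with a + T b splits an extension into two, one of them multiplied by T. Since T can
    be pulled out of either factor of [circ], both sides satisfy the same recursion. *)
Lemma ext_circ f h : ext (circ f h) = circ (ext f) (ext h).
Proof.
apply: cochain_eq => s; elim: s f h => [|x s IH] f h.
  rewrite circ_nil !ext_nil circ_nil ext_cons !ext_nil !contractE /=.
  by rewrite (multilinear0 (@cochain_multilinear _ _ f) [::]) linear0 addr0.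
rewrite ext_cons circ_cons !contract_circ !contract_ext !extD circDl circDr.
rewrite -ext_twist !circ_postT_l circ_postT_r; last exact: ext_mulT.
rewrite !cochainE !postTE mulTD !IH.
by rewrite addrACA.
Qed.

Lemma ext_brk f h : ext (brk f h) = brk (ext f) (ext h).
Proof. by rewrite /brk linearB linearD /= !ext_circ !ext_twist !ext_part. Qed.

Definition inAf (xi : seq g -> g) (s : seq dbl) : dbl := (xi [seq v.2 | v <- s],
  0).

Lemma inA_subproof (xi : cochain g) : inAf xi \in @cochain_pred k dbl.
Proof.
apply/asboolP; split=> [s1 s2 a v w|s1 s2 s3 v|]; rewrite /inAf.
- rewrite !map_cat /= (cochain_multilinear xi).
  by congr (_, _); rewrite /= scaler0 addr0.
- by rewrite !map_cat /= map_cat /= cochain_alternating.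
- have [N hN] := cochain_bounded xi; exists N => x hx.
  by rewrite hN ?size_map.
Qed.

Definition inA (xi : cochain g) : cochain dbl := Cochain (inA_subproof xi).

Lemma inAE xi s : inA xi s = (xi [seq v.2 | v <- s], 0). Proof. by []. Qed.

Lemma inA_is_linear : linear inA.
Proof.
move=> a xi eta; apply: cochain_eq => s.
by rewrite !(inAE, cochainE); congr (_, _); rewrite /= scaler0 addr0.
Qed.
HB.instance Definition _ :=
  GRing.isLinear.Build k (cochain g) (cochain dbl) _ inA inA_is_linear.

Lemma contract_inA x xi : contract x (inA xi) = inA (contract x.2 xi).
Proof. exact: cochain_eq. Qed.

Lemma inA_twist xi : inA (twist xi) = twist (inA xi).
Proof.
apply: cochain_eq => s; rewrite !(inAE, twistE) size_map.
by congr (_, _); rewrite /= scaler0.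
Qed.

Lemma cochain_deg_inA n xi : cochain_deg n xi -> cochain_deg n (inA xi).
Proof. by move=> h s hs; rewrite inAE h ?size_map. Qed.

Lemma parity_inA b xi : parity b xi -> parity b (inA xi).
Proof. by move=> h s hs; rewrite inAE h ?size_map. Qed.

(** [inA xi] reads only T-coefficients, including that of the inserted value, and [u] takes values
    in g. This is why a is abelian. *)
Lemma circ_inA0 xi (u : cochain dbl) : (forall s, (u s).2 = 0) -> circ (inA xi)
  u = 0.
Proof.
move=> hu; apply: cochain_eq => s; rewrite cochain0.
elim: s xi u hu => [|y s IH] xi u hu.
  rewrite circ_nil inAE /= hu.
  by rewrite (multilinear0 (@cochain_multilinear _ _ xi) [::]).
have hu1 t : (contract y u t).2 = 0 by exact: hu.
have hu2 t : (twist u t).2 = 0 by rewrite twistE /= hu scaler0.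
by rewrite circ_cons contract_inA (IH _ _ hu1) (IH _ _ hu2) addr0.
Qed.

Lemma circ_inA_snd xi u s : (circ (inA xi) u s).2 = 0.
Proof.
elim: s xi u => [//|y s IH] xi u.
by rewrite circ_cons contract_inA sndD !IH addr0.
Qed.

Lemma circ_inA_inA xi eta : circ (inA xi) (inA eta) = 0.
Proof. exact: circ_inA0. Qed.

Lemma brk_inA_inA xi eta : brk (inA xi) (inA eta) = 0.
Proof.
have h b s : (part b (inA xi) s).2 = 0 by rewrite partE; case: ifP.
rewrite /brk -inA_twist circ_inA_inA !(circ_inA0 _ (h _)).
by rewrite !(addr0, oppr0).
Qed.

(** Reads off the coefficient of 1 on arguments in gT. *)
Definition projf (u : seq dbl -> dbl) (s : seq g) : g :=
  (u [seq (0, x) : dbl | x <- s]).1.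

Lemma proj_subproof (u : cochain dbl) : projf u \in @cochain_pred k g.
Proof.
apply/asboolP; split=> [s1 s2 a v w|s1 s2 s3 v|]; rewrite /projf.
- rewrite !map_cat /=.
  rewrite -[(0, a *: v + w)]/((0, a *: v + w) : dbl).
  have -> : ((0, a *: v + w) : dbl) = a *: ((0, v) : dbl) + ((0, w) : dbl).
    by congr (_, _); rewrite /= scaler0 addr0.
  by rewrite (cochain_multilinear u).
- by rewrite !map_cat /= map_cat /= cochain_alternating.
- have [N hN] := cochain_bounded u; exists N => x hx.
  by rewrite hN ?size_map.
Qed.

Definition proj (u : cochain dbl) : cochain g := Cochain (proj_subproof u).

Lemma projE u s : proj u s = (u [seq (0, x) : dbl | x <- s]).1. Proof. by [].
  Qed.

Lemma proj_is_linear : linear proj.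
Proof. by move=> a u v; apply: cochain_eq. Qed.
HB.instance Definition _ :=
  GRing.isLinear.Build k (cochain dbl) (cochain g) _ proj proj_is_linear.

Lemma proj_twist u : proj (twist u) = twist (proj u).
Proof. by apply: cochain_eq => s; rewrite !(projE, twistE) size_map. Qed.

Lemma contract_proj y u : contract y (proj u) = proj (contract (0, y) u).
Proof. exact: cochain_eq. Qed.

Lemma cochain_deg_proj n u : cochain_deg n u -> cochain_deg n (proj u).
Proof. by move=> h s hs; rewrite projE h ?size_map. Qed.

Lemma parity_proj b u : parity b u -> parity b (proj u).
Proof. by move=> h s hs; rewrite projE h ?size_map. Qed.

(** The value of [v] on gT splits into its coefficient of 1, that is [proj v],
    and its coefficient of T, on which only [proj u] is seen by [proj]. *)
Lemma proj_circ u v :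
  proj (circ u v) = proj (circ u (inA (proj v))) + proj (circ (inA (proj u)) v).
Proof.
apply: cochain_eq => s; rewrite !cochainE !projE.
elim: s u v => [|y s IH] u v.
  have e : [seq (0, x) : dbl | x <- [::]] = [::] by [].
  rewrite !e !circ_nil !inAE !projE !e /=.
  have {1}-> : v [::] = ((v [::]).1, 0) + (0, (v [::]).2).
    by case: (v [::]) => a b; congr (_, _); rewrite /= ?addr0 ?add0r.
  by rewrite (multilinearD (@cochain_multilinear _ _ u) [::]).
rewrite map_cons !circ_cons !fstD !contract_inA.
rewrite (IH u (contract _ v)) (IH (contract _ u) (twist v)).
rewrite -[((0, y) : dbl).2]/y !contract_proj -inA_twist -proj_twist.
by rewrite addrACA.
Qed.

(** Splitting both composites by [proj_circ] gives four terms, which regroup into the two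
    brackets. *)
Lemma proj_brk p q u v : parity p u -> parity q v ->
  proj (brk u v) = proj (brk (inA (proj u)) v) + proj (brk u (inA (proj v))).
Proof.
move=> hu hv; have pu := parity_inA (parity_proj hu).
have pv := parity_inA (parity_proj hv).
rewrite (brk_parity hu hv) (brk_parity pu hv) (brk_parity hu pv).
rewrite !linearB !linearZ /= (proj_circ u v) (proj_circ v u).
by linear_over k.
Qed.

End Double.

(** * Sums over shuffles *)

Definition insert_at (T : Type) (i : nat) (y : T) (s : seq T) : seq T :=
  take i s ++ y :: drop i s.

Lemma insert_at_cat (T : Type) i y (s1 s2 : seq T) :
  insert_at (size s1 + i) y (s1 ++ s2) = s1 ++ insert_at i y s2.
Proof.
by rewrite /insert_at take_cat drop_cat !ltnNge !leq_addr /= addKn catA.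
Qed.

Lemma size_insert_at (T : Type) i y (s : seq T) :
  size (insert_at i y s) = (size s).+1.
Proof. by rewrite size_cat /= addnS -size_cat cat_take_drop. Qed.

Lemma nth_insert_at (T : Type) x0 i y (s : seq T) :
  (i <= size s)%N -> nth x0 (insert_at i y s) i = y.
Proof. by move=> hi; rewrite nth_cat size_takel // ltnn subnn. Qed.

Lemma map_insert_at (T U : Type) (f : T -> U) i y s :
  map f (insert_at i y s) = insert_at i (f y) (map f s).
Proof. by rewrite /insert_at map_cat /= map_take map_drop. Qed.

Definition decr_nth (b : seq nat) (j : nat) : seq nat :=
  set_nth 0%N b j (nth 0%N b j).-1.

Lemma nth_leq_sumn (b : seq nat) j : (nth 0 b j <= sumn b)%N.
Proof.
elim: b j => [|b0 b IH] [|j] //=; first exact: leq_addr.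
by rewrite (leq_trans (IH j)) ?leq_addl.
Qed.

(** The smallest element of a shuffle heads one of the blocks. *)
Lemma sorted_reshape_insert0 (W : nmodType) (b t : seq nat) (G : nat -> W) :
  sumn b = (size t).+1 -> all (fun z => 0 < z)%N t ->
  \sum_(0 <= i < (size t).+1 | all (sorted ltn) (reshape b (insert_at i 0%N t)))
    G i
  = \sum_(0 <= j < size b |
       (0 < nth 0 b j)%N && all (sorted ltn) (reshape (decr_nth b j) t))
      G (sumn (take j b)).
Proof.
elim: b t G => [//|b0 b IH] t G /= tE t_gt0.
have b0_le : (b0 <= (size t).+1)%N by rewrite -tE leq_addr.
rewrite big_mkcond [RHS]big_mkcond /= (@big_cat_nat _ _ _ b0) //=.
rewrite [RHS]big_nat_recl //=; congr (_ + _).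
  case: b0 tE b0_le => [|b0] tE b0_le; first by rewrite big_geq.
  (* Within the first block, 0 can only stand at the front, the other entries being positive. *)
  rewrite big_nat_recl // [X in _ + X]big1_seq ?addr0 //=.
    have -> : insert_at 0 0%N t = 0%N :: t by rewrite /insert_at take0 drop0.
    rewrite /= path_sortedE; last exact: ltn_trans.
    suff -> : all (ltn 0) (take b0 t) by [].
    by apply/allP => z /mem_take; apply/allP.
  move=> i; rewrite mem_index_iota /= => hi.
  case: ifP => // /andP[]; case: t tE t_gt0 b0_le => [|t0 t] /= tE; first by
    lia.
  case/andP => t0_gt0 _ hb; case: b0 tE hi hb => [|b0] tE hi hb; first by lia.
  rewrite -[_ ++ _]/(insert_at i 0%N t).
  have hm : (i < size (take b0.+1 (insert_at i 0%N t)))%N.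
    by rewrite size_take size_insert_at; case: ifP; lia.
  move/(order_path_min ltn_trans)/(all_nthP 0%N)/(_ i hm).
  by rewrite nth_take ?nth_insert_at //; lia.
have [b0_le'|b0_gt] := leqP b0 (size t); last first.
  have sb : sumn b = 0%N by lia.
  rewrite big_geq // big1_seq // => j _; rewrite ifF //.
  by have := nth_leq_sumn b j; rewrite sb leqn0 => /eqP ->.
have e0 : (size t).+1 = (b0 + (size (drop b0 t)).+1)%N by rewrite size_drop;
  lia.
have e1 : sumn b = (size (drop b0 t)).+1 by lia.
have e2 : all (fun z => 0 < z)%N (drop b0 t).
  by apply/allP => z /mem_drop; apply/allP.
(* When 0 lies in a later block, the condition on the first block is put into the summand and the
   induction runs over the rest. *)
have := IH (drop b0 t) (fun i => if sorted ltn (take b0 t) then G (b0 + i)%N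
  else 0) e1 e2.
rewrite big_mkcond [in X in _ = X -> _]big_mkcond /= => IH'.
rewrite -[X in \sum_(X <= _ < _) _]add0n big_addn.
rewrite (_ : ((size t).+1 - b0)%N = (size (drop b0 t)).+1); last by lia.
transitivity (\sum_(0 <= i < (size (drop b0 t)).+1)
   (if all (sorted ltn) (reshape b (insert_at i 0%N (drop b0 t)))
    then if sorted ltn (take b0 t) then G (b0 + i)%N else 0 else 0)).
  apply: eq_bigr => i _; rewrite addnC.
  have s0 : size (take b0 t) = b0 by rewrite size_takel.
  have -> : insert_at (b0 + i) 0%N t = take b0 t ++ insert_at i 0%N (drop b0 t).
    by rewrite -insert_at_cat s0 cat_take_drop.
  rewrite take_size_cat // drop_size_cat //.
  by case: (sorted _ _); rewrite //= if_same.
rewrite IH'; apply: eq_bigr => j _ /=.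
by case: (sorted _ _); rewrite /= ?andbF ?if_same.
Qed.

Lemma sorted_reshape_succ (b t : seq nat) :
  all (sorted ltn) (reshape b (map succn t)) = all (sorted ltn) (reshape b t).
Proof.
elim: b t => [//|b0 b IH] t /=; rewrite -map_take -map_drop IH.
by congr (_ && _); rewrite sorted_map; apply: eq_sorted.
Qed.

Lemma iota_insert N i : (i <= N)%N ->
  iota 0 N.+1 = insert_at i i (map (bump i) (iota 0 N)).
Proof.
move=> hi; apply: (@eq_from_nth _ 0%N) => [|p].
  by rewrite size_insert_at size_map !size_iota.
rewrite size_iota => hp; rewrite nth_iota // nth_cat size_takel ?size_map
  ?size_iota //.
case: ltnP => h.
  by rewrite nth_take // (nth_map 0%N) ?size_iota ?nth_iota /bump; lia.
case: p hp h => [|p] hp h; first by move: h; rewrite leqn0 => /eqP ->.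
case: (eqVneq i p.+1) => [->|ne]; first by rewrite subnn.
have -> : (p.+1 - i = (p - i).+1)%N by lia.
by rewrite /= nth_drop (nth_map 0%N) ?size_iota ?nth_iota /bump; lia.
Qed.

(** * Permutations described by the position of their least value *)

Section LiftPermutations.
Variable N : nat.

Lemma enum_ord_insert (i : 'I_N.+1) :
  enum 'I_N.+1 = insert_at i i (map (lift i) (enum 'I_N)).
Proof.
apply: (inj_map val_inj); rewrite map_insert_at val_enum_ord -map_comp.
rewrite (eq_map (g := bump i \o val)) // map_comp val_enum_ord.
by apply: iota_insert; rewrite -ltnS.
Qed.

Lemma map_lift_perm (T : Type) (f : 'I_N.+1 -> T) (i : 'I_N.+1) (s : 'S_N) :
  [seq f (lift_perm i ord0 s x) | x <- enum 'I_N.+1] =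
  insert_at i (f ord0) [seq f (lift ord0 (s x)) | x <- enum 'I_N].
Proof.
rewrite (enum_ord_insert i) map_insert_at lift_perm_id -map_comp.
by congr insert_at; apply: eq_map => x /=; rewrite lift_perm_lift.
Qed.

(** The position of the value 0 and the order of the other values determine the permutation;
    surjectivity follows by counting. *)
Lemma lift_perm_bij :
  bijective (fun p : 'I_N.+1 * 'S_N => lift_perm p.1 ord0 p.2).
Proof.
apply: inj_card_bij; last first.
  by rewrite card_prod card_ord !card_Sn factS.
move=> [i s] [i' s'] /= e.
have ii' : i = i'.
  apply: (@perm_inj _ (lift_perm i ord0 s)).
  by rewrite lift_perm_id e lift_perm_id.
rewrite -ii' in e *; congr (_, _); apply/permP => x; apply: (@lift_inj _ ord0).
by rewrite -(lift_perm_lift i) e lift_perm_lift.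
Qed.

Lemma big_lift_perm (W : nmodType) (P : pred 'S_N.+1) (F : 'S_N.+1 -> W) :
  \sum_(s | P s) F s =
  \sum_(i < N.+1) \sum_(s' : 'S_N | P (lift_perm i ord0 s')) F (lift_perm i ord0
    s').
Proof.
rewrite pair_big_dep /= (reindex (fun p : 'I_N.+1 * 'S_N => lift_perm p.1 ord0
  p.2)) //=.
exact/onW_bij/lift_perm_bij.
Qed.

End LiftPermutations.

(** The subtraction is in the integers: an empty block becomes negative and then admits no
    shuffle. *)
Definition decr_block (b : seq int) (j : nat) : seq int := set_nth 0 b j (b`_j -
  1).

Definition block_start (b : seq int) (j : nat) : nat := sumn (take j (map absz
  b)).

Lemma sum_Posz (b : seq nat) : \sum_(z <- map Posz b) z = (sumn b)%:Z.
Proof. by elim: b => [|b0 b IH] /=; rewrite ?big_nil // big_cons IH. Qed.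

Lemma map_absz_Posz (b : seq nat) : map absz (map Posz b) = b.
Proof. by rewrite -map_comp map_id. Qed.

Lemma shuffle_Posz (b : seq nat) N (s : 'S_N) : shuffle (map Posz b) s =
  (sumn b == N) && all (sorted ltn) (reshape b [seq val (s i) | i <- enum
    'I_N]).
Proof.
rewrite /shuffle sum_Posz map_absz_Posz.
by have -> : all (fun z : int => 0 <= z) (map Posz b) by elim: b.
Qed.

Lemma shuffle_neg (b : seq int) N (s : 'S_N) :
  ~~ all (fun z => 0 <= z) b -> shuffle b s = false.
Proof. by rewrite /shuffle => /negPf->. Qed.

Lemma all_ge0_Posz (b : seq int) :
  all (fun z => 0 <= z) b -> exists bn, b = map Posz bn.
Proof.
elim: b => [|[n|//] b IH] /=; first by exists [::].
by move=> /IH[bn ->]; exists (n :: bn).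
Qed.

Lemma decr_block_ge0 (b : seq int) j : 0 < b`_j ->
  all (fun z => 0 <= z) (decr_block b j) = all (fun z => 0 <= z) b.
Proof.
elim: b j => [|b0 b IH] [|j] //=; rewrite ?nth_nil // => hj; first by congr (_
  && _); lia.
by rewrite -[set_nth _ _ _ _]/(decr_block b j) IH.
Qed.

Lemma decr_block_Posz (b : seq nat) j : (0 < nth 0 b j)%N ->
  decr_block (map Posz b) j = map Posz (decr_nth b j).
Proof.
elim: b j => [|b0 b IH] [|j] //= hj; first by congr (_ :: _); rewrite predn_int.
by congr (_ :: _); apply: IH.
Qed.

Lemma sumn_decr_nth (b : seq nat) j : (0 < nth 0 b j)%N ->
  (sumn (decr_nth b j)).+1 = sumn b.
Proof.
elim: b j => [|b0 b IH] [|j] //= hj; first by lia.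
by rewrite -[set_nth _ _ _ _]/(decr_nth b j) -addnS IH.
Qed.

Lemma nth_map_Posz (b : seq nat) j : (map Posz b)`_j = (nth 0 b j)%N.
Proof. by elim: b j => [|b0 b IH] [|j] //=. Qed.

(** The least value must head a nonempty block, and removing it leaves a shuffle with that block
    shortened. All recursions for shuffle sums come from this. *)
Lemma big_shuffle_recl (W : nmodType) (b : seq int) N (F : 'S_N.+1 -> W) :
  \sum_(s | shuffle b s) F s =
  \sum_(0 <= j < size b | 0 < b`_j)
    \sum_(s' : 'S_N | shuffle (decr_block b j) s')
      F (lift_perm (inord (block_start b j)) ord0 s').
Proof.
have [hb|hb] := boolP (all (fun z => 0 <= z) b); last first.
  rewrite big_pred0 ?big1 // => [j hj|s]; last exact: shuffle_neg.
  by rewrite big_pred0 // => s; rewrite shuffle_neg ?decr_block_ge0.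
have [bn ->] := all_ge0_Posz hb; rewrite size_map.
under [RHS]eq_bigl do rewrite nth_map_Posz.
have [sb|sb] := eqVneq (sumn bn) N.+1; last first.
  rewrite [LHS]big_pred0 => [|s]; last by rewrite shuffle_Posz (negPf sb).
  rewrite big1 // => j hj; rewrite big_pred0 // => s; rewrite decr_block_Posz //
    shuffle_Posz.
  by rewrite -eqSS sumn_decr_nth // (negPf sb).
rewrite big_lift_perm (exchange_big_dep xpredT) //=.
transitivity (\sum_(s' : 'S_N) \sum_(0 <= j < size bn |
   (0 < nth 0 bn j)%N && shuffle (decr_block (map Posz bn) j) s')
   F (lift_perm (inord (block_start (map Posz bn) j)) ord0 s')); last first.
  rewrite [LHS](exchange_big_dep (fun j => 0 < nth 0 bn j)%N) /=; last first.
    by move=> s' j _ /andP[].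
  by apply: eq_bigr => j hj; apply: eq_bigl => s'; rewrite hj.
apply: eq_bigr => s' _.
(* The values are raised by one to make room for the least value 0. *)
pose t := [seq (val (s' i)).+1 | i <- enum 'I_N].
have st : size t = N by rewrite size_map size_enum_ord.
have := @sorted_reshape_insert0 W bn t (fun i => F (lift_perm (inord i) ord0
  s')).
rewrite st sb => /(_ erefl) h; have {}h := h ltac:(by apply/allP => z /mapP[i _
  ->]).
transitivity (\sum_(0 <= i < N.+1 | all (sorted ltn) (reshape bn (insert_at i
  0%N t)))
  F (lift_perm (inord i) ord0 s')).
  rewrite big_mkord; apply: eq_big => [i|i _]; last by rewrite inord_val.
  rewrite shuffle_Posz sb eqxx /=; congr (all _ (reshape _ _)).
  exact: (map_lift_perm val).
rewrite {}h; apply: eq_big => [j|j _]; last by rewrite /block_start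
  map_absz_Posz.
case hj: (0 < _)%N => //=; rewrite decr_block_Posz // shuffle_Posz.
rewrite -eqSS sumn_decr_nth // sb eqxx /= -[RHS]sorted_reshape_succ.
by rewrite -map_comp.
Qed.

Lemma big_shuffle0 (W : nmodType) (b : seq int) (F : 'S_0 -> W) :
  \sum_(s | shuffle b s) F s = if all (pred1 0) b then F 1%g else 0.
Proof.
have e (s : 'S_0) : shuffle b s = all (pred1 0) b.
  have [hb|hb] := boolP (all (fun z => 0 <= z) b); last first.
    rewrite shuffle_neg //; apply/esym/negbTE; apply: contra hb => /allP hb.
    by apply/allP => z /hb /eqP ->.
  have [bn ->] := all_ge0_Posz hb; rewrite shuffle_Posz.
  have -> : enum 'I_0 = [::] by apply: size0nil; rewrite size_enum_ord.
  have -> : all (sorted ltn) (reshape bn [::]) by elim: bn {hb}.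
  rewrite andbT; elim: bn {hb} => [//|b0 bn IH] /=.
  by rewrite addn_eq0 IH.
rewrite (eq_bigl _ _ e); case: ifP => _; last by rewrite big_pred0.
rewrite (bigD1 1%g) //= big_pred0 ?addr0 // => s.
by rewrite (permS0 s) eqxx.
Qed.

(** Guarantees that [inord] in the recursion denotes the intended position. *)
Lemma block_start_leq (b : seq int) j N (s : 'S_N) :
  0 < b`_j -> shuffle (decr_block b j) s -> (block_start b j <= N)%N.
Proof.
move=> bj; have [hb|hb] := boolP (all (fun z => 0 <= z) b); last first.
  by rewrite shuffle_neg // decr_block_ge0.
have [bn eb] := all_ge0_Posz hb; subst b.
rewrite nth_map_Posz in bj; rewrite decr_block_Posz // shuffle_Posz.
case/andP => /eqP eN _; rewrite -ltnS -eN sumn_decr_nth // /block_start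
  map_absz_Posz.
have hj : (j < size bn)%N by case: (ltnP j (size bn)) bj => // h; rewrite
  nth_default.
by rewrite -[in X in (_ < X)%N](cat_take_drop j bn) (drop_nth 0%N hj) sumn_cat
  /=; lia.
Qed.

Lemma permuted_lift_perm (T : Type) (x0 y : T) N (i : 'I_N.+1) (s : 'S_N) x :
  permuted x0 (lift_perm i ord0 s) (y :: x) = insert_at i y (permuted x0 s x).
Proof. exact: (map_lift_perm (fun z => nth x0 (y :: x) z)). Qed.

Lemma size_permuted (T : Type) (x0 : T) N (s : 'S_N) x : size (permuted x0 s x)
  = N.
Proof. by rewrite size_map size_enum_ord. Qed.

Section ShuffleSum.
Variables (k : fieldType) (g : lmodType k).
Implicit Types (F G : seq g -> g) (b : seq int) (y : g) (x : seq g).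

Lemma shuffle_sum_nil b F :
  shuffle_sum b F [::] = if all (pred1 0) b then F [::] else 0.
Proof.
rewrite /shuffle_sum big_shuffle0 odd_perm1 expr0 scale1r.
by rewrite (size0nil (size_permuted (0 : g) (1%g : 'S_0) [::])).
Qed.

(** The sign comes from moving [y] past all the blocks before the one that it heads. *)
Lemma shuffle_sum_cons b F (y : g) x : shuffle_sum b F (y :: x) =
  \sum_(0 <= j < size b | 0 < b`_j) (-1) ^+ block_start b j *:
    shuffle_sum (decr_block b j) (fun t => F (insert_at (block_start b j) y t))
      x.
Proof.
rewrite {1}/shuffle_sum big_shuffle_recl; apply: eq_bigr => j hj.
rewrite scaler_sumr; apply: eq_bigr => s hs.
have h : (block_start b j < (size x).+1)%N by rewrite ltnS (block_start_leq hj
  hs).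
rewrite permuted_lift_perm odd_lift_perm inordK //= addbF scalerA.
by rewrite signr_addb signr_odd.
Qed.

(** The extra hypotheses hold as soon as a shuffle exists; they provide the bounds needed to compute
    [take] and [drop]. *)
Lemma shuffle_sum_ext b F G x :
  (all (fun z => 0 <= z) b -> \sum_(z <- b) z = (size x)%:Z ->
   forall t, size t = size x -> F t = G t) ->
  shuffle_sum b F x = shuffle_sum b G x.
Proof.
move=> h; apply: eq_bigr => s /and3P[b0 /eqP bs _].
by rewrite h // size_permuted.
Qed.

Lemma shuffle_sum_eq0 b F x :
  \sum_(z <- b) z <> (size x)%:Z -> shuffle_sum b F x = 0.
Proof. by move=> h; rewrite /shuffle_sum big1 // => s /and3P[_ /eqP]. Qed.

Lemma shuffle_sum_neg b F x :
  ~~ all (fun z => 0 <= z) b -> shuffle_sum b F x = 0.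
Proof. by move=> h; rewrite /shuffle_sum big1 // => s; rewrite shuffle_neg. Qed.

Lemma shuffle_sumZ a b F x : shuffle_sum b (fun t => a *: F t) x = a *:
  shuffle_sum b F x.
Proof.
rewrite /shuffle_sum scaler_sumr; apply: eq_bigr => s _.
by rewrite !scalerA mulrC.
Qed.

Lemma shuffle_sum1 n F x : (forall t, (size t)%:Z <> n -> F t = 0) ->
  shuffle_sum [:: n] F x = F x.
Proof.
elim: x n F => [|y x IH] n F hF.
  rewrite shuffle_sum_nil /= andbT; case: (eqVneq n 0) => [//|hn].
  by rewrite hF // => h; rewrite -h eqxx in hn.
rewrite shuffle_sum_cons /= big_mkcond big_nat1 /=.
case: ifP => hn; last by rewrite hF //= => h; move: hn; rewrite -h.
rewrite /block_start take0 /= expr0 scale1r -[decr_block _ _]/[:: n - 1].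
transitivity (shuffle_sum [:: n - 1] (fun t => F (y :: t)) x).
  by apply: shuffle_sum_ext => _ _ t _; rewrite /insert_at take0 drop0.
by apply: (IH (n - 1) (fun t => F (y :: t))) => t ht; apply: hF => /= h; apply:
  ht; lia.
Qed.

Lemma block_start_rcons b z j : (j <= size b)%N ->
  block_start (rcons b z) j = block_start b j.
Proof. by move=> hj; rewrite /block_start map_rcons -cats1 takel_cat //
  size_map. Qed.

Lemma decr_block_rcons b z j : (j < size b)%N ->
  decr_block (rcons b z) j = rcons (decr_block b j) z.
Proof.
elim: b j => [//|b0 b IH] [|j] //= hj; congr (_ :: _).
exact: IH.
Qed.

Lemma decr_block_rcons_last b z :
  decr_block (rcons b z) (size b) = rcons b (z - 1).
Proof.
elim: b => [//|b0 b IH] /=; congr (_ :: _); exact: IH.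
Qed.

Lemma size_decr_block b j : (j < size b)%N -> size (decr_block b j) = size b.
Proof. by move=> hj; rewrite size_set_nth; apply/maxn_idPr. Qed.

Lemma block_start_size b : block_start b (size b) = sumn (map absz b).
Proof. by rewrite /block_start take_oversize // size_map. Qed.

Lemma sumn_absz b : all (fun z => 0 <= z) b -> \sum_(z <- b) z = (sumn (map absz
  b))%:Z.
Proof. by move=> /all_ge0_Posz[bn ->]; rewrite sum_Posz map_absz_Posz. Qed.

Lemma sum_decr_block b j : (j < size b)%N ->
  \sum_(z <- decr_block b j) z = \sum_(z <- b) z - 1.
Proof.
elim: b j => [//|b0 b IH] [|j] hj.
  by rewrite -[decr_block _ _]/(b0 - 1 :: b) !big_cons addrAC.
by rewrite -[decr_block _ _]/(b0 :: decr_block b j) !big_cons IH // addrA.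
Qed.

Lemma block_start_lt b j : all (fun z => 0 <= z) b -> 0 < b`_j ->
  (block_start b j < sumn (map absz b))%N.
Proof.
move=> /all_ge0_Posz[bn ->]; rewrite nth_map_Posz /block_start map_absz_Posz =>
  bj.
have hj : (j < size bn)%N by case: (ltnP j (size bn)) bj => // h; rewrite
  nth_default.
by rewrite -[in X in (_ < X)%N](cat_take_drop j bn) (drop_nth 0%N hj) sumn_cat
  /=; lia.
Qed.

Lemma insert_at_catl (T : Type) p (u : T) s1 s2 : (p <= size s1)%N ->
  insert_at p u (s1 ++ s2) = insert_at p u s1 ++ s2.
Proof.
move=> hp; rewrite /insert_at take_cat drop_cat.
move: hp; rewrite leq_eqVlt => /predU1P[->|hp]; last by rewrite hp -catA.
by rewrite ltnn subnn take0 drop0 take_size drop_size cats0 -catA.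
Qed.

Lemma insert_first_insert_at (xi : seq g -> g) F p n y t : (p <= n)%N -> (n <=
  size t)%N ->
  insert_first xi (fun t => F (insert_at p y t)) n t =
  insert_first xi F n.+1 (insert_at p y t).
Proof.
move=> hp hn; rewrite /insert_first -{3 4}(cat_take_drop n t).
have sn : size (take n t) = n by rewrite size_takel.
have sn1 : size (insert_at p y (take n t)) = n.+1 by rewrite size_insert_at sn.
by rewrite insert_at_catl ?sn // take_size_cat // drop_size_cat.
Qed.

Lemma insert_first_insert_last (xi : cochain g) F n y t : (n <= size t)%N ->
  insert_first xi F n (insert_at n y t) = - insert_first (contract y xi) F n t.
Proof.
move=> hn; rewrite /insert_first contractE /insert_at.
rewrite take_size_cat ?size_takel // drop_size_cat ?size_takel //.
exact: (alternating_swap (@cochain_multilinear _ _ xi) (@cochain_alternating _ _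
  xi) [::]).
Qed.

Lemma sumr_circf (I : Type) (r : seq I) (P : pred I) (c : I -> k) (Fs : I -> seq
  g -> g)
    (xi : seq g -> g) x : multilinear xi ->
  circf xi (fun t => \sum_(j <- r | P j) c j *: Fs j t) x =
  \sum_(j <- r | P j) c j *: circf xi (Fs j) x.
Proof.
move=> mxi; elim: r => [|j r IH].
  by rewrite big_nil circf0r // => t; rewrite big_nil.
rewrite big_cons; case: ifP => Pj; last first.
  by rewrite -IH; apply: circf_ext => // t; rewrite big_cons Pj.
rewrite (circf_linearr (a := c j) (Q := Fs j)
  (Q' := fun t => \sum_(j <- r | P j) c j *: Fs j t)) ?IH // => t.
by rewrite big_cons Pj.
Qed.

(** Shuffles compose: shuffling the inner arguments among themselves and then with the m remaining
    arguments of [xi] is one shuffle with an additional block. Both sides obey the same recursion in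
    the first argument. *)
Lemma circf_shuffle_sum b m F (xi : cochain g) x : cochain_deg m xi ->
  circf xi (shuffle_sum b F) x =
  shuffle_sum (rcons b m) (insert_first xi F `|\sum_(z <- b) z|) x.
Proof.
elim: x xi b m F => [|y x IH] xi b m F hxi.
  rewrite /= !shuffle_sum_nil all_rcons /= andbC; case: ifP => hb /=; last
    first.
    by rewrite (multilinear0 (@cochain_multilinear _ _ xi) [::]).
  case: eqVneq => [//|hm]; rewrite hxi //= => h.
  by move/eqP: hm; apply; lia.
rewrite shuffle_sum_cons size_rcons big_mkcond big_nat_recr //= -big_mkcond /=.
congr (_ + _).
  rewrite (circf_ext (Q' := fun t => \sum_(0 <= j < size b | 0 < b`_j)
    (-1) ^+ block_start b j *: shuffle_sum (decr_block b j)
       (fun t => F (insert_at (block_start b j) y t)) t) _ (fun=> erefl)); last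
         first.
    exact: shuffle_sum_cons.
  rewrite sumr_circf; last exact: cochain_multilinear.
  rewrite [LHS]big_nat_cond [RHS]big_nat_cond; apply: eq_big => [j|j /andP[/= hj
    bj]].
    by case: ltnP => //= hj; rewrite nth_rcons hj.
  rewrite block_start_rcons ?(ltnW hj) // decr_block_rcons // (IH _ _ _ _ hxi);
    congr (_ *: _).
  apply: shuffle_sum_ext; rewrite all_rcons -cats1 big_cat big_seq1 /=.
  move=> /andP[hm hb] hs t st.
  have hb' : all (fun z => 0 <= z) b by rewrite -(decr_block_ge0 bj).
  have h := block_start_lt hb' bj.
  rewrite sum_decr_block // sumn_absz // in hs *.
  have -> : absz (sumn (map absz b)) = (absz ((sumn (map absz b))%:Z - 1)).+1 by
    lia.
  by rewrite insert_first_insert_at //; lia.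
(* Here [xi] takes [y]. Passing the inner blocks and then the inserted value produces the sign of
   [twistf]. *)
rewrite nth_rcons ltnn eqxx decr_block_rcons_last.
rewrite block_start_rcons // block_start_size.
rewrite (circf_ext (P' := contract y xi) (Q' := fun t =>
  (-1) ^+ (sumn (map absz b)).+1 *: shuffle_sum b F t)) //; last first.
  move=> t; rewrite /twistf.
  have [hb|hb] := boolP (all (fun z => 0 <= z) b); last first.
    by rewrite shuffle_sum_neg // !scaler0.
  have [->//|hs] := eqVneq (size t) (sumn (map absz b)).
  by rewrite shuffle_sum_eq0 ?scaler0 // sumn_absz // => -[] /esym /eqP;
    apply/negP.
rewrite (circf_linearr (a := (-1) ^+ (sumn (map absz b)).+1) (Q := shuffle_sum b
  F)
  (Q' := fun=> 0)); last 2 first.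
- exact: cochain_multilinear.
- by move=> t; rewrite addr0.
rewrite (circf0r (Q := fun=> 0)) ?addr0 //; last exact: cochain_multilinear.
rewrite (IH _ _ _ _ (cochain_deg_contract y hxi)).
case: ifP => hm; last first.
  rewrite shuffle_sum_neg ?scaler0 // all_rcons; apply/negP => /andP[]; lia.
rewrite exprS mulN1r scaleNr -scalerN -scaleN1r -shuffle_sumZ; congr (_ *: _).
apply: shuffle_sum_ext; rewrite all_rcons -cats1 big_cat big_seq1 /=.
move=> /andP[_ hb] hs t st; rewrite scaleN1r sumn_absz //
  -insert_first_insert_last //.
by move: hs; rewrite sumn_absz // st; lia.
Qed.

Lemma NR_circE p q (P Q : cochain g) x :
  cochain_deg p P -> cochain_deg q Q -> NR_circ p q P Q x = circ P Q x.
Proof.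
move=> hP hQ; rewrite /NR_circ -[circ P Q x]/(circf P Q x).
(* [Q] is rewritten as its own sum over the only shuffle with one block. *)
rewrite -(circf_ext (P := P) (Q := shuffle_sum [:: q + 1] Q) x (fun=> erefl));
  last first.
  by move=> t; rewrite shuffle_sum1.
by rewrite (circf_shuffle_sum _ _ _ hP) /arity big_seq1.
Qed.

Lemma NR_bracketE p q (P Q : cochain g) x :
  cochain_deg p P -> cochain_deg q Q -> NR_bracket p q P Q x = brk P Q x.
Proof.
move=> hP hQ; rewrite /NR_bracket !NR_circE //.
rewrite (brk_parity (cochain_deg_parity hP) (cochain_deg_parity hQ)) !cochainE.
by rewrite signz oddzM.
Qed.

End ShuffleSum.

(** * Iterated insertions *)

Section DegreeLists.
Variables (k : fieldType) (g : lmodType k).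
Implicit Types (m : seq int) (xi : seq (cochain g)).

Fixpoint degs m xi : Prop :=
  match m, xi with
  | [::], [::] => True
  | d :: m', F :: xi' => cochain_deg d F /\ degs m' xi'
  | _, _ => False
  end.

Lemma degs_nth m xi : size m = size xi ->
  (forall j, (j < size xi)%N -> cochain_deg m`_j xi`_j) -> degs m xi.
Proof.
elim: m xi => [|d m IH] [|F xi] //= [] hs h; split; first exact: (h 0%N).
by apply: IH => // j hj; apply: (h j.+1).
Qed.

Lemma degs_size m xi : degs m xi -> size m = size xi.
Proof. by elim: m xi => [|d m IH] [|F xi] //= [_ /IH->]. Qed.

Lemma degs_rcons m xi d F :
  degs (rcons m d) (rcons xi F) -> degs m xi /\ cochain_deg d F.
Proof.
elim: m xi => [|e m IH] [|G xi] //=; first by case.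
- by case: xi => [|? ?] [].
- by case=> _; case: m {IH}.
- by case=> hG /IH[].
Qed.

Lemma degs_omit j m xi : degs m xi -> degs (omit j m) (omit j xi).
Proof.
elim: m xi j => [|d m IH] [|F xi] // [|j] //=; first by rewrite /omit /= !drop0;
  case.
case=> hF h; split=> //; exact: IH.
Qed.

Lemma degs_set_nth j m xi d F : degs m xi -> (j < size xi)%N -> cochain_deg d F
  ->
  degs (set_nth 0 m j d) (set_nth 0 xi j F).
Proof.
elim: m xi j => [|e m IH] [|G xi] // [|j] //= [hG h] hj hF; split=> //.
exact: IH.
Qed.

Lemma degsP m xi j : degs m xi -> (j < size xi)%N -> cochain_deg m`_j xi`_j.
Proof.
by elim: m xi j => [|e m IH] [|G xi] // [|j] /= [hG h] hj; [|exact: IH].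
Qed.

End DegreeLists.

Section Tensor.
Variables (k : fieldType) (g : lmodType k).
Implicit Types (m : seq int) (xi : seq (cochain g)) (x t : seq g) (y : g).

Definition tensor_values m xi x : seq g :=
  [seq e.1 e.2 | e <- zip (map (@cochain_fun k g) xi) (reshape (map arity m)
    x)].

Definition tensor_args m xi x : seq g :=
  tensor_values m xi x ++ drop (sumn (map arity m)) x.

Lemma tensor_args_cons d m F xi x : tensor_args (d :: m) (F :: xi) x =
  F (take (arity d) x) :: tensor_args m xi (drop (arity d) x).
Proof. by rewrite /tensor_args /tensor_values /= drop_drop addnC. Qed.

Lemma size_tensor_values m xi x : size m = size xi ->
  size (tensor_values m xi x) = size xi.
Proof.
move=> h; rewrite size_map size_zip size_map -h minnE.
have -> : size (reshape (map arity m) x) = size m.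
  by elim: m x {h} => [|d m IH] x //=; rewrite IH.
by rewrite subnn subn0.
Qed.

(** The inserted [y] opens the block of the map of index [j] and so becomes its first argument; the
    other blocks are cut as before. *)
Lemma tensor_args_insert j m xi y t :
  degs m xi -> (j < size m)%N -> 0 < m`_j + 1 ->
  (sumn (map arity m) <= (size t).+1)%N ->
  tensor_args m xi (insert_at (sumn (take j (map arity m))) y t) =
  tensor_args (decr_block m j) (set_nth 0 xi j (contract y xi`_j)) t.
Proof.
elim: m xi j t => [|d m IH] [|F xi] // j t [hF h].
case: j => [|j] hj mj ht.
  rewrite -[decr_block _ _]/(d - 1 :: m) -[set_nth _ _ _ _]/(contract y F ::
    xi).
  rewrite !tensor_args_cons [take 0 _]/= /insert_at take0 drop0 /= in mj *.
  have -> : arity d = (arity (d - 1)).+1 by rewrite /arity; lia.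
  by [].
rewrite -[decr_block _ _]/(d :: decr_block m j).
rewrite -[set_nth _ _ _ _]/(F :: set_nth 0 xi j (contract y xi`_j)).
rewrite !tensor_args_cons /= in hj mj ht *.
have ge1 : (0 < sumn (map arity m))%N.
  rewrite -(cat_take_drop j (map arity m)) sumn_cat (drop_nth 0%N) ?size_map //.
  by rewrite (nth_map 0) //= /arity; lia.
have dt : (arity d <= size t)%N by lia.
have -> : insert_at (arity d + sumn (take j (map arity m))) y t =
    take (arity d) t ++ insert_at (sumn (take j (map arity m))) y (drop (arity
      d) t).
  by rewrite -insert_at_cat size_takel // cat_take_drop.
rewrite take_size_cat ?size_takel // drop_size_cat ?size_takel //.
by rewrite IH // size_drop; lia.
Qed.

Lemma tensor_args_insert_last m xi y t : size m = size xi ->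
  (sumn (map arity m) <= size t)%N ->
  tensor_args m xi (insert_at (sumn (map arity m)) y t) =
  tensor_values m xi t ++ y :: drop (sumn (map arity m)) t.
Proof.
elim: m xi t => [|d m IH] [|F xi] t //=; first by rewrite /tensor_args
  /insert_at take0 drop0.
case=> hs ht; rewrite tensor_args_cons.
have dt : (arity d <= size t)%N by lia.
have -> : insert_at (arity d + sumn (map arity m)) y t =
    take (arity d) t ++ insert_at (sumn (map arity m)) y (drop (arity d) t).
  by rewrite -insert_at_cat size_takel // cat_take_drop.
rewrite take_size_cat ?size_takel // drop_size_cat ?size_takel //.
rewrite IH // ?size_drop; last by lia.
by rewrite /tensor_values /= drop_drop addnC.
Qed.

Definition tensor_sign m : int :=
  \sum_(b < size m) \sum_(a < b) m`_b * (m`_a + 1).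

Lemma tensor_sign_cons d m :
  tensor_sign (d :: m) = tensor_sign m + (d + 1) * \sum_(e <- m) e.
Proof.
have E l : tensor_sign l =
    \sum_(0 <= b < size l) \sum_(0 <= a < b) l`_b * (l`_a + 1).
  by rewrite /tensor_sign big_mkord; apply: eq_bigr => b _; rewrite big_mkord.
rewrite !E /= big_nat_recl // big_geq // add0r.
under eq_bigr do rewrite big_nat_recl //=.
by rewrite big_split /= addrC -mulr_suml mulrC [\sum_(e <- m) e](big_nth 0).
Qed.

(** The entry of index [j] is multiplied with the arities of the maps before it, and its arity with
    the degrees of the maps after it. *)
Lemma tensor_sign_decr m j : (j < size m)%N ->
  oddz (tensor_sign (decr_block m j)) = oddz (tensor_sign m)
   (+) oddz (\sum_(e <- take j m) (e + 1)) (+) oddz (\sum_(e <- drop j.+1 m) e).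
Proof.
elim: m j => [//|d m IH] [|j] hj.
  rewrite -[decr_block _ _]/(d - 1 :: m) !tensor_sign_cons take0 big_nil /=
    drop0.
  by rewrite !(oddzD, oddzM, oddzN, oddz0, oddz1); do 4 case: (oddz _).
rewrite -[decr_block _ _]/(d :: decr_block m j) !tensor_sign_cons /=.
rewrite big_cons sum_decr_block // !(oddzD, oddzM, oddzN, oddz0, oddz1) IH //.
by do 5 case: (oddz _).
Qed.

Lemma odd_sumn_arity m : odd (sumn (map arity m)) = oddz (\sum_(e <- m) (e +
  1)).
Proof.
elim: m => [|d m IH] /=; first by rewrite big_nil.
by rewrite big_cons oddD IH [RHS]oddzD.
Qed.

Lemma comp_tensorE (f : seq g -> g) m xi x :
  size m = size xi ->
  comp_tensor f m (map (@cochain_fun k g) xi) x =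
  (-1) ^+ oddz (tensor_sign m) *: f (tensor_args m xi x).
Proof. by move=> _; rewrite -signz. Qed.

Lemma alternating_move (f : cochain g) (s1 s2 : seq g) y :
  f (s1 ++ y :: s2) = (-1) ^+ size s1 *: contract y f (s1 ++ s2).
Proof.
elim: s1 f => [|v s1 IH] f /=; first by rewrite scale1r.
rewrite -[LHS]/(contract v f (s1 ++ y :: s2)) IH contract_swap cochainN.
by rewrite exprS mulN1r scaleNr scalerN.
Qed.

End Tensor.

Section IteratedInsertion.
Variables (k : fieldType) (g : lmodType k) (mu lam : k).
Implicit Types (m : seq int) (xi : seq (cochain g)) (x t : seq g) (y : g).
Implicit Types (u v : cochain (dbl g)) (f : cochain g).

Notation mulT := (@mulT k g mu lam).
Notation ext := (@ext k g mu lam).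
Notation postT := (@postT k g mu lam).

Definition circA u xi : cochain (dbl g) := foldl (fun w F => circ w (inA F)) u
  xi.

Lemma circAD u v xi : circA (u + v) xi = circA u xi + circA v xi.
Proof. by elim: xi u v => [//|F xi IH] u v /=; rewrite circDl IH. Qed.

Lemma circAZ a u xi : circA (a *: u) xi = a *: circA u xi.
Proof. by elim: xi u => [//|F xi IH] u /=; rewrite circZl IH. Qed.

Lemma circA_rcons u xi F : circA u (rcons xi F) = circ (circA u xi) (inA F).
Proof. by rewrite /circA -cats1 foldl_cat. Qed.

(** Either [u] takes the new argument, with the sign of all the [xi], or one of the [xi] does, with
    the sign of those inserted after it. *)
Lemma contract_circA (v : dbl g) u m xi : degs m xi ->
  contract v (circA u xi) =
    (-1) ^+ oddz (\sum_(e <- m) e) *: circA (contract v u) xi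
  + \sum_(0 <= j < size xi) (-1) ^+ oddz (\sum_(e <- drop j.+1 m) e) *:
      circA u (set_nth 0 xi j (contract v.2 xi`_j)).
Proof.
elim: xi m u => [|F xi IH] [|d m] // u.
  by move=> _; rewrite big_nil big_geq // addr0 expr0 scale1r.
move=> [hF h]; rewrite -[circA u (F :: xi)]/(circA (circ u (inA F)) xi).
rewrite (IH _ _ h) contract_circ contract_inA -inA_twist (twist_deg hF).
rewrite linearZ /= circZr circAD circAZ big_nat_recl //= drop0 big_cons oddzD.
rewrite scalerDr scalerA -signr_addb addrA; congr (_ + _).
by rewrite addrC addbC.
Qed.

(** No argument can go into [v], so all of them follow its constant value. *)
Lemma circ_dead u v (s : seq (dbl g)) : (forall w, w \in s -> contract w v = 0)
  ->
  circ u v s = u (v [::] :: s).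
Proof.
elim: s u v => [//|w s IH] u v h; rewrite circ_cons h ?mem_head // circ0r.
rewrite add0r IH => [|z hz]; last first.
  by rewrite contract_twist h ?inE ?hz ?orbT // linear0 oppr0.
rewrite twistE expr1 contractE.
have -> := multilinearZ (@cochain_multilinear _ _ u) [:: w] s (-1) (v [::]).
rewrite scaleN1r (alternating_swap (@cochain_multilinear _ _ u)
  (@cochain_alternating _ _ u) [::]) opprK.
by [].
Qed.

Lemma circA_dead u xi (s : seq g) :
  circA u xi [seq (z, 0) : dbl g | z <- s] =
  u ([seq (F [::], 0) : dbl g | F : cochain g <- xi] ++ [seq (z, 0) : dbl g | z
    <- s]).
Proof.
elim: xi u => [//|F xi IH] u; rewrite -[circA u (F :: xi)]/(circA (circ u (inA
  F)) xi).
rewrite IH circ_dead // => w; rewrite mem_cat => h.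
rewrite contract_inA; have -> : w.2 = 0 by case/orP: h => /mapP[z _ ->].
by rewrite contract0 linear0.
Qed.

Lemma ext_dead f (s : seq g) : ext f [seq (z, 0) : dbl g | z <- s] = (f s, 0).
Proof.
elim: s f => [//|x s IH] f; set s' := map _ s in IH *.
rewrite -[LHS]/(ext (contract x f) s' + mulT (ext (contract 0 f) s')).
by rewrite IH contract0 linear0 cochain0 linear0 addr0.
Qed.

Lemma iter_postTE n u s : iter n postT u s = iter n mulT (u s).
Proof. by elim: n => [//|n IH] /=; rewrite -IH. Qed.

Definition mulTn n (v : g) : dbl g := iter n mulT ((v, 0) : dbl g).

Lemma mulTn_is_linear n : linear (mulTn n).
Proof.
move=> a v w; rewrite /mulTn; elim: n => [|n IH] /=.
  by congr (_, _); rewrite /= scaler0 addr0.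
by rewrite IH linearP.
Qed.
HB.instance Definition _ n :=
  GRing.isLinear.Build k g (dbl g) _ (mulTn n) (mulTn_is_linear n).

Lemma mulTnD n (v w : g) : mulTn n (v + w) = mulTn n v + mulTn n w.
Proof. exact: linearD. Qed.
Lemma mulTnZ n a (v : g) : mulTn n (a *: v) = a *: mulTn n v.
Proof. exact: linearZ. Qed.
Lemma mulTn0 n : mulTn n 0 = 0.
Proof. exact: linear0. Qed.
Lemma mulTn_sum n (I : Type) (r : seq I) (P : pred I) (F : I -> g) :
  mulTn n (\sum_(i <- r | P i) F i) = \sum_(i <- r | P i) mulTn n (F i).
Proof. exact: linear_sum. Qed.

Lemma cochain_sum (V : lmodType k) (I : Type) (r : seq I) (P : pred I)
    (F : I -> cochain V) s :
  (\sum_(i <- r | P i) F i) s = \sum_(i <- r | P i) F i s.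
Proof. by elim/big_rec2: _ => // i w F' _ <-. Qed.

(** Each argument from gT brings one factor T out of the extension: the power of T counts the free
    slots of [f]. *)
Lemma contract_iter_postT_ext n f y :
  contract (0, y) (iter n postT (ext f)) = iter n.+1 postT (ext (contract y f)).
Proof.
apply: cochain_eq => s; rewrite contractE !iter_postTE iterSr; congr (iter n
  mulT _).
rewrite -[LHS]/(ext (contract 0 f) s + mulT (ext (contract y f) s)).
by rewrite contract0 linear0 cochain0 add0r.
Qed.

Lemma tensor_args_nil m xi : size m = size xi ->
  tensor_args m xi [::] = [seq F [::] | F : cochain g <- xi].
Proof.
elim: m xi => [|d m IH] [|F xi] //= [] hs.
by rewrite tensor_args_cons /= IH.
Qed.

Lemma tensor_sign0 m : all (pred1 0) [seq e + 1 | e <- m] -> tensor_sign m = 0.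
Proof.
elim: m => [|d m IH] /=; first by rewrite /tensor_sign big_ord0.
by case/andP=> /eqP hd /IH h; rewrite tensor_sign_cons h hd mul0r.
Qed.

Lemma cochain_mem0 (V : lmodType k) (P : cochain V) s : 0 \in s -> P s = 0.
Proof. by case/splitPr => s1 s2; apply/multilinear0/cochain_multilinear. Qed.

Lemma map_succ_decr_block m i : (i < size m)%N ->
  [seq e + 1 | e <- decr_block m i] = decr_block [seq e + 1 | e <- m] i.
Proof.
elim: m i => [//|d m IH] [|i] hi; first by congr (_ :: _); apply: addrAC.
by congr (_ :: _); apply: IH.
Qed.

Lemma decr_block_neg (b : seq int) i : (i < size b)%N -> ~~ (0 < b`_i) ->
  ~~ all (fun z => 0 <= z) (decr_block b i).
Proof.
move=> hi; apply: contra => /(all_nthP 0)/(_ i).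
by rewrite size_decr_block // nth_set_nth /= eqxx => /(_ hi); lia.
Qed.

Lemma block_start_succ m i :
  block_start [seq e + 1 | e <- m] i = sumn (take i (map arity m)).
Proof. by rewrite /block_start -map_comp. Qed.

Lemma oddz_sum_succ m :
  oddz (\sum_(e <- m) (e + 1)) = oddz (\sum_(e <- m) e) (+) odd (size m).
Proof.
elim: m => [|d m IH]; rewrite ?big_nil // !big_cons !oddzD IH oddz1 /=.
by case: (odd _); do 2 case: (oddz _).
Qed.

(** The inserted maps contribute no T and each remaining slot of [f] contributes one. The number [j]
    accumulates the powers already extracted in the induction. If the number of free slots is
    negative, the shuffle sum is 0 and the exponent is immaterial. *)
Lemma circA_ext n j f m xi x : cochain_deg n f -> degs m xi ->
  circA (iter j postT (ext f)) xi [seq (0, z) : dbl g | z <- x] =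
  mulTn (j + absz (n + 1 - (size xi)%:Z)%R)
    (shuffle_sum (rcons [seq e + 1 | e <- m] (n + 1 - (size xi)%:Z))
      (comp_tensor f m (map (@cochain_fun k g) xi)) x).
Proof.
elim: x n j f m xi => [|y x IH] n j f m xi hf h; have hs := degs_size h.
  rewrite -[map _ [::]]/[seq (z, 0) : dbl g | z <- [::]] circA_dead cats0.
  rewrite (map_comp (fun z => (z, 0) : dbl g) (fun F : cochain g => F [::])).
  rewrite iter_postTE ext_dead shuffle_sum_nil comp_tensorE //.
  rewrite tensor_args_nil // all_rcons /=; case: eqVneq => [-> |hr] /=; last
    first.
    rewrite hf ?linear0 -/(mulTn j 0) ?linear0 // size_map => e.
    by move: hr; rewrite -e subrr eqxx.
  rewrite addn0; case: ifP => [/tensor_sign0 ->|/negbT].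
    by rewrite expr0 scale1r.
  (* Some block is not empty, so that there is no shuffle. On the other side the corresponding [xi]
     has no constant and [f] receives the argument 0. *)
  rewrite all_map -has_predC => /(has_nthP 0)[i hi] /= /eqP hmi.
  rewrite cochain_mem0 //; apply/mapP; exists xi`_i; first by rewrite mem_nth
    -?hs.
  by rewrite (degsP h) -?hs // => e; apply: hmi; rewrite -e.
(* Either [f] takes [y], which yields one more T, or some [xi] does; in the shuffle sum these are
   the last block and the others. *)
rewrite map_cons -contractE (contract_circA _ _ h) cochainD cochainZ.
rewrite contract_iter_postT_ext (IH (n - 1) _ _ m) //; last exact:
  cochain_deg_contract.
rewrite shuffle_sum_cons size_rcons [X in _ = mulTn _ X]big_mkcond big_nat_recr
  //=.
rewrite size_map hs mulTnD addrC; congr (_ + _).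
  rewrite cochain_sum mulTn_sum; apply: eq_big_nat => i /andP[_ hi].
  have hi' : (i < size m)%N by rewrite hs.
  set r := n + 1 - (size xi)%:Z.
  have hb : (rcons [seq e + 1 | e <- m] r)`_i = m`_i + 1.
    by rewrite nth_rcons size_map hi' (nth_map 0).
  have hc : cochain_deg (m`_i - 1) (contract y xi`_i).
    exact/cochain_deg_contract/(degsP h).
  rewrite cochainZ (IH n j f (decr_block m i)) //; last exact: degs_set_nth.
  rewrite size_set_nth (maxn_idPr hi) -/r hb.
  have em : [seq e + 1 | e <- decr_block m i] = decr_block [seq e + 1 | e <- m]
    i.
    exact: map_succ_decr_block.
  rewrite em -decr_block_rcons ?size_map //.
  case: ifP => hm; last first.
    rewrite shuffle_sum_neg ?mulTn0 ?scaler0 //; apply: decr_block_neg.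
      by rewrite size_rcons size_map ltnS ltnW.
    by rewrite hb hm.
  rewrite block_start_rcons ?size_map 1?ltnW // -mulTnZ -!shuffle_sumZ.
  congr mulTn; apply: shuffle_sum_ext; rewrite decr_block_rcons ?size_map //.
  rewrite all_rcons -cats1 big_cat big_seq1 /= => /andP[hr hall] hsum t ht.
  have hall' : all (fun z => 0 <= z) [seq e + 1 | e <- m].
    by rewrite -(decr_block_ge0 (j := i)) // (nth_map 0).
  rewrite sum_decr_block ?size_map // sumn_absz // -map_comp in hsum.
  rewrite !comp_tensorE ?size_decr_block // ?size_set_nth ?(maxn_idPr hi) //.
  rewrite block_start_succ tensor_args_insert //; last first.
    by move: hsum; rewrite -[map (absz \o _) m]/(map arity m); lia.
  (* The change of the Koszul sign has two parts: the arities of the earlier maps give the sign of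
     the shuffle, the degrees of the later ones the sign of the contraction. *)
  rewrite !scalerA -(signr_odd _ (sumn _)) -!signr_addb -map_take
    odd_sumn_arity.
  rewrite tensor_sign_decr //; congr (_ ^+ nat_of_bool _ *: _).
  by do 3 case: (oddz _).
rewrite nth_rcons size_map hs ltnn eqxx -hs.
set r := n + 1 - (size m)%:Z; rewrite (_ : n - 1 + 1 - (size m)%:Z = r - 1);
  last by lia.
case: ifP => hr; last first.
  rewrite shuffle_sum_neg ?mulTn0 ?linear0 ?scaler0 //.
  by rewrite all_rcons; apply/negP => /andP[]; lia.
have -> : (j + absz r)%N = (j + absz (r - 1)%R).+1 by lia.
rewrite -[mulT _]/(mulTn (j + absz (r - 1)%R).+1 _) -mulTnZ -!shuffle_sumZ;
  congr mulTn.
have -> : decr_block (rcons [seq e + 1 | e <- m] r) (size m) =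
    rcons [seq e + 1 | e <- m] (r - 1).
  by rewrite -(size_map (fun e => e + 1) m) decr_block_rcons_last.
rewrite block_start_rcons ?size_map // block_start_succ take_oversize ?size_map
  //.
apply: shuffle_sum_ext; rewrite all_rcons -cats1 big_cat big_seq1 /=.
move=> /andP[hr' hall] hsum t ht; rewrite sumn_absz // -map_comp in hsum.
rewrite !comp_tensorE // tensor_args_insert_last //; last first.
  by move: hsum; rewrite -[map (absz \o _) m]/(map arity m); lia.
(* [y] passes the blocks of all the [xi] and then their values; as arity and degree differ by one
   for each map, the sum of the degrees remains. *)
rewrite alternating_move size_tensor_values // -hs !scalerA; congr (_ *: _).
rewrite -(signr_odd _ (sumn _)) -(signr_odd _ (size m)) odd_sumn_arity
  oddz_sum_succ.
rewrite -!signr_addb; congr (_ ^+ nat_of_bool _).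
by case: (odd _); do 2 case: (oddz _).
Qed.

End IteratedInsertion.

(** * The iterated brackets in closed form *)

Section HigherBrackets.
Variables (k : fieldType) (g : lmodType k) (mu lam : k).
Implicit Types (m : seq int) (xi : seq (cochain g)) (x t : seq g) (y : g).
Implicit Types (u v : cochain (dbl g)) (f : cochain g).

Notation ext := (@ext k g mu lam).

(** Multiplying by T is one step of the recursion of B. The step from T^0 is separate, because
    A_(-1) = -1 is a convention and not lam times a B. *)
Lemma mulTnE (r : nat) (v : g) :
  mulTn mu lam r v = (- (coefA mu lam (r%:Z - 1) *: v), Defs.coefB mu lam r *:
    v).
Proof.
elim: r => [|r IH].
  by congr (_, _); rewrite /coefA /Defs.coefB /= ?scaleN1r ?opprK ?scale0r.
have succE (q : nat) : q.+1%:Z - 1 = q%:Z by lia.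
rewrite succE -[LHS]/(mulT mu lam (mulTn mu lam r v)) IH; congr (_, _).
  by rewrite -[coefA mu lam r]/(lam * Defs.coefB mu lam r) -scalerA.
case: r {IH} => [|r]; rewrite -[LHS]/(- (_ *: v) + mu *: (_ *: v)).
  rewrite -[coefA mu lam _]/(-1) -[Defs.coefB mu lam 0]/0 -[Defs.coefB mu lam
    1]/1.
  by rewrite scaleN1r opprK scale0r scaler0 addr0 scale1r.
rewrite succE Defs.coefB_rec -[coefA mu lam r]/(lam * Defs.coefB mu lam r).
by rewrite scalerA addrC scalerBl.
Qed.

Definition brkA u xi : cochain (dbl g) := foldl (fun w F => brk w (inA F)) u xi.

Lemma brkA_rcons u xi F : brkA u (rcons xi F) = brk (brkA u xi) (inA F).
Proof. by rewrite /brkA -cats1 foldl_cat. Qed.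

Lemma cochain_deg_circA n m xi u : cochain_deg n u -> degs m xi ->
  cochain_deg (n + \sum_(e <- m) e) (circA u xi).
Proof.
elim: xi m n u => [|F xi IH] [|d m] // n u hu; first by rewrite big_nil addr0.
case=> hF h; rewrite big_cons addrA; apply: IH => //.
exact/cochain_deg_circ/cochain_deg_inA.
Qed.

Lemma cochain_deg_brkA n m xi u : cochain_deg n u -> degs m xi ->
  cochain_deg (n + \sum_(e <- m) e) (brkA u xi).
Proof.
elim: xi m n u => [|F xi IH] [|d m] // n u hu; first by rewrite big_nil addr0.
case=> hF h; rewrite big_cons addrA; apply: IH => //.
exact/cochain_deg_brk/cochain_deg_inA.
Qed.

Lemma circ_sumr (V : lmodType k) (I : Type) (r : seq I) (P : pred I) (w :
  cochain V)
    (F : I -> cochain V) :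
  circ w (\sum_(i <- r | P i) F i) = \sum_(i <- r | P i) circ w (F i).
Proof. exact: linear_sum. Qed.

Lemma circ_suml (V : lmodType k) (I : Type) (r : seq I) (P : pred I) (w :
  cochain V)
    (F : I -> cochain V) :
  circ (\sum_(i <- r | P i) F i) w = \sum_(i <- r | P i) circ (F i) w.
Proof.
by apply: (big_morph (fun z => circ z w)) => [z1 z2|]; rewrite ?circDl ?circ0l.
Qed.

(** The associator vanishes because the one with its last two maps exchanged does: there, maps with
    values in g are inserted into elements of a. *)
Lemma circ_inA_circ F G u p q : parity p u -> parity q G ->
  circ (circ (inA F) u) (inA G) = circ (inA F) (circ u (inA G)).
Proof.
move=> hu hG; have := assoc_sym (inA F) hu (parity_inA hG).
rewrite /assoc circ_inA_inA circ0l (circ_inA0 F (u := circ (inA G) u)); last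
  first.
  exact: circ_inA_snd.
by rewrite subr0 scaler0 => /eqP; rewrite subr_eq0 => /eqP.
Qed.

Lemma omit_rcons (T : Type) j (s : seq T) a : (j < size s)%N ->
  omit j (rcons s a) = rcons (omit j s) a.
Proof.
move=> hj; rewrite /omit -!cats1 takel_cat 1?ltnW // drop_cat -catA.
case: ltnP => // h; congr (_ ++ _).
by rewrite [drop _ s]drop_oversize // (eqP (_ : j.+1 - size s == 0)%N)
  ?subn_eq0.
Qed.

Lemma omit_rcons_last (T : Type) (s : seq T) a : omit (size s) (rcons s a) = s.
Proof.
by rewrite /omit -cats1 take_size_cat // drop_oversize ?cats0 // size_cat addn1.
Qed.

(** A bracket with some [xi] either inserts it or puts it outermost. In the second case the values
    lie in g, and no further [xi] can be put around them. The sign is that of the bracket at which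
    the [xi] becomes outermost. *)
Lemma brkA_circA n m xi u : cochain_deg n u -> degs m xi ->
  brkA u xi = circA u xi -
   \sum_(0 <= j < size xi)
     (-1) ^+ oddz ((n + \sum_(h < j) m`_h) * m`_j) *:
       circ (inA xi`_j) (circA u (omit j xi)).
Proof.
move=> hu; elim/last_ind: xi m => [|xi F IH] m.
  by move=> _; rewrite big_geq // subr0.
case/lastP: m => [|m d]; first by case: xi {IH}.
move=> /degs_rcons[h hF]; have hs := degs_size h.
rewrite brkA_rcons (brk_parity (cochain_deg_parity (cochain_deg_brkA hu h))
  (cochain_deg_parity (cochain_deg_inA hF))).
rewrite (IH _ h) circDl circNl circ_suml circDr circNr circ_sumr.
have -> : \sum_(0 <= j < size xi) circ (inA F)
     ((-1) ^+ oddz ((n + \sum_(h < j) m`_h) * m`_j) *: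
        circ (inA xi`_j) (circA u (omit j xi))) = 0.
  rewrite big1 // => j _; rewrite circZr circ_inA0 ?scaler0 //.
  exact: circ_inA_snd.
rewrite subr0 -circA_rcons size_rcons big_nat_recr //= opprD addrA; congr (_ + _
  - _).
  congr (- _); apply: eq_big_nat => j /andP[_ hj]; have hj' : (j < size m)%N by
    rewrite hs.
  rewrite circZl (circ_inA_circ _ (cochain_deg_parity (cochain_deg_circA hu
    (degs_omit j h)))
    (cochain_deg_parity hF)) -circA_rcons !nth_rcons hj hj'.
  rewrite omit_rcons //; congr (_ ^+ nat_of_bool (oddz ((_ + _) * _)) *: _).
  by apply: eq_bigr => i _; rewrite nth_rcons (ltn_trans _ hj').
rewrite -[in (rcons m d)`_(size xi)]hs !nth_rcons hs !ltnn !eqxx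
  omit_rcons_last.
rewrite oddzM; congr ((-1) ^+ nat_of_bool (oddz (_ + _) && _) *: _).
rewrite (big_nth 0) big_mkord hs; apply: eq_bigr => i _.
by rewrite nth_rcons hs ltn_ord.
Qed.

(** An outermost element of a reads the T-coefficient of what is inserted; hence B in the second sum
    where the first has A. *)
Lemma proj_circ_inA F u x :
  proj (circ (inA F) u) x = circf F (fun t => (u [seq (0, z) : dbl g | z <-
    t]).2) x.
Proof.
rewrite projE; elim: x F u => [|y x IH] F u; first by rewrite circ_nil.
rewrite map_cons circ_cons contract_inA fstD !IH /=; congr (_ + _).
by apply: circf_ext => // t; rewrite /twistf size_map.
Qed.

Lemma projB u v : proj (u - v) = proj u - proj v. Proof. exact: linearB. Qed.
Lemma projZ a u : proj (a *: u) = a *: proj u. Proof. exact: linearZ. Qed.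
Lemma proj_sum (I : Type) (r : seq I) (P : pred I) (F : I -> cochain (dbl g)) :
  proj (\sum_(i <- r | P i) F i) = \sum_(i <- r | P i) proj (F i).
Proof. exact: linear_sum. Qed.

Lemma omit_map (T U : Type) (h : T -> U) j s : omit j (map h s) = map h (omit j
  s).
Proof. by rewrite /omit map_cat map_take map_drop. Qed.

Lemma size_omit (T : Type) j (s : seq T) : (j < size s)%N -> size (omit j s) =
  (size s).-1.
Proof. by move=> hj; rewrite size_cat size_takel 1?ltnW // size_drop; lia. Qed.

Lemma proj_brkA n f m xi x : cochain_deg n f -> degs m xi ->
  proj (brkA (ext f) xi) x =
  higher_bracket mu lam (size xi).+1 n f m (map (@cochain_fun k g) xi) x.
Proof.
move=> hf h; rewrite (brkA_circA (cochain_deg_ext mu lam hf) h) projB proj_sum.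
rewrite cochainD cochainN cochain_sum /higher_bracket big_mkord; congr (_ - _).
  rewrite projE (circA_ext mu lam 0 x hf h) mulTnE /= -scaleNr /higher_term1.
  rewrite (_ : n + 2 - (size xi).+1%:Z = n + 1 - (size xi)%:Z); last by lia.
  set r := n + 1 - (size xi)%:Z.
  have [hr|hr] := boolP (0 <= r); last first.
    by rewrite shuffle_sum_neg ?scaler0 ?oppr0 // all_rcons negb_and hr.
  by rewrite scaleNr (_ : (absz r)%:Z - 1 = n - (size xi).+1%:Z + 1) //; lia.
apply: eq_bigr => j _; have hj := ltn_ord j.
have hj' : (j < size m)%N by rewrite (degs_size h).
have ho := degs_omit j h; have so : size (omit j xi) = (size xi).-1 by apply:
  size_omit.
rewrite projZ cochainZ proj_circ_inA /higher_term2 signz -scalerA; congr (_ *: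
  _).
set r := n + 3 - (size xi).+1%:Z.
have er : n + 1 - (size (omit j xi))%:Z = r by rewrite so; lia.
rewrite (circf_ext (P' := xi`_j) (Q' := fun t => Defs.coefB mu lam r *:
  shuffle_sum (rcons [seq e + 1 | e <- omit j m] r)
    (comp_tensor f (omit j m) (map (@cochain_fun k g) (omit j xi))) t)) //; last
      first.
  move=> t; rewrite (circA_ext mu lam 0 t hf ho) er mulTnE add0n.
  rewrite -[LHS]/(Defs.coefB mu lam (absz r)%:Z *: _).
  have [hr|hr] := boolP (0 <= r); first by rewrite gez0_abs.
  by rewrite shuffle_sum_neg ?scaler0 // all_rcons negb_and hr.
rewrite (circf_linearr (a := Defs.coefB mu lam r) (Q := shuffle_sum
  (rcons [seq e + 1 | e <- omit j m] r)
    (comp_tensor f (omit j m) (map (@cochain_fun k g) (omit j xi)))) (Q' :=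
      fun=> 0));
  last 2 first.
- exact: cochain_multilinear.
- by move=> t; rewrite addr0.
rewrite (circf0r (Q := fun=> 0)) ?addr0 //; last exact: cochain_multilinear.
rewrite (circf_shuffle_sum _ _ _ (degsP h hj)) omit_map (nth_map 0) //.
by rewrite (_ : n - (size xi).+1%:Z + 3 = r) //; lia.
Qed.

End HigherBrackets.

(** * Graded symmetric maps *)

Lemma take_filter_ord N i (T : Type) (c : 'I_N -> T) : (i <= N)%N ->
  take i [seq c h | h <- enum 'I_N] = map c (filter (fun h : 'I_N => h < i)%N
    (enum 'I_N)).
Proof.
move=> hi; rewrite -map_take; congr map; apply: (inj_map val_inj).
rewrite map_take val_enum_ord take_iota (minn_idPl hi).
rewrite -[iota 0 i](filter_iota_ltn 0 hi) -val_enum_ord filter_map.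
by congr map; apply: eq_filter.
Qed.

Lemma map_permuted (T U : Type) (h : T -> U) x0 N (s : 'S_N) x :
  map h (permuted x0 s x) = permuted (h x0) s (map h x).
Proof.
rewrite /permuted -map_comp; apply: eq_map => i /=.
have [hi|hi] := ltnP (s i) (size x); first by rewrite (nth_map x0).
by rewrite !nth_default // size_map.
Qed.

Section GradedSymmetry.
Variables (k : fieldType) (L : lmodType k) (G : int -> L -> Prop).
Implicit Types (p q : L * int) (X Y A : seq (L * int)) (F : seq L -> L).

Definition sg (d e : int) : k := (-1) ^+ (oddz d && oddz e).

Lemma sgE d e : (-1) ^ (d * e) = sg d e.
Proof. by rewrite signz oddzM. Qed.

Lemma sgDr d e1 e2 : sg d (e1 + e2) = sg d e1 * sg d e2.
Proof. by rewrite /sg oddzD; case: (oddz d) (oddz e1) (oddz e2) => [] [] [];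
  rewrite /= ?expr0 ?expr1; ring. Qed.

Lemma sgC d e : sg d e = sg e d. Proof. by rewrite /sg andbC. Qed.

Lemma sg0 d : sg d 0 = 1. Proof. by rewrite /sg oddz0 andbF. Qed.

Lemma sgK d e : sg d e * sg d e = 1.
Proof. by rewrite /sg -expr2 sqrr_sign. Qed.

(** The only new inversions are those of the first element with the elements now placed before
    it. *)
Lemma koszul_sign_lift N (i : 'I_N.+1) (s : 'S_N) (e : int) (d : seq int) :
  koszul_sign k (lift_perm i ord0 s) (e :: d) =
  (\prod_(z <- take i [seq d`_(s h) | h <- enum 'I_N]) sg e z) * koszul_sign k s
    d.
Proof.
have hi : (i <= N)%N by rewrite -ltnS.
rewrite take_filter_ord // big_map big_filter big_enum_cond /=.
rewrite /koszul_sign (bigD1_ord i) //= lift_perm_id /=.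
rewrite big_pred0 ?mul1r => [|j]; last by rewrite ltn0 andbF.
rewrite [X in _ = X * _]big_mkcond -big_split /=; apply: eq_bigr => p _.
rewrite big_mkcond (bigD1_ord i) //= lift_perm_id lift_perm_lift /= [in
  RHS]big_mkcond /=.
congr (_ * _).
  have -> : (bump i p < i)%N = (p < i)%N by rewrite /bump; lia.
  by rewrite andbT -sgE mulrC.
apply: eq_bigr => q _; rewrite lift_perm_lift /= !ltnS.
have -> : (bump i p < bump i q)%N = (p < q)%N by rewrite /bump; lia.
by [].
Qed.

(** Elements are paired with a degree because 0 is homogeneous of every degree, so the element alone
    does not determine the sign. *)
Fixpoint homp X : Prop := if X is p :: X' then G p.2 p.1 /\ homp X' else True.

Lemma homp_cat X Y : homp (X ++ Y) <-> homp X /\ homp Y.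
Proof. by elim: X => [|p X IH] /=; tauto. Qed.

Lemma homp_nth X i : homp X -> (i < size X)%N ->
  G (nth (0, 0) X i).2 (nth (0, 0) X i).1.
Proof. by elim: X i => [//|p X IH] [|i] /= [hp hX] hi //; apply: IH. Qed.

(** Only neighbours are exchanged, which suits induction on lists; [gsymp_permuted] recovers all
    permutations. *)
Definition gsymp (H : seq (L * int) -> L) : Prop := forall X1 p q X2,
  homp (X1 ++ p :: q :: X2) ->
  H (X1 ++ q :: p :: X2) = sg p.2 q.2 *: H (X1 ++ p :: q :: X2).

Lemma gsymp_cons H p : G p.2 p.1 -> gsymp H -> gsymp (fun X => H (p :: X)).
Proof. by move=> hp hH X1 q r X2 h; rewrite -!cat_cons hH. Qed.

Lemma gsymp_move H p X1 X2 : gsymp H -> homp (X1 ++ p :: X2) ->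
  H (X1 ++ p :: X2) = (\prod_(q <- X1) sg p.2 q.2) *: H (p :: X1 ++ X2).
Proof.
elim: X1 H => [|q X1 IH] H hH; first by rewrite big_nil scale1r.
move=> /= [hq h]; rewrite (IH (fun X => H (q :: X))) //; last exact: gsymp_cons.
have h' : homp (p :: q :: X1 ++ X2).
  by move: h; rewrite homp_cat /= homp_cat; tauto.
by rewrite (hH [::] p q _ h') big_cons scalerA mulrC.
Qed.

Lemma gsymp_permuted H X N (s : 'S_N) : gsymp H -> size X = N -> homp X ->
  H (permuted (0, 0) s X) = koszul_sign k s (map snd X) *: H X.
Proof.
elim: N X H s => [|N IH] X H s hH.
  case: X => // _ _; rewrite /koszul_sign big_ord0 scale1r; congr H.
  by apply: size0nil; rewrite size_permuted.
case: X => [|p X] //= [sX] [hp hX].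
have [f fK Kf] := lift_perm_bij N; rewrite -(Kf s); case: (f s) => i s' /= {s f
  fK Kf}.
rewrite permuted_lift_perm koszul_sign_lift /insert_at.
have hperm : homp (permuted (0, 0) s' X).
  rewrite /permuted; elim: (enum _) => [//|j r IHr] /=; split=> //.
  by apply: homp_nth => //; rewrite sX.
rewrite gsymp_move //; last first.
  by move: hperm; rewrite -{1}(cat_take_drop i (permuted _ _ _)) !homp_cat /=;
    tauto.
rewrite cat_take_drop (IH X (fun Y => H (p :: Y))) //; last exact: gsymp_cons.
rewrite scalerA; congr (_ * _ *: _).
have -> : [seq [seq q.2 | q <- X]`_(s' h) | h <- enum 'I_N] =
    [seq q.2 | q <- permuted (0, 0) s' X].
  by rewrite (map_permuted (fun q : L * int => q.2)).
by rewrite -(map_take _ (fun q : L * int => q.2)) [RHS]big_map.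
Qed.

(** The signed sum of [C a c] over the two-block unshuffles (a, c) of [X]. *)
Fixpoint unshuffle (C : seq (L * int) -> seq (L * int) -> L) X : L :=
  if X is p :: X' then
    unshuffle (fun a c => C (p :: a) c) X' +
    unshuffle (fun a c => sg p.2 (\sum_(q <- a) q.2) *: C a (p :: c)) X'
  else C [::] [::].

Lemma sum_shuffle2 (N i : nat) (F : 'S_N.+1 -> L) : (i <= N.+1)%N ->
  \sum_(s | shuffle [:: i%:Z; (N.+1 - i)%N%:Z] s) F s =
  (if (0 < i)%N then
     \sum_(s | shuffle [:: (i.-1)%:Z; (N.+1 - i)%N%:Z] s) F (lift_perm ord0 ord0
       s)
   else 0) +
  (if (i <= N)%N then
     \sum_(s | shuffle [:: i%:Z; (N - i)%N%:Z] s) F (lift_perm (inord i) ord0 s)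
   else 0).
Proof.
move=> hi; rewrite big_shuffle_recl /= big_mkcond big_nat_recl //= big_nat1 /=.
congr (_ + _).
  case: i hi => [|i] hi //=; apply: eq_big => [s|s _].
    by congr (shuffle _ s); rewrite /decr_block /=; congr [:: _; _]; lia.
  congr (F (lift_perm _ _ _)); apply: val_inj.
  by rewrite /= inordK.
rewrite (_ : (0 < (N.+1 - i)%N%:Z) = (i <= N)%N); last by lia.
case: ifP => // hN; apply: eq_big => [s|s _].
  by congr (shuffle _ s); rewrite /decr_block /=; congr [:: _; _]; lia.
by rewrite /block_start /= addn0.
Qed.

(** Replaces the permutations in the Jacobi identities by a recursion on the arguments. Empty first
    parts are included. *)
Lemma sum_shuffle_unshuffle C X N : size X = N ->
  \sum_(0 <= i < N.+1) \sum_(s : 'S_N | shuffle [:: i%:Z; (N - i)%N%:Z] s)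
    koszul_sign k s (map snd X) *:
      C (take i (permuted (0, 0) s X)) (drop i (permuted (0, 0) s X)) =
  unshuffle C X.
Proof.
elim: N X C => [|N IH] X C.
  move=> /size0nil -> /=; rewrite big_nat1 big_shuffle0 /=.
  rewrite /koszul_sign big_ord0 scale1r.
  by rewrite (size0nil (size_permuted (0, 0) (1%g : 'S_0) [::])).
case: X => // p X [sX] /=.
under eq_big_nat => i hi do rewrite (sum_shuffle2 _ (hi : (i <= N.+1)%N)).
rewrite big_split /=; congr (_ + _).
  rewrite big_nat_recl // add0r -(IH _ _ sX); apply: eq_big_nat => i /andP[_ hi]
    /=.
  rewrite subSS; apply: eq_bigr => s _.
  rewrite permuted_lift_perm koszul_sign_lift /insert_at -[nat_of_ord ord0]/0%N.
  rewrite !take0 drop0 big_nil mul1r.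
  by [].
rewrite big_nat_recr //= ltnn addr0 -(IH _ _ sX); apply: eq_big_nat => i /andP[_
  hi] /=.
rewrite -ltnS hi; apply: eq_bigr => s _.
rewrite permuted_lift_perm koszul_sign_lift inordK //.
set Y := permuted _ s X; have sY : size Y = N by rewrite size_permuted.
have st : size (take i Y) = i by rewrite size_takel ?sY.
rewrite /insert_at take_size_cat // drop_size_cat //.
have -> : [seq [seq q.2 | q <- X]`_(s h) | h <- enum 'I_N] = [seq q.2 | q <- Y].
  by rewrite (map_permuted (fun q : L * int => q.2)).
rewrite -(map_take _ (fun q : L * int => q.2)) big_map scalerA mulrC; congr (_ *
  _ *: _).
by elim: (take i Y) => [|q r IHr]; rewrite ?big_nil ?sg0 // !big_cons IHr sgDr.
Qed.

(** Both parts of an unshuffle inherit any property [b] of the entries; it will be membership in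
    a. *)
Lemma unshuffle_ext (b : pred (L * int)) C C' X : homp X -> all b X ->
  (forall a c, homp a -> homp c -> all b a -> all b c -> C a c = C' a c) ->
  unshuffle C X = unshuffle C' X.
Proof.
elim: X C C' => [|p X IH] C C' /=; first by move=> _ _ ->.
move=> [hp hX] /andP[bp bX] h; congr (_ + _); apply: IH => // a c ha hc ba bc.
  by apply: h => //=; rewrite bp.
by congr (_ *: _); apply: h => //=; rewrite bp.
Qed.

Lemma eq_unshuffle C C' X : (forall a c, C a c = C' a c) -> unshuffle C X =
  unshuffle C' X.
Proof.
by elim: X C C' => [|p X IH] C C' h /=; rewrite ?h //; congr (_ + _); apply: IH
  => a c;
  rewrite h.
Qed.

Lemma unshuffleD C C' X :
  unshuffle (fun a c => C a c + C' a c) X = unshuffle C X + unshuffle C' X.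
Proof.
elim: X C C' => [//|p X IH] C C' /=; rewrite IH.
rewrite [X in _ + X = _](eq_unshuffle (C' := fun a c => sg p.2 (\sum_(q <- a)
  q.2) *: C a (p :: c) +
  sg p.2 (\sum_(q <- a) q.2) *: C' a (p :: c))); last by move=> a c; rewrite
    scalerDr.
by rewrite IH addrACA.
Qed.

Lemma unshuffleZ e C X : unshuffle (fun a c => e *: C a c) X = e *: unshuffle C
  X.
Proof.
elim: X C => [//|p X IH] C /=; rewrite scalerDr -!IH; congr (_ + _).
by apply: eq_unshuffle => a c; rewrite !scalerA mulrC.
Qed.

Lemma unshuffle0 X : unshuffle (fun _ _ => 0) X = 0.
Proof.
rewrite -[RHS](scale0r (unshuffle (fun _ _ => 0) X)) -unshuffleZ.
by apply: eq_unshuffle => a c; rewrite scaler0.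
Qed.

Lemma unshuffle_nil (b : pred (L * int)) C X : homp X -> all b X ->
  (forall p a c, homp (p :: a) -> homp c -> all b (p :: a) -> all b c -> C (p ::
    a) c = 0) ->
  unshuffle C X = C [::] X.
Proof.
elim: X C => [//|p X IH] C /= [hp hX] /andP[bp bX] h.
rewrite (unshuffle_ext (b := b) (C' := fun _ _ => 0)) //; last first.
  by move=> a c ha hc ba bc; apply: h => //=; rewrite bp.
rewrite unshuffle0 add0r IH // => [|q a c ha hc ba bc].
  by rewrite big_nil sg0 scale1r.
by rewrite h ?scaler0 //= bp.
Qed.

Lemma unshuffle_additive C (u v : L) d X1 X2 :
  (forall a1 a2 c, C (a1 ++ (u + v, d) :: a2) c =
     C (a1 ++ (u, d) :: a2) c + C (a1 ++ (v, d) :: a2) c) ->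
  (forall a c1 c2, C a (c1 ++ (u + v, d) :: c2) =
     C a (c1 ++ (u, d) :: c2) + C a (c1 ++ (v, d) :: c2)) ->
  unshuffle C (X1 ++ (u + v, d) :: X2) =
  unshuffle C (X1 ++ (u, d) :: X2) + unshuffle C (X1 ++ (v, d) :: X2).
Proof.
elim: X1 C => [|p X1 IH] C hl hr /=.
  rewrite [RHS]addrACA; congr (_ + _); rewrite -unshuffleD; apply: eq_unshuffle
    => a c.
    exact: (hl [::]).
  by rewrite (hr _ [::]) scalerDr.
rewrite [RHS]addrACA; congr (_ + _).
  by apply: IH => [a1 a2 c|a c1 c2]; [apply: (hl (p :: a1))|apply: hr].
apply: IH => [a1 a2 c|a c1 c2].
  by rewrite hl scalerDr !big_cat !big_cons.
by rewrite (hr _ (p :: c1)) scalerDr.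
Qed.

Definition gsym F : Prop := gsymp (fun X => F (map fst X)).

Definition homog (e : int) F : Prop :=
  forall X, homp X -> G (\sum_(q <- X) q.2 + e) (F (map fst X)).

Lemma gsym_cons F p : G p.2 p.1 -> gsym F -> gsym (fun s => F (p.1 :: s)).
Proof. by move=> hp hF; apply: (gsymp_cons hp hF). Qed.

Lemma homog_cons e F p : G p.2 p.1 -> homog e F ->
  homog (p.2 + e) (fun s => F (p.1 :: s)).
Proof.
move=> hp hF X hX; have := hF (p :: X) (conj hp hX).
by rewrite big_cons addrA [p.2 + _]addrC.
Qed.

(** The Jacobi identities of an L_oo[1]-structure [l] say that [ins l l] is 0. *)
Definition ins F F' X : L :=
  unshuffle (fun a c => F (F' (map fst a) :: map fst c)) X.

(** If [F] takes [p], moving [p] in front of the inner value cancels its sign with the inner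
    arguments and leaves only its sign with the degree of [F']. This is the analogue of
    [contract_circ]. *)
Lemma ins_cons e F F' p X : gsym F -> homog e F' -> homp (p :: X) ->
  ins F F' (p :: X) = ins F (fun s => F' (p.1 :: s)) X
    + sg p.2 e *: ins (fun s => F (p.1 :: s)) F' X.
Proof.
move=> sF hF' [hp hX]; rewrite /ins /=; congr (_ + _).
rewrite -unshuffleZ; apply: (unshuffle_ext (b := predT)) => //; first exact:
  all_predT.
move=> a c ha hc _ _.
have h : homp ([::] ++ p :: (F' (map fst a), \sum_(q <- a) q.2 + e) :: c).
  by split=> //; split=> //; apply: hF'.
have /= -> := sF _ _ _ _ h.
by rewrite scalerA sgDr mulrA sgK mul1r.
Qed.

(** Allows the entries from sm to be moved to the front in the Jacobi identities. *)
Lemma ins_swap e F F' : multilinear F -> gsym F -> gsym F' -> homog e F' ->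
  gsymp (ins F F').
Proof.
move=> mF sF sF' hF' X1; elim: X1 e F F' mF sF sF' hF' => [|r X1 IH] e F F' mF
  sF sF' hF' p q X2.
  move=> /= [hp [hq hX]].
  have [Fp Fq] := (gsym_cons hp sF, gsym_cons hq sF).
  have [F'p F'q] := (homog_cons hp hF', homog_cons hq hF').
  rewrite !(ins_cons sF hF') ?(ins_cons sF F'p) ?(ins_cons sF F'q)
    ?(ins_cons Fp hF') ?(ins_cons Fq hF') //.
  have -> : ins F (fun s => F' (q.1 :: p.1 :: s)) X2 =
      sg p.2 q.2 *: ins F (fun s => F' (p.1 :: q.1 :: s)) X2.
    rewrite -unshuffleZ; apply: (unshuffle_ext (b := predT)) => //; first exact:
      all_predT.
    move=> a c ha hc _ _.
    have := sF' [::] p q a (conj hp (conj hq ha)); rewrite /= => ->.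
    by rewrite (multilinearZ mF [::]).
  have -> : ins (fun s => F (q.1 :: p.1 :: s)) F' X2 =
      sg p.2 q.2 *: ins (fun s => F (p.1 :: q.1 :: s)) F' X2.
    rewrite -unshuffleZ; apply: (unshuffle_ext (b := predT)) => //; first exact:
      all_predT.
    move=> a c ha hc _ _.
    have h : homp ([::] ++ p :: q :: (F' (map fst a), \sum_(q <- a) q.2 + e) ::
      c).
      by do 3 split=> //; apply: hF'.
    by have /= -> := sF _ _ _ _ h.
  rewrite !sgDr [sg q.2 p.2]sgC /sg.
  by do 3 case: (oddz _); rewrite /= ?expr0 ?expr1; linear_over k.
move=> /= [hr h].
have [Fr F'r] := (gsym_cons hr sF, gsym_cons hr sF').
have h' : homp (X1 ++ q :: p :: X2) by move: h; rewrite !homp_cat /=; tauto.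
rewrite !(ins_cons sF hF') //.
rewrite (IH (r.2 + e) F _ _ _ _ _ p q X2) //; last exact: homog_cons.
rewrite (IH e _ F' _ _ _ _ p q X2) //; last exact: multilinear_cons.
by rewrite scalerDr !scalerA mulrC.
Qed.

Lemma ins_additive F F' (u v : L) d X1 X2 : multilinear F -> multilinear F' ->
  ins F F' (X1 ++ (u + v, d) :: X2) =
  ins F F' (X1 ++ (u, d) :: X2) + ins F F' (X1 ++ (v, d) :: X2).
Proof.
move=> mF mF'; apply: unshuffle_additive => [a1 a2 c|a c1 c2]; rewrite !map_cat
  /=.
  by rewrite (multilinearD mF') (multilinearD mF [::]).
by rewrite -!cat_cons (multilinearD mF).
Qed.

End GradedSymmetry.

(** * The derived brackets *)

Section DerivedBrackets.
Variables (k : fieldType) (g : lmodType k) (mu lam : k).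
Implicit Types (z : sm_a g) (s : seq (sm_a g)) (u v w : cochain (dbl g)).
Implicit Types (p q : sm_a g * int) (X Y : seq (sm_a g * int)).

Notation ext := (@ext k g mu lam).
Notation hom := (homp (@sm_a_deg k g)).

Definition to_m z : cochain g := z.1.
Definition to_a z : cochain g := z.2.

Definition brkL u s : cochain (dbl g) := foldl (fun w z => brk w (inA (to_a z)))
  u s.

Lemma brkLP a u v s : brkL (a *: u + v) s = a *: brkL u s + brkL v s.
Proof. by elim: s u v => [//|z s IH] u v /=; rewrite brkDl brkZl IH. Qed.

Lemma brkL0 s : brkL 0 s = 0.
Proof. by elim: s => [//|z s IH] /=; rewrite brk0l. Qed.

Lemma brkLZ a u s : brkL (a *: u) s = a *: brkL u s.
Proof. by have := brkLP a u 0 s; rewrite brkL0 !addr0. Qed.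

Lemma inA_sndP a z1 z2 : inA (to_a (a *: z1 + z2)) = a *: inA (to_a z1) + inA
  (to_a z2).
Proof. exact: linearP. Qed.

Lemma ext_fstP a z1 z2 : ext (to_m (a *: z1 + z2)) = a *: ext (to_m z1) + ext
  (to_m z2).
Proof. exact: linearP. Qed.

Lemma twistP (V : lmodType k) a (F F' : cochain V) :
  twist (a *: F + F') = a *: twist F + twist F'.
Proof. exact: linearP. Qed.

Lemma brkL_multilinear a u s1 s2 z1 z2 : brkL u (s1 ++ (a *: z1 + z2) :: s2) =
  a *: brkL u (s1 ++ z1 :: s2) + brkL u (s1 ++ z2 :: s2).
Proof.
elim: s1 u => [|z s1 IH] u /=; last exact: IH.
by rewrite inA_sndP brkDr brkZr brkLP.
Qed.

(** The sum over the entries (f, xi) of the list of the iterated brackets of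
    [ext f] with the [inA xi] of the other entries, with Koszul signs. *)
Fixpoint derived s : cochain (dbl g) :=
  if s is z :: s' then brkL (ext (to_m z)) s' - brk (twist (inA (to_a z)))
    (derived s')
  else 0.

(** Moving xi from the head to the end costs its Koszul sign with the other entries. Turning [w, xi]
    around costs that sign again together with -(-1)^|xi|, since w has degree one more than the
    entries. The minus sign and [twist] remain. *)
Lemma derived_cons z s :
  derived (z :: s) = brkL (ext (to_m z)) s - brk (twist (inA (to_a z))) (derived
    s).
Proof. by []. Qed.

Lemma derived_multilinear : multilinear derived.
Proof.
move=> s1; elim: s1 => [|z s1 IH] s2 a z1 z2.
  rewrite !cat0s !derived_cons inA_sndP twistP brkDl brkZl (ext_fstP a z1 z2).
  by rewrite brkLP; linear_over k.
by rewrite !cat_cons !derived_cons brkL_multilinear IH brkDr brkZr; linear_over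
  k.
Qed.

Definition lsm s : cochain g :=
  if s is [:: z1; z2] then brk (twist (to_m z1)) (to_m z2) else 0.

Lemma lsm_size s : size s != 2%N -> lsm s = 0.
Proof. by case: s => [|? [|? []]]. Qed.

Lemma lsm_multilinear : multilinear lsm.
Proof.
move=> s1 s2 a z1 z2.
have [|ns] := eqVneq (size (s1 ++ z1 :: s2)) 2%N; last first.
  by rewrite !lsm_size ?scaler0 ?addr0 //; move: ns; rewrite !size_cat.
case: s1 => [|y1 [|y2 s1]] /=; last by rewrite size_cat /= !addnS.
  case: s2 => [|y2 []] //= _.
  by rewrite -[LHS]/(brk (twist (a *: to_m z1 + to_m z2)) (to_m y2)) twistP
    brkDl brkZl.
case: s2 => [|? ?] //= _.
by rewrite -[LHS]/(brk (twist (to_m y1)) (a *: to_m z1 + to_m z2)) brkDr brkZr.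
Qed.

Definition linf s : sm_a g := (lsm s, proj (derived s)).

Lemma linf_multilinear : multilinear linf.
Proof.
move=> s1 s2 a z1 z2; congr (_, _); first exact: lsm_multilinear.
by rewrite derived_multilinear; apply: linearP.
Qed.

Lemma cochain_deg_brkL n u X : cochain_deg n u -> hom X ->
  cochain_deg (n + \sum_(q <- X) q.2) (brkL u (map fst X)).
Proof.
elim: X n u => [|p X IH] n u hu; first by rewrite big_nil addr0.
move=> /= [[_ hp] hX]; rewrite big_cons addrA; apply: IH => //.
exact/cochain_deg_brk/cochain_deg_inA.
Qed.

Lemma cochain_degN (V : lmodType k) n (F : cochain V) :
  cochain_deg n F -> cochain_deg n (- F).
Proof. by rewrite -scaleN1r; apply: cochain_degZ. Qed.

Lemma cochain_deg_add (V : lmodType k) n (F F' : cochain V) :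
  cochain_deg n F -> cochain_deg n F' -> cochain_deg n (F + F').
Proof. by rewrite -[F]scale1r => ? ?; apply: cochain_degD; rewrite //
  -[F]scale1r. Qed.

Lemma cochain_deg_derived X : hom X ->
  cochain_deg (\sum_(q <- X) q.2 + 1) (derived (map fst X)).
Proof.
elim: X => [|p X IH] //= [[hp1 hp2] hX]; rewrite big_cons.
apply: cochain_deg_add.
  by rewrite addrAC; apply: cochain_deg_brkL => //; apply: cochain_deg_ext.
rewrite -addrA; apply/cochain_degN/cochain_deg_brk; last exact: IH.
exact/cochain_deg_twist/cochain_deg_inA.
Qed.

Lemma linf_homog : homog (@sm_a_deg k g) 1 linf.
Proof.
move=> X hX; split; last exact/cochain_deg_proj/cochain_deg_derived.
rewrite -[(linf _).1]/(lsm _).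
have [|ns] := eqVneq (size X) 2%N; last by rewrite lsm_size ?size_map.
case: X hX => [|p [|q []]] //= [[hp _] [[hq _] _]] _.
rewrite !big_cons big_nil addr0 -addrA addrACA.
exact/cochain_deg_brk/hq/cochain_deg_twist.
Qed.

Lemma hom_parity p : sm_a_deg p.2 p.1 ->
  parity (oddz (p.2 + 1)) (to_m p.1) /\ parity (oddz p.2) (to_a p.1).
Proof. by case=> h1 h2; split; apply: cochain_deg_parity. Qed.

(** As elements of a commute, the Leibniz rule leaves only the exchanged bracket. *)
Lemma brk_inA_swap n d e u (F F' : cochain g) :
  parity n u -> parity d F -> parity e F' ->
  brk (brk u (inA F')) (inA F) = (-1) ^+ (d && e) *: brk (brk u (inA F)) (inA
    F').
Proof.
move=> hu hF hF'; rewrite (brk_jacobi hu (parity_inA hF') (parity_inA hF)).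
by rewrite brk_inA_inA brk0r add0r andbC.
Qed.

Lemma brkL_swap n u X1 p q X2 : cochain_deg n u -> hom (X1 ++ p :: q :: X2) ->
  brkL u (map fst (X1 ++ q :: p :: X2)) =
  sg k p.2 q.2 *: brkL u (map fst (X1 ++ p :: q :: X2)).
Proof.
elim: X1 n u => [|r X1 IH] n u hu /=.
  move=> [[_ hp] [[_ hq] _]].
  rewrite (brk_inA_swap (cochain_deg_parity hu) (cochain_deg_parity hp)
    (cochain_deg_parity hq)).
  exact: brkLZ.
by move=> [[_ hr] h]; apply: IH h; apply/(cochain_deg_brk hu)/cochain_deg_inA;
  exact: hr.
Qed.

Lemma brk_brkL n d u (F : cochain g) X : parity d F -> cochain_deg n u -> hom X
  ->
  brk (inA F) (brkL u (map fst X)) = brkL (brk (inA F) u) (map fst X).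
Proof.
move=> hF; elim: X n u => [//|p X IH] n u hu /= [[_ hp] hX].
rewrite (IH _ _ (cochain_deg_brk hu (cochain_deg_inA hp))) //; congr (brkL _ _).
rewrite (brk_jacobi (parity_inA hF) (cochain_deg_parity hu)
  (parity_inA (cochain_deg_parity hp))).
by rewrite brk_inA_inA brk0l scaler0 addr0.
Qed.

(** The terms led by one of the two maps in m are exchanged by antisymmetry; in the remaining term
    the two elements of a commute, by the Jacobi identity. *)
Lemma derived_swap2 p q X : hom [:: p, q & X] ->
  derived (map fst [:: q, p & X]) = sg k p.2 q.2 *: derived (map fst [:: p, q &
    X]).
Proof.
case: p q => [[f F] d] [[f' F'] e] /= [[hf hF] [[hf' hF'] hX]].
rewrite /= in hf hF hf' hF'.
have pf := cochain_deg_parity (cochain_deg_ext mu lam hf).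
have pf' := cochain_deg_parity (cochain_deg_ext mu lam hf').
have pF := cochain_deg_parity hF; have pF' := cochain_deg_parity hF'.
have pW := cochain_deg_parity (cochain_deg_derived hX).
rewrite -!inA_twist (twist_deg hF) (twist_deg hF') !linearZ /= !brkZl.
rewrite !brkDr !brkNr !brkZr.
rewrite (brk_brkL pF' (cochain_deg_ext mu lam hf)) //.
rewrite (brk_brkL pF (cochain_deg_ext mu lam hf')) //.
rewrite (brkC (parity_inA pF') pf) (brkC (parity_inA pF) pf').
set W := derived _.
have -> : brk (inA F') (brk (inA F) W) =
    sg k d e *: brk (inA F) (brk (inA F') W).
  have := brk_jacobi (parity_inA pF) (parity_inA pF') pW.
  rewrite brk_inA_inA brk0l (brkC (parity_brk (parity_inA pF) pW) (parity_inA
    pF')).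
  move=> /esym/eqP; rewrite addr_eq0 => /eqP ->.
  rewrite -/W /sg; move: (oddz (_ + 1)) => b.
  by case: (oddz d) (oddz e) b => [] [] []; rewrite /= ?expr0 ?expr1;
    linear_over k.
rewrite /sg !oddzD oddz1 -!scaleN1r !brkLZ.
by case: (oddz d) (oddz e) => [] []; rewrite /= ?expr0 ?expr1; linear_over k.
Qed.

Lemma derived_gsymp : forall X1 p q X2, hom (X1 ++ p :: q :: X2) ->
  derived (map fst (X1 ++ q :: p :: X2)) =
  sg k p.2 q.2 *: derived (map fst (X1 ++ p :: q :: X2)).
Proof.
elim=> [|r X1 IH] p q X2; first exact: derived_swap2.
move=> [[hr1 hr2] h]; rewrite !cat_cons !map_cons !derived_cons (IH _ _ _ h).
by rewrite (brkL_swap (cochain_deg_ext mu lam hr1) h) brkZr [RHS]scalerBr.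
Qed.

Lemma lsm_gsymp X1 p q X2 : hom (X1 ++ p :: q :: X2) ->
  lsm (map fst (X1 ++ q :: p :: X2)) =
  sg k p.2 q.2 *: lsm (map fst (X1 ++ p :: q :: X2)).
Proof.
move=> h; have [e|ns] := eqVneq (size (X1 ++ X2)) 0%N; last first.
  rewrite !lsm_size ?scaler0 // size_map; move: ns; rewrite !size_cat /=; lia.
case: X1 h e => // h; case: X2 h => // h _.
case: p q h => [[f F] d] [[f' F'] e] /= [[hf hF] [[hf' hF'] _]].
rewrite /= in hf hF hf' hF'.
change (brk (twist f') f = sg k d e *: brk (twist f) f').
rewrite (twist_deg hf) (twist_deg hf') !brkZl.
rewrite (brkC (cochain_deg_parity hf') (cochain_deg_parity hf)).
rewrite /sg !oddzD oddz1.
by case: (oddz d) (oddz e) => [] []; rewrite /= ?expr0 ?expr1; linear_over k.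
Qed.

Lemma linf_gsym : gsym (@sm_a_deg k g) linf.
Proof.
move=> X1 p q X2 h; congr (_, _); first exact: lsm_gsymp.
by rewrite derived_gsymp // -projZ.
Qed.

Lemma brkL_sm u s1 z s2 : to_a z = 0 -> brkL u (s1 ++ z :: s2) = 0.
Proof.
move=> hz; elim: s1 u => [|y s1 IH] u; last exact: IH.
by rewrite -[LHS]/(brkL (brk u (inA (to_a z))) s2) hz linear0 brk0r brkL0.
Qed.

Lemma derived_a s : (forall z, z \in s -> to_m z = 0) -> derived s = 0.
Proof.
elim: s => [//|z s IH] h; rewrite derived_cons h ?mem_head // linear0 brkL0.
by rewrite IH ?brk0r ?subr0 // => y hy; rewrite h // inE hy orbT.
Qed.

(** Each summand takes the m-component of one entry and the a-components of all the others, one of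
    which is 0 here. *)
Lemma derived_sm2 s1 z1 s2 z2 s3 : to_a z1 = 0 -> to_a z2 = 0 ->
  derived (s1 ++ z1 :: s2 ++ z2 :: s3) = 0.
Proof.
move=> h1 h2; elim: s1 => [|y s1 IH].
  rewrite cat0s derived_cons h1 !linear0 brk0l subr0.
  exact: brkL_sm.
rewrite cat_cons derived_cons IH brk0r subr0.
by rewrite -cat_cons catA brkL_sm.
Qed.

End DerivedBrackets.

(** * The Jacobi identities *)

Section Jacobi.
Variables (k : fieldType) (g : lmodType k) (mu lam : k).
Implicit Types (z : sm_a g) (s : seq (sm_a g)) (u v w : cochain (dbl g)).
Implicit Types (p q : sm_a g * int) (X Y : seq (sm_a g * int)).

Notation ext := (@ext k g mu lam).
Notation hom := (homp (@sm_a_deg k g)).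
Notation linf := (linf mu lam).
Notation L := (sm_a g).

(** Voronov's derived brackets of an arbitrary [u]: fixing a first argument xi amounts to replacing
    [u] by [u, xi]. *)
Definition Phi u s : L := (0, proj (brkL u s)).

Lemma Phi_cons u z s : Phi u (z :: s) = Phi (brk u (inA (to_a z))) s.
Proof. by []. Qed.

Lemma PhiP a u v s : Phi (a *: u + v) s = a *: Phi u s + Phi v s.
Proof.
congr (_, _); first by rewrite /= scaler0 addr0.
by rewrite brkLP; apply: linearP.
Qed.

Lemma PhiZ a u s : Phi (a *: u) s = a *: Phi u s.
Proof.
congr (_, _); first by rewrite /= scaler0.
by rewrite brkLZ; apply: projZ.
Qed.

Lemma Phi_gsym n u : cochain_deg n u -> gsym (@sm_a_deg k g) (Phi u).
Proof.
move=> hu X1 p q X2 h; congr (_, _); first by rewrite /= scaler0.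
by rewrite (brkL_swap hu h) -projZ.
Qed.

Lemma Phi_homog n u : cochain_deg n u -> homog (@sm_a_deg k g) n (Phi u).
Proof.
move=> hu X hX; split; first exact: cochain_deg0.
by rewrite addrC; apply/cochain_deg_proj/cochain_deg_brkL.
Qed.

(** Without arguments this is [proj_brk]. A further argument acts on the left by the Leibniz rule
    and on the right by [ins_cons], with the same result. *)
Lemma Phi_brk n m u v X : cochain_deg n u -> cochain_deg m v -> hom X ->
  Phi (brk u v) (map fst X) =
  ins (Phi u) (Phi v) X - sg k n m *: ins (Phi v) (Phi u) X.
Proof.
elim: X n m u v => [|p X IH] n m u v hu hv.
  move=> _; rewrite -![ins _ _ [::]]/(Phi _ [:: Phi _ [::]]) !Phi_cons.
  have pu := cochain_deg_parity hu; have pv := cochain_deg_parity hv.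
  congr (_, _); first by rewrite /= scaler0 subr0.
  rewrite -[LHS]/(proj (brk u v)) (proj_brk pu pv).
  rewrite (brkC (parity_inA (parity_proj pu)) pv) linearN linearZ /=.
  by rewrite addrC.
move=> [[hp1 hp2] hX].
have hp : sm_a_deg p.2 p.1 by [].
have hF := cochain_deg_inA hp2; rewrite -/(to_a p.1) in hF.
set F := inA (to_a p.1) in hF.
have -> : ins (Phi u) (Phi v) (p :: X) =
    ins (Phi u) (Phi (brk v F)) X + sg k p.2 m *: ins (Phi (brk u F)) (Phi v) X.
  exact: (ins_cons (Phi_gsym hu) (Phi_homog hv)).
have -> : ins (Phi v) (Phi u) (p :: X) =
    ins (Phi v) (Phi (brk u F)) X + sg k p.2 n *: ins (Phi (brk v F)) (Phi u) X.
  exact: (ins_cons (Phi_gsym hv) (Phi_homog hu)).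
rewrite map_cons Phi_cons -/F.
rewrite (brk_jacobi (cochain_deg_parity hu) (cochain_deg_parity hv)
  (cochain_deg_parity hF)) addrC PhiP.
rewrite (IH _ _ _ _ (cochain_deg_brk hu hF) hv hX) (IH _ _ _ _ hu
  (cochain_deg_brk hv hF) hX).
rewrite /sg !oddzD.
by case: (oddz n); case: (oddz m); case: (oddz p.2);
  rewrite /= ?expr0 ?expr1; linear_over k.
Qed.

Definition is_a p : bool := to_m p.1 == 0.

Lemma linf_a s : (forall z, z \in s -> to_m z = 0) -> linf s = 0.
Proof.
move=> h; congr (_, _); last by rewrite derived_a // linear0.
have [|ns] := eqVneq (size s) 2%N; last by rewrite lsm_size.
case: s h => [|y [|z []]] //= h _.
change (brk (twist (to_m y)) (to_m z) = 0).
by rewrite (h z) ?brk0r // !inE eqxx orbT.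
Qed.

Lemma linf_a_pairs X : all is_a X -> linf (map fst X) = 0.
Proof. by move=> /allP h; apply: linf_a => z /mapP[p /h /eqP hp ->]. Qed.

Lemma linf_sm2 s1 z1 s2 z2 s3 : to_a z1 = 0 -> to_a z2 = 0 ->
  (0 < size (s1 ++ s2 ++ s3))%N -> linf (s1 ++ z1 :: s2 ++ z2 :: s3) = 0.
Proof.
move=> h1 h2 hs; congr (_, _); last by rewrite derived_sm2 // linear0.
by apply: lsm_size; move: hs; rewrite !size_cat /= size_cat /=; lia.
Qed.

Lemma linf_Phi z s : to_a z = 0 -> (forall y, y \in s -> to_m y = 0) ->
  linf (z :: s) = Phi (ext (to_m z)) s.
Proof.
move=> hz hs; congr (_, _).
  have [|ns] := eqVneq (size (z :: s)) 2%N; last by rewrite lsm_size.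
  case: s hs => [|y []] //= hs _.
  change (brk (twist (to_m z)) (to_m y) = 0).
  by rewrite (hs y) ?brk0r // !inE eqxx.
by rewrite derived_cons hz !linear0 brk0l subr0.
Qed.

Lemma linf_Phi_pairs z X : to_a z = 0 -> all is_a X ->
  linf (z :: map fst X) = Phi (ext (to_m z)) (map fst X).
Proof.
by move=> hz /allP h; apply: linf_Phi => // y /mapP[p /h /eqP hp ->].
Qed.

Lemma linf_0 s1 s2 : linf (s1 ++ 0 :: s2) = 0.
Proof. exact/multilinear0/linf_multilinear. Qed.

Lemma eq_ins_a F1 F1' F2 F2' X : hom X -> all is_a X ->
  (forall Y, all is_a Y -> F2 (map fst Y) = F2' (map fst Y)) ->
  (forall Y Z, all is_a Y -> all is_a Z ->
    F1 (F2' (map fst Y) :: map fst Z) = F1' (F2' (map fst Y) :: map fst Z)) ->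
  ins F1 F2 X = ins F1' F2' X :> L.
Proof.
move=> hX aX h2 h1; apply: (unshuffle_ext (b := is_a) hX aX) => a c _ _ ha hc.
by rewrite h2 // h1.
Qed.

Lemma ins0 X : ins (fun=> 0) (fun=> 0) X = 0 :> L.
Proof. exact: unshuffle0. Qed.

Lemma jacobi_a X : hom X -> all is_a X -> ins linf linf X = 0.
Proof.
move=> hX aX; rewrite -(ins0 X); apply: eq_ins_a => // Y; first exact:
  linf_a_pairs.
by move=> Z _ _; apply: (linf_0 [::]).
Qed.

(** Whichever bracket takes [p], the other has only entries from a: if the inner one takes it, its
    value lies in a. *)
Lemma jacobi_sm1 p X : to_a p.1 = 0 -> hom (p :: X) -> all is_a X ->
  ins linf linf (p :: X) = 0.
Proof.
move=> ap hpX aX; have [hp hX] := hpX.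
rewrite (ins_cons (@linf_gsym k g mu lam) (@linf_homog k g mu lam)) //.
rewrite (eq_ins_a (F1' := fun=> 0) (F2' := Phi (ext (to_m p.1)))) //; last 2
  first.
- by move=> Y aY; apply: linf_Phi_pairs.
- move=> Y Z aY aZ; apply: linf_a => z; rewrite inE => /predU1P[-> //|].
  by move=> /mapP[q hq ->]; apply/eqP/(allP aZ).
rewrite (eq_ins_a (F1 := fun s => linf (p.1 :: s)) (F1' := fun=> 0) (F2' :=
  fun=> 0)) //; last 2 first.
- exact: linf_a_pairs.
- by move=> Y Z _ _; apply: (linf_0 [:: p.1]).
by rewrite /ins !unshuffle0 scaler0 addr0.
Qed.

Lemma lsm2 z1 z2 : to_m (linf [:: z1; z2]) = brk (twist (to_m z1)) (to_m z2).
Proof. by []. Qed.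

Lemma linf2_a z1 z2 : to_a z1 = 0 -> to_a z2 = 0 -> to_a (linf [:: z1; z2]) = 0.
Proof.
move=> h1 h2; rewrite -[LHS]/(proj (derived mu lam [:: z1; z2])).
by rewrite (@derived_sm2 _ _ _ _ [::] _ [::]) // linear0.
Qed.

Lemma in_smZ a (f : cochain g) : in_sm (a *: f) = a *: in_sm f.
Proof. by congr (_, _); rewrite /= scaler0. Qed.

Lemma in_smD (f f' : cochain g) : in_sm (f + f') = in_sm f + in_sm f'.
Proof. by congr (_, _); rewrite /= addr0. Qed.

Lemma linf2_sm z1 z2 : to_a z1 = 0 -> to_a z2 = 0 ->
  linf [:: z1; z2] = in_sm (brk (twist (to_m z1)) (to_m z2)).
Proof. by move=> h1 h2; congr (_, _); apply: linf2_a. Qed.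

Lemma ins_nil F F' X : hom X -> (forall z s, F' (z :: s) = 0) ->
  (forall s, F (0 :: s) = 0) -> ins F F' X = F (F' [::] :: map fst X) :> L.
Proof.
move=> hX h h0; rewrite /ins (unshuffle_nil (b := predT) hX) //; first exact:
  all_predT.
by move=> p a c _ _ _ _; rewrite /= h h0.
Qed.

Lemma ins_eq0 F F' X : (forall s s', F (F' s :: s') = 0) -> ins F F' X = 0 :> L.
Proof.
move=> h; rewrite -(@unshuffle0 k _ X); apply: eq_unshuffle => a c; exact: h.
Qed.

(** If the inner bracket takes both maps it is their bracket in m. As [ext] preserves brackets,
    [Phi_brk] expresses the resulting term through the two terms in which the maps are separated. *)
Lemma jacobi_sm2 p q X : to_a p.1 = 0 -> to_a q.1 = 0 -> hom (p :: q :: X) ->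
  all is_a X -> ins linf linf (p :: q :: X) = 0.
Proof.
move=> ap aq hpqX aX; have [hp [hq hX]] := hpqX.
have gl := @linf_gsym k g mu lam; have hl := @linf_homog k g mu lam.
pose l1 z := fun s => linf (z :: s).
pose l2 z z' := fun s => linf (z :: z' :: s).
have -> : ins linf linf [:: p, q & X] =
  ins linf (l1 p.1) (q :: X) + sg k p.2 1 *: ins (l1 p.1) linf (q :: X).
  exact: (ins_cons gl hl).
have -> : ins linf (l1 p.1) (q :: X) =
  ins linf (l2 p.1 q.1) X + sg k q.2 (p.2 + 1) *: ins (l1 q.1) (l1 p.1) X.
  exact: (ins_cons gl (homog_cons hp hl)).
have -> : ins (l1 p.1) linf (q :: X) =
  ins (l1 p.1) (l1 q.1) X + sg k q.2 1 *: ins (l2 p.1 q.1) linf X.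
  exact: (ins_cons (gsym_cons hp gl) hl).
have -> : ins (l2 p.1 q.1) linf X = 0.
  rewrite (eq_ins_a (F1' := fun=> 0) (F2' := fun=> 0)) ?ins0 //.
    exact: linf_a_pairs.
  by move=> Y Z _ _; apply: (linf_0 [:: p.1; q.1]).
have e z z' : to_a z = 0 -> to_a z' = 0 -> ins (l1 z) (l1 z') X =
    ins (Phi (ext (to_m z))) (Phi (ext (to_m z'))) X.
  move=> hz hz'; apply: eq_ins_a => // [Y aY|Y Z aY aZ]; first exact:
    linf_Phi_pairs.
  apply: linf_Phi => // y; rewrite inE => /predU1P[-> //|].
  by move=> /mapP[r hr ->]; apply/eqP/(allP aZ).
rewrite !e //.
have -> : ins linf (l2 p.1 q.1) X = linf (linf [:: p.1; q.1] :: map fst X).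
  apply: ins_nil => // [z s|s]; last exact: (linf_0 [::]).
  exact: (@linf_sm2 [::] p.1 [::] q.1).
have [[pp _] [pq _]] := (hom_parity hp, hom_parity hq).
rewrite linf_Phi_pairs ?linf2_a // lsm2 (twist_parity pp) brkZl extZ ext_brk
  PhiZ.
rewrite (Phi_brk (cochain_deg_ext mu lam hp.1) (cochain_deg_ext mu lam hq.1))
  //.
set A := ins _ _ X; set B := ins _ _ X; rewrite /sg !oddzD oddz1.
by case: (oddz p.2); case: (oddz q.2); rewrite /= ?expr0 ?expr1; linear_over k.
Qed.

Lemma jacobi_sm3 p q r X : to_a p.1 = 0 -> to_a q.1 = 0 -> to_a r.1 = 0 ->
  hom (p :: q :: r :: X) -> ins linf linf (p :: q :: r :: X) = 0.
Proof.
move=> ap aq ar hpqrX; have [hp [hq [hr hX]]] := hpqrX.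
have gl := @linf_gsym k g mu lam; have hl := @linf_homog k g mu lam.
pose l1 z := fun s => linf (z :: s).
pose l2 z z' := fun s => linf (z :: z' :: s).
pose l3 z z' z'' := fun s => linf (z :: z' :: z'' :: s).
have e3 F s : (forall s', F (0 :: s') = 0) -> forall s', F (l3 p.1 q.1 r.1 s ::
  s') = 0.
  move=> h s'; rewrite (_ : l3 _ _ _ s = 0) //.
  exact: (@linf_sm2 [::] p.1 [::] q.1).
have [glp glq] := (gsym_cons hp gl, gsym_cons hq gl).
have [hlp hlq] := (homog_cons hp hl, homog_cons hq hl).
have -> : ins linf linf [:: p, q, r & X] =
  ins linf (l1 p.1) [:: q, r & X] + sg k p.2 1 *: ins (l1 p.1) linf [:: q, r &
    X].
  exact: (ins_cons gl hl).
have -> : ins linf (l1 p.1) [:: q, r & X] =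
  ins linf (l2 p.1 q.1) (r :: X) + sg k q.2 (p.2 + 1) *: ins (l1 q.1) (l1 p.1)
    (r :: X).
  exact: (ins_cons gl hlp).
have -> : ins (l1 p.1) linf [:: q, r & X] =
  ins (l1 p.1) (l1 q.1) (r :: X) + sg k q.2 1 *: ins (l2 p.1 q.1) linf (r :: X).
  exact: (ins_cons glp hl).
have -> : ins linf (l2 p.1 q.1) (r :: X) =
  ins linf (l3 p.1 q.1 r.1) X + sg k r.2 (q.2 + (p.2 + 1)) *: ins (l1 r.1) (l2
    p.1 q.1) X.
  exact: (ins_cons gl (homog_cons hq hlp)).
have -> : ins (l1 q.1) (l1 p.1) (r :: X) =
  ins (l1 q.1) (l2 p.1 r.1) X + sg k r.2 (p.2 + 1) *: ins (l2 q.1 r.1) (l1 p.1)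
    X.
  exact: (ins_cons glq hlp).
have -> : ins (l1 p.1) (l1 q.1) (r :: X) =
  ins (l1 p.1) (l2 q.1 r.1) X + sg k r.2 (q.2 + 1) *: ins (l2 p.1 r.1) (l1 q.1)
    X.
  exact: (ins_cons glp hlq).
have -> : ins (l2 p.1 q.1) linf (r :: X) =
  ins (l2 p.1 q.1) (l1 r.1) X + sg k r.2 1 *: ins (l3 p.1 q.1 r.1) linf X.
  exact: (ins_cons (gsym_cons hq glp) hl).
have two_out z z' F : to_a z = 0 -> to_a z' = 0 -> ins (l2 z z') F X = 0.
  by move=> hz hz'; apply: ins_eq0 => s s'; apply: (@linf_sm2 [::] z [::] z').
have three_in F : (forall s', F (0 :: s') = 0) -> ins F (l3 p.1 q.1 r.1) X = 0.
  by move=> h; apply: ins_eq0 => s s'; apply: e3.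
have three_out F : ins (l3 p.1 q.1 r.1) F X = 0.
  by apply: ins_eq0 => s s'; apply: (@linf_sm2 [::] p.1 [::] q.1).
have one_out z z' z'' : to_a z' = 0 -> to_a z'' = 0 ->
    ins (l1 z) (l2 z' z'') X = linf (z :: linf [:: z'; z''] :: map fst X).
  move=> h' h''; apply: ins_nil => // [y s|s]; last exact: (linf_0 [:: z]).
  exact: (@linf_sm2 [::] z' [::] z'').
rewrite !two_out // three_in; last exact: (linf_0 [::]).
rewrite three_out !one_out //.
(* With a further entry, the outer bracket still has two entries from sm and more than two
   arguments. Without one, the Jacobi identity in m remains. *)
case: X {hpqrX two_out three_in three_out one_out} hX => [|x X] hX; last first.
  have e z z' z'' : to_a z = 0 -> to_a z' = 0 -> to_a z'' = 0 ->
      linf (z :: linf [:: z'; z''] :: map fst (x :: X)) = 0.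
    move=> h h' h''; apply: (@linf_sm2 [::] z [::]) => //; exact: linf2_a.
  by rewrite !e // !(scaler0, addr0).
have [[[pp _] [pq _]] [pr _]] := (hom_parity hp, hom_parity hq, hom_parity hr).
rewrite !(scaler0, add0r, addr0) [map _ _]/= !linf2_sm ?linf2_a //.
have toE (F : cochain g) : to_m (in_sm F) = F by [].
rewrite !toE.
rewrite -!in_smZ -!in_smD -[RHS]/(in_sm 0); congr in_sm.
rewrite (twist_parity pp) (twist_parity pq) (twist_parity pr) !(brkZl, brkZr).
rewrite (brkC pr (parity_brk pp pq)) (brkC pq (parity_brk pp pr)).
rewrite (brk_jacobi pp pq pr) /sg !oddzD oddz1.
by case: (oddz p.2); case: (oddz q.2); case: (oddz r.2);
  rewrite /= ?expr0 ?expr1; linear_over k.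
Qed.

Definition is_s p : bool := to_a p.1 == 0.
Definition pure p : bool := is_a p || is_s p.

(** By symmetry an entry outside a may be moved to the front. Three uses reduce the Jacobi
    identities to zero, one, two, or at least three leading entries from sm. *)
Lemma gsymp_pure_eq0 (H : seq (L * int) -> L) : gsymp (@sm_a_deg k g) H ->
  (forall X, hom X -> all is_a X -> H X = 0) ->
  (forall p X, to_a p.1 = 0 -> hom (p :: X) -> all pure X -> H (p :: X) = 0) ->
  forall X, hom X -> all pure X -> H X = 0.
Proof.
move=> sH h0 h1 X hX pX; have [|/allPn[p pX' np]] := boolP (all is_a X); first
  exact: h0.
case/splitPr: pX' hX pX => X1 X2 hX pX; rewrite (gsymp_move sH hX) h1 ?scaler0
  //.
- by move: pX; rewrite all_cat /= => /and3P[_ + _]; rewrite /pure (negPf np) =>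
  /eqP.
- by move: hX; rewrite !homp_cat /= homp_cat; tauto.
- by move: pX; rewrite !all_cat /= => /and3P[-> _ ->].
Qed.

Lemma jacobi_pure X : hom X -> all pure X -> ins linf linf X = 0.
Proof.
have mg := ins_swap (@linf_multilinear k g mu lam) (@linf_gsym k g mu lam)
  (@linf_gsym k g mu lam) (@linf_homog k g mu lam).
move: X; apply: (gsymp_pure_eq0 mg) => [X|p X ap [hp hX] pX]; first exact:
  jacobi_a.
apply: (gsymp_pure_eq0 (H := fun Y => ins linf linf (p :: Y)) _ _ _ hX pX).
- exact: (gsymp_cons hp mg).
- by move=> Y hY aY; apply: jacobi_sm1.
move=> q Y aq [hq hY] pY.
apply: (gsymp_pure_eq0 (H := fun Z => ins linf linf (p :: q :: Z)) _ _ _ hY pY).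
- exact: (gsymp_cons hq (gsymp_cons hp mg)).
- by move=> Z hZ aZ; apply: jacobi_sm2.
by move=> r Z ar [hr hZ] pZ; apply: jacobi_sm3.
Qed.

Lemma jacobi_homogeneous X : hom X -> ins linf linf X = 0.
Proof.
(* Each entry is split into its components by additivity; the prefix, empty at first, holds the
   entries already made pure. *)
move=> hX; rewrite -[X]cat0s; have: all pure [::] by [].
have: hom ([::] ++ X) by []; elim: X [::] {hX} => [|[z d] X IH] Y.
  by rewrite cats0; apply: jacobi_pure.
move=> hX pY; have ez : z = in_sm z.1 + in_a z.2.
  by case: z {hX} => f F; congr (_, _); rewrite /= ?addr0 ?add0r.
have [hY [[h1 h2] hX']] : hom Y /\ sm_a_deg d z /\ hom X by move: hX; rewrite
  homp_cat.
rewrite ez ins_additive; [|exact: linf_multilinear..].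
rewrite -!cat_rcons !IH ?addr0 //.
- by rewrite -cats1 !homp_cat /=; do !split.
- by rewrite all_rcons pY /pure /is_a eqxx.
- by rewrite -cats1 !homp_cat /=; do !split.
- by rewrite all_rcons pY /pure /is_s eqxx orbT.
Qed.

End Jacobi.

(** * The grading of sm + a *)

Section Grading.
Variables (k : fieldType) (g : lmodType k).

Lemma hpart_subproof (e : int) (F : cochain g) :
  (fun s => if (size s)%:Z == e + 1 then F s else 0) \in @cochain_pred k g.
Proof.
rewrite (_ : (fun s => _) =
  fun s => (if (size s)%:Z == e + 1 then 1 else 0) *: F s).
  exact: (cochain_scale_subproof (fun n : nat => if n%:Z == e + 1 then 1 else
    0)).
by apply: funext => s; case: ifP; rewrite ?scale0r ?scale1r.
Qed.

Definition hpart e F : cochain g := Cochain (hpart_subproof e F).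

Lemma cochain_deg_hpart e F : cochain_deg e (hpart e F).
Proof. by move=> s /eqP /negPf hs; rewrite /= hs. Qed.

(** The offset [c] lets both summands, whose degrees are shifted by one, be decomposed over the same
    range. *)
Lemma sum_hpart (F : cochain g) (M c : nat) :
  (forall s, (M <= size s + c)%N -> F s = 0) ->
  \sum_(0 <= i < M) hpart (i%:Z - c%:Z - 1) F = F.
Proof.
move=> hF; apply: cochain_eq => s; rewrite cochain_sum.
have e i : hpart (i%:Z - c%:Z - 1) F s = if i == (size s + c)%N then F s else 0.
  rewrite /=; case: eqP => h1; case: eqP => h2 //; exfalso.
    by apply: h2; lia.
  by apply: h1; lia.
under eq_bigr do rewrite e.
rewrite -big_mkcond big_nat1_eq; case: ifP => // /negbT.
by rewrite -leqNgt => /hF ->.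
Qed.

Lemma cochain_deg_free (ds : seq int) (c : int -> cochain g) (h : int) :
  uniq ds -> (forall d, cochain_deg (d + h) (c d)) -> \sum_(d <- ds) c d = 0 ->
  forall d, d \in ds -> c d = 0.
Proof.
move=> ud hc h0 d hd; apply: cochain_eq => s.
have [hs|/eqP hs] := eqVneq (size s)%:Z (d + h + 1); last exact: hc.
have := congr1 (fun F : cochain g => F s) h0; rewrite cochain_sum (bigD1_seq d)
  //=.
rewrite big1 ?addr0 // => e ne; apply: hc; rewrite hs => he.
by case/eqP: ne; lia.
Qed.

Lemma sm_a_is_grading : is_grading (@sm_a_deg k g).
Proof.
split.
- by move=> d; split.
- by move=> d a u v [hu1 hu2] [hv1 hv2]; split; apply: cochain_degD.
- move=> u; have [N1 h1] := cochain_bounded u.1; have [N2 h2] := cochain_bounded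
  u.2.
  pose c d : sm_a g := (hpart (d + 1) u.1, hpart d u.2).
  (* The least degree is -2: constants have degree -1 in m, hence -2 in sm. *)
  exists [seq i%:Z - 2 | i <- index_iota 0 (N1 + N2).+1], c; split.
    by move=> d; split; apply: cochain_deg_hpart.
  rewrite big_map (surjective_pairing (\sum_(i <- _) _))
    [LHS]surjective_pairing.
  rewrite !raddf_sum /=; congr (_, _).
    rewrite -[LHS](sum_hpart (M := (N1 + N2).+1) (c := 0)) => [|s hs].
      by apply: eq_bigr => i _; congr hpart; lia.
    by apply: h1; lia.
  rewrite -[LHS](sum_hpart (M := (N1 + N2).+1) (c := 1)) => [|s hs].
    by apply: eq_bigr => i _; congr hpart; lia.
  by apply: h2; lia.
- move=> ds c ud hc h0 d hd.
  rewrite [c d]surjective_pairing.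
  rewrite (@cochain_deg_free ds (fun d => (c d).1) 1) //; last 2 first.
  + by move=> e; case: (hc e).
  + by rewrite -(raddf_sum fst) h0.
  rewrite (@cochain_deg_free ds (fun d => (c d).2) 0) //.
  + by move=> e; rewrite addr0; case: (hc e).
  + by rewrite -(raddf_sum snd) h0.
Qed.

End Grading.

(** * The structure and its components *)

Section Main.
Variables (k : fieldType) (g : lmodType k) (mu lam : k).
Notation hom := (homp (@sm_a_deg k g)).
Notation linf := (@linf k g mu lam).

Lemma homp_zip (x : seq (sm_a g)) (d : seq int) : size d = size x ->
  (forall j, (j < size x)%N -> sm_a_deg d`_j x`_j) -> hom (zip x d).
Proof.
elim: x d => [|z x IH] [|e d] //= [] hs h; split; first exact: (h 0%N).
by apply: IH => // j hj; apply: (h j.+1).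
Qed.

Lemma linf_Linfty1 : is_Linfty1 (@sm_a_deg k g) linf.
Proof.
split.
- exact: sm_a_is_grading.
- exact: linf_multilinear.
- move=> x d _ sd h; have := linf_homog mu lam (homp_zip sd h).
  rewrite -[map fst _]/(unzip1 _) unzip1_zip ?sd //.
  by rewrite -(big_map snd xpredT id) -[map snd _]/(unzip2 _) unzip2_zip ?sd.
- move=> n x d s _ sx sd h.
  have hX : hom (zip x d) by apply: homp_zip; rewrite sx.
  have e1 : map fst (zip x d) = x by apply: unzip1_zip; rewrite sx sd.
  have e2 : map snd (zip x d) = d by apply: unzip2_zip; rewrite sx sd.
  have := gsymp_permuted s (@linf_gsym k g mu lam) _ hX.
  rewrite size_zip sx sd minnn => /(_ erefl).
  by rewrite (map_permuted fst) e1 e2.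
- move=> n x d _ sx sd h.
  have hX : hom (zip x d) by apply: homp_zip; rewrite sx.
  have e1 : map fst (zip x d) = x by apply: unzip1_zip; rewrite sx sd.
  have e2 : map snd (zip x d) = d by apply: unzip2_zip; rewrite sx sd.
  have sX : size (zip x d) = n by rewrite size_zip sx sd minnn.
  apply: etrans (jacobi_homogeneous mu lam hX); rewrite /ins
    -(sum_shuffle_unshuffle _ sX).
  (* The Jacobi identities start at i = 1, but [unshuffle] also has the term with an empty inner
     bracket, which is 0. *)
  rewrite [RHS]big_ltn // [X in _ = X + _]big1 => [|s _]; last first.
    have -> : linf (map fst (take 0 (permuted (0, 0) s (zip x d)))) = 0.
      by rewrite take0; apply: linf_a.
    by rewrite (linf_0 mu lam [::]) scaler0.
  rewrite add0r; apply: eq_bigr => i _; apply: eq_bigr => s _.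
  by rewrite map_take map_drop (map_permuted fst) e1 e2.
Qed.

(** All n + 1 slots of [f] are free, and the coefficient of 1 in T^(n+1) is -A_n. *)
Lemma linf_sm (n : int) (f : cochain g) : -1 <= n -> cochain_deg n f ->
  linf [:: in_sm f] = in_a (- (coefA mu lam n *: f)).
Proof.
move=> n_ge hf; rewrite linf_Phi //; congr (_, _); apply: cochain_eq => x.
rewrite -[LHS]/(ext mu lam f [seq (0, y) : dbl g | y <- x]).1.
have -> := @circA_ext _ _ mu lam n 0 f [::] [::] x hf I.
rewrite mulTnE !cochainE /= shuffle_sum1 /comp_tensor /= => [|t ht].
  rewrite big_ord0 expr0z scale1r drop0 subr0.
  by rewrite (_ : (absz (n + 1))%:Z - 1 = n) //; lia.
rewrite big_ord0 expr0z scale1r drop0 hf // => h; apply: ht; lia.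
Qed.

Lemma linf_higher (n : int) (f : cochain g) (m : seq int) (xi : seq (cochain g))
  x :
  (0 < size xi)%N -> cochain_deg n f -> degs m xi ->
  (linf (in_sm f :: map (@in_a k g) xi)).1 = 0 /\
  (linf (in_sm f :: map (@in_a k g) xi)).2 x =
    higher_bracket mu lam (size xi).+1 n f m (map (@cochain_fun k g) xi) x.
Proof.
move=> xi_gt0 hf h; rewrite linf_Phi // => [|y /mapP[F _ ->] //]; split=> //.
rewrite -(proj_brkA mu lam x hf h) /=; congr (proj _ _).
by rewrite /brkL /brkA; elim: (xi) (ext _ _ _) => //=.
Qed.

Lemma linf_other (y : seq (cochain g + cochain g)) :
  count (@is_sm k g) y <> 1%N -> ~ (count (@is_sm k g) y = 2%N /\ size y = 2%N)
    ->
  linf (map (@of_summand k g) y) = 0.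
Proof.
move=> n1 n2; have [|] := boolP (has (@is_sm k g) y); last first.
  move=> /hasPn h; apply: linf_a => z /mapP[t /h + ->].
  by case: t.
case/hasP => -[f|//] hf _; case/splitPr: hf n1 n2 => s1 s2 n1 n2.
have [s3 [s4 [s5 [f1 [f2 ey]]]]] : exists s3 s4 s5 f1 f2,
    s1 ++ inl f :: s2 = s3 ++ inl f1 :: s4 ++ inl f2 :: s5.
  have [|h2] := boolP (has (@is_sm k g) s2).
    case/hasP => -[f2|//] hf2 _; case/splitPr: hf2 {n1 n2} => s4 s5.
    by exists s1, s4, s5, f, f2.
  have [|h1] := boolP (has (@is_sm k g) s1).
    case/hasP => -[f1|//] hf1 _; case/splitPr: hf1 {n1 n2} => s3 s4.
    by exists s3, s4, s2, f1, f; rewrite -catA.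
  exfalso; apply: n1; move: h1 h2; rewrite !has_count -!eqn0Ngt => /eqP h1 /eqP
    h2.
  by rewrite count_cat /= h1 h2.
rewrite {}ey in n2 *; rewrite map_cat /= map_cat /= linf_sm2 // !size_cat
  !size_map.
rewrite lt0n; apply/negP; rewrite !addn_eq0 !size_eq0.
by move=> /and3P[/eqP e3 /eqP e4 /eqP e5]; apply: n2; rewrite e3 e4 e5.
Qed.

End Main.

Theorem theorem5p3 (k : fieldType) (char0 : [pchar k] =i pred0)
    (mu lam t : k) (t_sqrt : t ^+ 2 = mu ^+ 2 - 4 * lam) (g : lmodType k) :
  exists l : seq (sm_a g) -> sm_a g,
    [/\ is_Linfty1 (@sm_a_deg k g) l,
        (forall (n : int) (f : cochain g), -1 <= n -> cochain_deg n f ->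
           l [:: in_sm f] = in_a (- (coefA mu lam n *: f))),
        (forall (n m : int) (f f' : cochain g), -1 <= n -> -1 <= m ->
           cochain_deg n f -> cochain_deg m f' ->
           (l [:: in_sm f; in_sm f']).2 = 0 /\
           forall x : seq g, (l [:: in_sm f; in_sm f']).1 x =
             ((-1) ^ n : k) *: NR_bracket n m f f' x),
        (forall (i : nat) (n : int) (f : cochain g)
                (m : seq int) (xi : seq (cochain g)),
           (2 <= i)%N -> -1 <= n -> cochain_deg n f ->
           size m = i.-1 -> size xi = i.-1 ->
           (forall j, (j < i.-1)%N ->
              -1 <= m`_j /\ cochain_deg m`_j xi`_j) ->
           (l (in_sm f :: map (@in_a k g) xi)).1 = 0 /\
           forall x : seq g, (l (in_sm f :: map (@in_a k g) xi)).2 x =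
             higher_bracket mu lam i n f m (map (@cochain_fun k g) xi) x)
      & (* all other components vanish *)
        (forall y : seq (cochain g + cochain g),
           (0 < size y)%N -> count (@is_sm k g) y <> 1%N ->
           ~ (count (@is_sm k g) y = 2%N /\ size y = 2%N) ->
           l (map (@of_summand k g) y) = 0)].
Proof.
exists (@linf k g mu lam); split.
- exact: linf_Linfty1.
- exact: linf_sm.
- move=> n m f f' _ _ hf hf'; rewrite linf2_sm //; split=> // x.
  change (brk (twist f) f' x = (-1) ^ n *: NR_bracket n m f f' x).
  by rewrite (twist_deg hf) brkZl cochainZ NR_bracketE // signz.
- move=> [//|i] n f m xi hi _ hf sm sxi h.
  have hd : degs m xi.
    by apply: degs_nth; rewrite ?sm // sxi => j /h[].
  have xi_gt0 : (0 < size xi)%N by rewrite sxi.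
  split; first by case: (linf_higher mu lam [::] xi_gt0 hf hd).
  by move=> x; case: (linf_higher mu lam x xi_gt0 hf hd) => _ ->; rewrite sxi.
- by move=> y _; apply: linf_other.
Qed.
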